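(* Let $\ell\ge2$ be an integer and suppose that $\frac{\omega}{\ell-\frac12}\le h<\frac{\omega}{\ell-1}$. Let $\Phi=\{\varphi_j:1\le j\le 2\ell-1\}$ be a subset of $B_\omega$. Then $E_{\Phi,t_o}$ is a frame for $B_\omega$ if and only if there exist positive constants $\delta,\gamma,\sigma,\eta$ such that (1) $\delta\le\sum_{j=1}^{2\ell-1}|\widehat{\varphi_j}|^2\le\gamma$ a.e. in $(-\omega,\omega)$; (2) $[J_{\Phi,t_o}]_{2\ell-2}\ge\sigma$ a.e. in $K$; (3) $|\det J_{\Phi,t_o}|\ge\eta$ a.e. in $K_-\cup K_+$. If $h=\frac{\omega}{\ell-\frac12}$ (in which case $K$ is empty), then $E_{\Phi,t_o}$ is a Riesz basis for $B_\omega$ if and only if conditions (1) and (3) hold (for some positive constants $\delta,\gamma,\eta$).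
   Context: Conventions: $\hat f(\xi)=\frac{1}{\sqrt{2\pi}}\int f(t)e^{-it\xi}\,dt$ (extended to $L^2(\mathbb R)$); $\tau_a f(x)=f(x+a)$. Fix $\omega>0$ and $B_\omega=\{f\in L^2(\mathbb R):\operatorname{supp}\hat f\subset[-\omega,\omega]\}$. $t_o>0$ is a parameter and $h=2\pi/t_o$. For a finite family $\Phi=\{\varphi_1,\dots,\varphi_N\}\subset B_\omega$, $E_{\Phi,t_o}=\{\tau_{nt_o}\varphi_j: n\in\mathbb Z,\ 1\le j\le N\}$. $E_{\Phi,t_o}$ is a frame for $B_\omega$ if there are $0<A\le B$ with $A\|f\|^2\le\sum_{j=1}^N\sum_{n\in\mathbb Z}|\langle f,\tau_{nt_o}\varphi_j\rangle|^2\le B\|f\|^2$ for all $f\in B_\omega$; it is a Riesz basis if moreover the operator $c\mapsto\sum_{j}\sum_n c_j(n)\tau_{nt_o}\varphi_j$ from $\ell^2(\mathbb Z;\mathbb C^N)$ to $B_\omega$ is injective. Intervals (for $\frac{\omega}{\ell-1/2}\le h<\frac{\omega}{\ell-1}$): $K_-=(0,\ \omega-(\ell-1)h)$, $K=(\omega-(\ell-1)h,\ -\omega+\ell h)$, $K_+=(-\omega+\ell h,\ h)$. Pre-Gramian: for $x\in[0,h]$, $J_{\Phi,t_o}(x)$ is the $(2\ell-1)\times(2\ell-1)$ matrix with entries $\sqrt h\,\widehat{\varphi_i}(x+jh)$, columns indexed by $i=1,\dots,2\ell-1$, and rows indexed, in increasing order, by $j=-(\ell-1),\dots,\ell-1$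 for $x\in K_-\cup K$ (the last row, $j=\ell-1$, being zero for a.e. $x\in K$), and by $j=-\ell,\dots,\ell-2$ for $x\in K_+$ (all the other rows $j\in\mathbb Z$ vanish a.e. on the respective intervals). $[J]_n$ denotes the sum of the squares of the absolute values of the minors of order $n$ of the matrix $J$. *)

(* Defs.v *)
From mathcomp Require Import all_boot all_order all_algebra.
From mathcomp Require Import complex.
From mathcomp Require Import all_classical all_reals all_analysis.

Set Implicit Arguments.
Unset Strict Implicit.
Unset Printing Implicit Defensive.

Import Order.TTheory GRing.Theory Num.Theory.
Import ComplexField.Normc.
Import numFieldNormedType.Exports.

Local Open Scope classical_set_scope.
Local Open Scope ring_scope.
Local Open Scope complex_scope.

Section ComplexL2.
Variable R : realType.
Implicit Types (f g : R -> R[i]).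

Notation mu := (@lebesgue_measure R).

Definition cmeasurable f : Prop :=
  measurable_fun [set: R] (fun x => complex.Re (f x)) /\
  measurable_fun [set: R] (fun x => complex.Im (f x)).

Definition cintegral f : R[i] :=
  (\int[mu]_x complex.Re (f x)) +i* (\int[mu]_x complex.Im (f x)).

Definition L1norm f : \bar R := (\int[mu]_x (normc (f x))%:E)%E.

Definition L2norm_sq f : \bar R := (\int[mu]_x (normc (f x) ^+ 2)%:E)%E.

Definition L1 : set (R -> R[i]) :=
  [set f | cmeasurable f /\ (L1norm f < +oo)%E].

(* Elements of the L^p spaces are represented by functions; two functions that
   agree almost everywhere are the same element. *)
Definition L2 : set (R -> R[i]) :=
  [set f | cmeasurable f /\ (L2norm_sq f < +oo)%E].

Definition L2inner f g : R[i] := cintegral (fun x => f x * (g x)^*).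

Definition L2cvg (u : nat -> R -> R[i]) f : Prop :=
  (fun n => L2norm_sq (fun x => u n x - f x)) @ \oo --> 0%E.

Definition expi (t : R) : R[i] := cos t +i* sin t.

Definition fourier_L1 f (xi : R) : R[i] :=
  ((Num.sqrt (2 * pi))^-1)%:C * cintegral (fun t => f t * expi (- (t * xi))).

(* [fourier f g]: g represents the Fourier transform of f, where the transform
   on L^2 is the extension by continuity of the integral formula from the dense
   subspace of L^1 `&` L^2.  It is a relation because the transform is only
   determined up to null sets. *)
Definition fourier f g : Prop :=
  [/\ L2 f, L2 g &
    exists u : nat -> R -> R[i],
      [/\ forall n, (L1 `&` L2) (u n),
          L2cvg u f &
          L2cvg (fun n => fourier_L1 (u n)) g]].

Definition ess_supp f : set R :=
  [set x | forall U : set R, nbhs x U -> ~ {ae mu, forall y, U y -> f y = 0}].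

Definition bandlimited (omega : R) : set (R -> R[i]) :=
  [set f | L2 f /\
    exists2 g, fourier f g & ess_supp g `<=` `[- omega, omega]%classic].

Definition translate (a : R) f : R -> R[i] := fun x => f (x + a).

Section Systems.
Variables (omega t0 : R) (N : nat) (phi : 'I_N -> R -> R[i]).

Definition is_frame : Prop :=
  exists A B : R, [/\ 0 < A, A <= B &
    forall f, bandlimited omega f ->
      let S := (\sum_(j < N) \esum_(n in [set: int])
                  (normc (L2inner f (translate (n%:~R * t0) (phi j))) ^+ 2)%:E)%E in
      (A%:E * L2norm_sq f <= S)%E /\ (S <= B%:E * L2norm_sq f)%E].

Definition ell2 : set (int -> 'I_N -> R[i]) :=
  [set c | (\esum_(n in [set: int])
              (\sum_(j < N) normc (c n j) ^+ 2)%:E < +oo)%E].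

(* k-th symmetric partial sum: n ranges over -k, ..., k *)
Definition synthesis_partial (c : int -> 'I_N -> R[i]) (k : nat) : R -> R[i] :=
  fun x => \sum_(j < N) \sum_(m < (2 * k).+1)
    c (m%:Z - k%:Z) j * translate ((m%:Z - k%:Z)%:~R * t0) (phi j) x.

(* [synthesis c f]: the synthesis operator maps c to (the class of) f. *)
Definition synthesis (c : int -> 'I_N -> R[i]) f : Prop :=
  bandlimited omega f /\ L2cvg (synthesis_partial c) f.

Definition is_riesz_basis : Prop :=
  is_frame /\
  forall c c' : int -> 'I_N -> R[i], ell2 c -> ell2 c' ->
    forall f, synthesis c f -> synthesis c' f ->
      forall n j, c n j = c' n j.

End Systems.

(* Sum of the squared moduli of the minors of order n; the row and column
   selections are the strictly increasing maps from 'I_n. *)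
Definition minors_sq (p q n : nat) (J : 'M[R[i]]_(p, q)) : R :=
  let incr m (s : {ffun 'I_n -> 'I_m}) :=
    [forall a : 'I_n, forall b : 'I_n, (a < b)%N ==> (s a < s b)%N] in
  \sum_(r : {ffun 'I_n -> 'I_p} | incr p r)
    \sum_(s : {ffun 'I_n -> 'I_q} | incr q s)
      normc (\det (mxsub r s J)) ^+ 2.

Definition Kminus (omega h : R) (l : nat) : interval R :=
  `]0, (omega - (l%:R - 1) * h)[.

Definition Kmid (omega h : R) (l : nat) : interval R :=
  `](omega - (l%:R - 1) * h), (- omega + l%:R * h)[.

Definition Kplus (omega h : R) (l : nat) : interval R :=
  `](- omega + l%:R * h), h[.

(* The rows are j = -(l-1), ..., l-1 outside K_+ and j = -l, ..., l-2 on K_+;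
   the value at the endpoints of the intervals is immaterial. *)
Definition preGramian (omega t0 : R) (l : nat)
    (phihat : 'I_(2 * l - 1) -> R -> R[i]) (x : R) : 'M[R[i]]_(2 * l - 1) :=
  let h := 2 * pi / t0 in
  let j (r : nat) : int :=
    r%:Z - (if x \in Kplus omega h l then l%:Z else l%:Z - 1) in
  \matrix_(r, i) ((Num.sqrt h)%:C * phihat i (x + (j r)%:~R * h)).

End ComplexL2.

(* Main.v *)
(* For f in B_omega with transform g, the coefficient <f, tau_(n t0) phi_j> is,
   by Plancherel, the Fourier coefficient at n t0 of the h-periodization of g * conj(phihat_j), so
   Parseval on [0, h[ turns the frame inequalities into
     A |w|^2 <= h \sum_j |\sum_k w_k conj(phihat_j(x + (k - l) h))|^2 <= B |w|^2
   for a.e. x in [0, h[ and all vectors w supported on the k with x + (k - l) h in [-omega, omega].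
   On K_- and K_+ these are bounds on the square matrix J(x), that is, on its entries and its
   determinant; on K the last row of J(x) vanishes and the remaining 2l - 2 rows are bounded below iff
   some minor of order 2l - 2 is.  When K is empty, the determinant bound also gives
   |c|^2 <= C |\sum c_j(n) tau_(n t0) phi_j|^2 for finite c, hence injectivity of the synthesis.

   Plancherel is obtained from
     \int e^(-e |x|) |FT u (x)|^2 dx = 2 pi |u|^2 - pi \int P_e(y) |tau_y u - u|^2 dy
   (P_e the Poisson kernel) by letting e tend to 0.  Parseval follows by averaging the Bessel
   inequality for the shifted systems e^(i (n t0 + s) x) over s in [0, t0[: by Plancherel no loss is
   possible on average, and the Bessel sums depend continuously on s. *)
Require Import Defs.
From HB Require Import structures.
From mathcomp Require Import all_boot all_order all_algebra.
From mathcomp Require Import complex ring lra.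
From mathcomp Require Import all_classical all_reals all_analysis measurable_realfun zify perm.
Set Implicit Arguments.
Unset Strict Implicit.
Unset Printing Implicit Defensive.
Import Order.TTheory GRing.Theory Num.Theory.
Import ComplexField.Normc.
Import numFieldNormedType.Exports.
Local Open Scope classical_set_scope.
Local Open Scope ring_scope.
Local Open Scope complex_scope.
(* [x ^*] parses as [Num.conj x] in [ring_scope]; the two conjugations are only convertible. *)
Local Notation "x ^*" := (conjc x) : ring_scope.
Local Opaque pi.

(** * Complex numbers *)

Section csq.
Context {R : realType}.
Implicit Types x y z : R[i].

(** As [omega <= (l - 1/2) h], the band is no longer than [(2l - 1) h]. Over a generic [x] in [0, h[
    the points [x + j h] in the band have [-l <= j <= l - 1]: there are [2l - 1] of them over K_-
    and K_+, but only [2l - 2] over K. With [2l - 1] generators the fiber matrices are therefore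
    square off K and have one row too few on K. The delicate direction leads from the frame
    inequalities to the fibers. Functions with a prescribed transform must exist ([fourier_surj]).
    Parseval requires the periodized products to be square integrable, whereas a product of two L2
    functions is only integrable; the tests are thus confined to sets where the fiber sum is
    bounded. The exceptional null set must not depend on the vector [w]; it is chosen for rational
    vectors and a limit is taken at each fixed point. Sizes are kept squared ([csq], [n2]), so that
    the algebra is polynomial in real and imaginary parts. *)

Definition csq z : R := complex.Re z ^+ 2 + complex.Im z ^+ 2.

Lemma cReM x y : complex.Re (x * y) =
  complex.Re x * complex.Re y - complex.Im x * complex.Im y.
Proof. by case: x => a b; case: y. Qed.

Lemma cImM x y : complex.Im (x * y) =
  complex.Re x * complex.Im y + complex.Im x * complex.Re y.
Proof. by case: x => a b; case: y. Qed.

Lemma cReD x y : complex.Re (x + y) = complex.Re x + complex.Re y.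
Proof. by case: x => a b; case: y. Qed.

Lemma cImD x y : complex.Im (x + y) = complex.Im x + complex.Im y.
Proof. by case: x => a b; case: y. Qed.

Lemma cReN x : complex.Re (- x) = - complex.Re x.
Proof. by case: x. Qed.

Lemma cImN x : complex.Im (- x) = - complex.Im x.
Proof. by case: x. Qed.

Lemma cReJ x : complex.Re (x^*) = complex.Re x.
Proof. by case: x. Qed.

Lemma cImJ x : complex.Im (x^*) = - complex.Im x.
Proof. by case: x. Qed.

Lemma conjcM x y : (x * y)^* = x^* * y^*.
Proof. exact: rmorphM. Qed.

Lemma conjcD x y : (x + y)^* = x^* + y^*.
Proof. exact: rmorphD. Qed.

Lemma complex_eqP x y : complex.Re x = complex.Re y ->
  complex.Im x = complex.Im y -> x = y.
Proof. by case: x => a b; case: y => c d /= -> ->. Qed.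

Lemma conjc_real (r : R) : (r%:C)^* = r%:C :> R[i].
Proof. by apply: complex_eqP; rewrite /= ?oppr0. Qed.

Lemma conjc0 : (0 : R[i])^* = 0.
Proof. exact: (conjc_real 0). Qed.

Lemma conjc_sum I (s : seq I) (F : I -> R[i]) : (\sum_(i <- s) F i)^* = \sum_(i <- s) (F i)^*.
Proof. exact: (big_morph _ conjcD conjc0). Qed.

Lemma conjc_conjc x : (x^*)^* = x.
Proof. by case: x => a b; rewrite /= opprK. Qed.

Definition reimE := (cReM, cImM, cReD, cImD, cReN, cImN, cReJ, cImJ).

Lemma cReMr (r : R) x : complex.Re (r%:C * x) = r * complex.Re x.
Proof. by rewrite cReM /= mul0r subr0. Qed.

Lemma cImMr (r : R) x : complex.Im (r%:C * x) = r * complex.Im x.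
Proof. by rewrite cImM /= mul0r addr0. Qed.

Lemma cRe_sum I (s : seq I) (P : pred I) (F : I -> R[i]) :
  complex.Re (\sum_(i <- s | P i) F i) = \sum_(i <- s | P i) complex.Re (F i).
Proof. by apply: (big_morph _ cReD). Qed.

Lemma cIm_sum I (s : seq I) (P : pred I) (F : I -> R[i]) :
  complex.Im (\sum_(i <- s | P i) F i) = \sum_(i <- s | P i) complex.Im (F i).
Proof. by apply: (big_morph _ cImD). Qed.

Lemma normc_sq z : normc z ^+ 2 = csq z.
Proof. by case: z => a b; rewrite /normc /csq /= sqr_sqrtr// addr_ge0// sqr_ge0. Qed.

Lemma normc_sqrt z : normc z = Num.sqrt (csq z).
Proof. by case: z. Qed.

Lemma normc_ge0 z : 0 <= normc z.
Proof. by rewrite normc_sqrt sqrtr_ge0. Qed.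

Lemma csq_ge0 z : 0 <= csq z.
Proof. by rewrite /csq addr_ge0// sqr_ge0. Qed.

Lemma csqM x y : csq (x * y) = csq x * csq y.
Proof. by rewrite /csq !reimE; ring. Qed.

Lemma csqJ x : csq (x^*) = csq x.
Proof. by rewrite /csq !reimE sqrrN. Qed.

Lemma csqN x : csq (- x) = csq x.
Proof. by rewrite /csq !reimE !sqrrN. Qed.

Lemma csq0 : csq (0 : R[i]) = 0.
Proof. by rewrite /csq /= expr0n addr0. Qed.

Lemma csq_real (r : R) : csq (r%:C) = r ^+ 2.
Proof. by rewrite /csq /= [0 ^+ 2]expr0n addr0. Qed.

Lemma csqE x : x * x^* = (csq x)%:C.
Proof. by apply: complex_eqP; rewrite !reimE /csq /=; ring. Qed.

Lemma csq_eq0 x : csq x = 0 -> x = 0.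
Proof. by rewrite -normc_sq => /eqP; rewrite sqrf_eq0 => /eqP /eq0_normc. Qed.

Lemma csqD_le x y : csq (x + y) <= 2 * csq x + 2 * csq y.
Proof.
rewrite -subr_ge0.
have -> : 2 * csq x + 2 * csq y - csq (x + y) = csq (x - y).
  by rewrite /csq !reimE; ring.
exact: csq_ge0.
Qed.

(** Young's inequality: unlike in [csqD_le], the factor of [csq x] can be taken as close to 1 as
    desired, which keeps constants sharp in limits. *)
Lemma csqD_eta (eta : R) x y : 0 < eta ->
  csq (x + y) <= (1 + eta) * csq x + (1 + eta^-1) * csq y.
Proof.
move=> e0; rewrite /csq !reimE -subr_ge0.
set a := complex.Re x; set b := complex.Im x.
set c := complex.Re y; set d := complex.Im y.
have -> : (1 + eta) * (a ^+ 2 + b ^+ 2) + (1 + eta^-1) * (c ^+ 2 + d ^+ 2) -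
  ((a + c) ^+ 2 + (b + d) ^+ 2) =
  eta * ((a - eta^-1 * c) ^+ 2 + (b - eta^-1 * d) ^+ 2).
  by field; rewrite gt_eqF.
by rewrite mulr_ge0// ?addr_ge0 ?sqr_ge0// ltW.
Qed.

Lemma csq_sum_le n (F : 'I_n -> R[i]) :
  csq (\sum_i F i) <= n%:R * \sum_i csq (F i).
Proof.
have sumsq (G : 'I_n -> R) : (\sum_i G i) ^+ 2 <= n%:R * \sum_i (G i) ^+ 2.
  (* Expanded, this double sum is [2 * n] times the sum of the squares minus twice the square of the
     sum. *)
  have : 0 <= \sum_(i < n) \sum_(j < n) (G i - G j) ^+ 2.
    by apply: sumr_ge0 => i _; apply: sumr_ge0 => j _; exact: sqr_ge0.
  under eq_bigr do under eq_bigr do rewrite sqrrB.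
  under eq_bigr do rewrite big_split big_split/= sumr_const card_ord.
  rewrite big_split big_split/= sumr_const card_ord.
  rewrite -sumrMnl -mulr_natl.
  have -> : \sum_(i < n) \sum_(j < n) - (G i * G j *+ 2) = - ((\sum_i G i) ^+ 2 *+ 2).
    rewrite expr2 mulr_suml -sumrMnl -sumrN; apply: eq_bigr => i _.
    by rewrite mulr_sumr -sumrMnl -sumrN.
  under eq_bigr do rewrite -mulr_natl.
  rewrite -mulr_sumr; lra.
rewrite /csq cRe_sum cIm_sum big_split /= mulrDr.
by apply: lerD; exact: sumsq.
Qed.

Lemma expi0 : expi (0 : R) = 1.
Proof. by rewrite /expi cos0 sin0. Qed.

Lemma expiD (s t : R) : expi (s + t) = expi s * expi t.
Proof. by apply: complex_eqP; rewrite !reimE /= ?cosD ?sinD //; ring. Qed.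

Lemma expiJ (s : R) : (expi s)^* = expi (- s).
Proof. by apply: complex_eqP; rewrite !reimE /= ?cosN ?sinN. Qed.

Lemma csq_expi (s : R) : csq (expi s) = 1.
Proof. by rewrite /csq /= cos2Dsin2. Qed.

Lemma csqMexpi x (s : R) : csq (x * expi s) = csq x.
Proof. by rewrite csqM csq_expi mulr1. Qed.

Lemma normr_sin_le (s : R) : `|sin s| <= `|s|.
Proof.
wlog s0 : s / 0 <= s.
  move=> H; have [/H//|/ltW] := leP 0 s.
  by rewrite -oppr_ge0 => /H; rewrite sinN !normrN.
have [|c _] := @MVT_segment R sin cos 0 s s0 (fun (r : R) _ => is_derive_sin r).
  by apply: continuous_subspaceT => x; exact: continuous_sin.
rewrite sin0 !subr0 => ->; rewrite normrM ler_piMl// .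
by rewrite ler_norml cos_geN1 cos_le1.
Qed.

Lemma csq_expi1 (s : R) : csq (expi s - 1) <= s ^+ 2.
Proof.
rewrite /csq !reimE /=.
have -> : (cos s - 1) ^+ 2 + (sin s - 0) ^+ 2 = 4 * (sin (s / 2)) ^+ 2.
  have h : s = s / 2 + s / 2 by rewrite -splitr.
  rewrite [in LHS]h cosD sinD; have := cos2Dsin2 (s / 2).
  set c := cos _; set d := sin _ => cd.
  rewrite subr0.
  have c2 : c * c = 1 - d ^+ 2 by rewrite -cd addrK.
  have -> : (d * c + c * d) ^+ 2 = 4 * d ^+ 2 * (c * c) by ring.
  by rewrite c2; ring.
rewrite (_ : s ^+ 2 = 4 * (s / 2) ^+ 2); last by field.
rewrite ler_pM2l// -[leLHS]real_normK ?num_real// -[leRHS]real_normK ?num_real//.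
by rewrite lerXn2r// ?nnegrE// normr_sin_le.
Qed.

Lemma le_Re_normc x : `|complex.Re x| <= normc x.
Proof.
by rewrite normc_sqrt -sqrtr_sqr ler_wsqrtr// /csq lerDl sqr_ge0.
Qed.

Lemma le_Im_normc x : `|complex.Im x| <= normc x.
Proof.
by rewrite normc_sqrt -sqrtr_sqr ler_wsqrtr// /csq lerDr sqr_ge0.
Qed.

Lemma normc_le_ReIm x : normc x <= `|complex.Re x| + `|complex.Im x|.
Proof.
rewrite normc_sqrt -[leRHS]ger0_norm ?addr_ge0// -sqrtr_sqr ler_wsqrtr//.
rewrite /csq sqrrD !real_normK ?num_real//.
by rewrite [in leRHS]addrAC lerDl mulrn_wge0// mulr_ge0.
Qed.

Lemma normc_le_csq x y : normc (x * y) <= csq x + csq y.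
Proof.
rewrite normcM; have := normc_sq x; have := normc_sq y.
have := normc_ge0 x; have := normc_ge0 y; nra.
Qed.

End csq.

(** * Complex integrals and square-integrable functions *)

Section cmf.
Context {d} {T : measurableType d} {R : realType}.
Implicit Types f g : T -> R[i].

Definition cmf f : Prop :=
  measurable_fun [set: T] (fun x => complex.Re (f x)) /\
  measurable_fun [set: T] (fun x => complex.Im (f x)).

Lemma cmf_cst (z : R[i]) : cmf (fun=> z).
Proof. by split; exact: measurable_cst. Qed.

Lemma cmf_real (r : T -> R) : measurable_fun setT r -> cmf (fun x => (r x)%:C).
Proof. by move=> mr; split => //=; exact: measurable_cst. Qed.

Lemma cmfD f g : cmf f -> cmf g -> cmf (fun x => f x + g x).
Proof.
move=> [fr fi] [gr gi]; split.
  by under eq_fun do rewrite cReD; exact: measurable_funD.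
by under eq_fun do rewrite cImD; exact: measurable_funD.
Qed.

Lemma cmfN f : cmf f -> cmf (fun x => - f x).
Proof.
move=> [fr fi]; split.
  by under eq_fun do rewrite cReN; exact: measurableT_comp.
by under eq_fun do rewrite cImN; exact: measurableT_comp.
Qed.

Lemma cmfB f g : cmf f -> cmf g -> cmf (fun x => f x - g x).
Proof. by move=> mf mg; apply: cmfD => //; exact: cmfN. Qed.

Lemma cmfM f g : cmf f -> cmf g -> cmf (fun x => f x * g x).
Proof.
move=> [fr fi] [gr gi]; split.
  by under eq_fun do rewrite cReM; apply: measurable_funB; exact: measurable_funM.
by under eq_fun do rewrite cImM; apply: measurable_funD; exact: measurable_funM.
Qed.

Lemma cmfJ f : cmf f -> cmf (fun x => (f x)^*).
Proof.
move=> [fr fi]; split.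
  by under eq_fun do rewrite cReJ.
by under eq_fun do rewrite cImJ; exact: measurableT_comp.
Qed.

Lemma cmf_sum I (s : seq I) (P : pred I) (F : I -> T -> R[i]) :
  (forall i, cmf (F i)) -> cmf (fun x => \sum_(i <- s | P i) F i x).
Proof.
move=> mF; split.
  under eq_fun do rewrite cRe_sum.
  elim: s => [|i s ih].
    by under eq_fun do rewrite big_nil; exact: measurable_cst.
  under eq_fun do rewrite big_cons; case: (P i) => //.
  by apply: measurable_funD => //; exact: (mF i).1.
under eq_fun do rewrite cIm_sum.
elim: s => [|i s ih].
  by under eq_fun do rewrite big_nil; exact: measurable_cst.
under eq_fun do rewrite big_cons; case: (P i) => //.
by apply: measurable_funD => //; exact: (mF i).2.
Qed.

Lemma cmf_expi (r : T -> R) : measurable_fun setT r -> cmf (fun x => expi (r x)).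
Proof.
move=> mr; split => /=; apply: measurableT_comp mr.
  by apply: continuous_measurable_fun; exact: continuous_cos.
by apply: continuous_measurable_fun; exact: continuous_sin.
Qed.

Lemma measurable_csq f : cmf f -> measurable_fun setT (fun x => csq (f x)).
Proof. by move=> [fr fi]; apply: measurable_funD; exact: measurable_funX. Qed.

Lemma measurable_normc f : cmf f -> measurable_fun setT (fun x => normc (f x)).
Proof.
move=> mf; under eq_fun do rewrite normc_sqrt.
have ms : measurable_fun [set: R] (Num.sqrt : R -> R).
  by apply: continuous_measurable_fun; exact: sqrt_continuous.
exact: (measurableT_comp ms (measurable_csq mf)).
Qed.

Lemma measurable_csqE f : cmf f -> measurable_fun setT (fun x => (csq (f x))%:E).
Proof. by move=> mf; apply/measurable_EFinP; exact: measurable_csq. Qed.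

End cmf.

Lemma cmf_comp {d d'} {T : measurableType d} {T' : measurableType d'} {R : realType}
    (f : T -> R[i]) (phi : T' -> T) : measurable_fun setT phi -> cmf f ->
  cmf (fun x => f (phi x)).
Proof.
by move=> mphi [fr fi]; split; [apply: measurableT_comp fr mphi|apply: measurableT_comp fi mphi].
Qed.

Section intR.
Context {d} {T : measurableType d} {R : realType}.
Variables (mu : {measure set T -> \bar R}) (D : set T).
Hypothesis mD : measurable D.
Implicit Types f g : T -> R.

Lemma intRD f g : mu.-integrable D (EFin \o f) -> mu.-integrable D (EFin \o g) ->
  mu.-integrable D (EFin \o (fun x => f x + g x)).
Proof. by move=> If Ig; exact: (integrableD mD If Ig). Qed.

Lemma intRB f g : mu.-integrable D (EFin \o f) -> mu.-integrable D (EFin \o g) ->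
  mu.-integrable D (EFin \o (fun x => f x - g x)).
Proof. by move=> If Ig; exact: (integrableB mD If Ig). Qed.

Lemma intRZ (k : R) f : mu.-integrable D (EFin \o f) ->
  mu.-integrable D (EFin \o (fun x => k * f x)).
Proof. by move=> If; exact: (integrableZl mD k If). Qed.

End intR.

Section cint.
Context {d} {T : measurableType d} {R : realType}.
Variable mu : {measure set T -> \bar R}.
Implicit Types f g : T -> R[i].

Definition cint f : R[i] :=
  (\int[mu]_x complex.Re (f x)) +i* (\int[mu]_x complex.Im (f x)).

Definition cintb f : Prop :=
  mu.-integrable setT (fun x => (complex.Re (f x))%:E) /\
  mu.-integrable setT (fun x => (complex.Im (f x))%:E).

Lemma cintb_cmf f : cintb f -> cmf f.
Proof.
by move=> [fr fi]; split; apply/measurable_EFinP;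
  [exact: measurable_int fr|exact: measurable_int fi].
Qed.

Lemma cintb_dom f (g : T -> R) : cmf f -> mu.-integrable setT (EFin \o g) ->
  (forall x, normc (f x) <= g x) -> cintb f.
Proof.
move=> [fr fi] ig fg; split.
  apply: le_integrable ig => //; first exact/measurable_EFinP.
  move=> x _ /=; rewrite lee_fin (le_trans (le_Re_normc _))// (le_trans (fg x))//.
  exact: ler_norm.
apply: le_integrable ig => //; first exact/measurable_EFinP.
move=> x _ /=; rewrite lee_fin (le_trans (le_Im_normc _))// (le_trans (fg x))//.
exact: ler_norm.
Qed.

Lemma cintb_normc f : cintb f -> mu.-integrable setT (fun x => (normc (f x))%:E).
Proof.
move=> If; have mf := cintb_cmf If.
have h : mu.-integrable setT
    (fun x => `|(complex.Re (f x))%:E| + `|(complex.Im (f x))%:E|)%E.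
  by apply: integrableD => //; apply: integrable_abse; [exact: If.1|exact: If.2].
apply: le_integrable h => //.
  by apply/measurable_EFinP; exact: measurable_normc.
move=> x _ /=; rewrite lee_fin ger0_norm ?normc_ge0// ger0_norm ?addr_ge0//.
exact: normc_le_ReIm.
Qed.

Lemma cintb_fin f : cmf f -> (\int[mu]_x (normc (f x))%:E < +oo)%E -> cintb f.
Proof.
move=> mf fin; apply: (@cintb_dom _ (fun x => normc (f x))) => //.
apply/integrableP; split.
  by apply/measurable_EFinP; exact: measurable_normc.
rewrite (le_lt_trans _ fin)//; apply: ge0_le_integral => //.
- apply: measurableT_comp => //.
  by apply/measurable_EFinP; exact: measurable_normc.
- by apply/measurable_EFinP; exact: measurable_normc.
- by move=> x _ /=; rewrite lee_fin ger0_norm// normc_ge0.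
Qed.

Lemma cintbD f g : cintb f -> cintb g -> cintb (fun x => f x + g x).
Proof.
move=> [fr fi] [gr gi]; split.
  by under eq_fun do rewrite cReD EFinD; exact: integrableD.
by under eq_fun do rewrite cImD EFinD; exact: integrableD.
Qed.

Lemma cintbN f : cintb f -> cintb (fun x => - f x).
Proof.
move=> [fr fi]; split.
  by under eq_fun do rewrite cReN EFinN; exact: integrableN.
by under eq_fun do rewrite cImN EFinN; exact: integrableN.
Qed.

Lemma cintbB f g : cintb f -> cintb g -> cintb (fun x => f x - g x).
Proof. by move=> fi gi; apply: cintbD => //; exact: cintbN. Qed.

Lemma cintbZ (z : R[i]) f : cintb f -> cintb (fun x => z * f x).
Proof.
move=> [fr fi]; split.
  under eq_fun do rewrite cReM EFinB !EFinM.
  by apply: integrableB => //; exact: integrableZl.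
under eq_fun do rewrite cImM EFinD !EFinM.
by apply: integrableD => //; exact: integrableZl.
Qed.

Lemma cintbJ f : cintb f -> cintb (fun x => (f x)^*).
Proof.
move=> [fr fi]; split; first by under eq_fun do rewrite cReJ.
by under eq_fun do rewrite cImJ EFinN; exact: integrableN.
Qed.

Lemma cintb0 : cintb (fun=> 0).
Proof. by split; exact: integrable0. Qed.

Lemma cintb_sum I (s : seq I) (F : I -> T -> R[i]) :
  (forall i, cintb (F i)) -> cintb (fun x => \sum_(i <- s) F i x).
Proof.
move=> iF; elim: s => [|i s ih].
  by under eq_fun do rewrite big_nil; exact: cintb0.
by under eq_fun do rewrite big_cons; exact: cintbD.
Qed.

Lemma eq_cint f g : f =1 g -> cint f = cint g.
Proof. by move=> /funext ->. Qed.

Lemma cintD f g : cintb f -> cintb g ->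
  cint (fun x => f x + g x) = cint f + cint g.
Proof.
move=> [fr fi] [gr gi]; apply: complex_eqP; rewrite !reimE /=.
  by under eq_Rintegral do rewrite cReD; rewrite RintegralD.
by under eq_Rintegral do rewrite cImD; rewrite RintegralD.
Qed.

Lemma cintZ (z : R[i]) f : cintb f -> cint (fun x => z * f x) = z * cint f.
Proof.
move=> [fr fi]; apply: complex_eqP; rewrite !reimE /=.
  under eq_Rintegral do rewrite cReM; rewrite RintegralB//.
  - by rewrite !RintegralZl.
  - exact: intRZ.
  - exact: intRZ.
under eq_Rintegral do rewrite cImM; rewrite RintegralD//.
- by rewrite !RintegralZl.
- exact: intRZ.
- exact: intRZ.
Qed.

Lemma cintZr (z : R[i]) f : cintb f -> cint (fun x => f x * z) = cint f * z.
Proof. by move=> fi; rewrite mulrC -cintZ//; apply: eq_cint => x; rewrite mulrC. Qed.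

Lemma cintJ f : cintb f -> cint (fun x => (f x)^*) = (cint f)^*.
Proof.
move=> [fr fi]; apply: complex_eqP; rewrite !reimE /=.
  by under eq_Rintegral do rewrite cReJ.
under eq_Rintegral do rewrite cImJ -mulN1r.
by rewrite RintegralZl// mulN1r.
Qed.

Lemma cint0 : cint (fun=> 0) = 0.
Proof. by apply: complex_eqP => /=; rewrite Rintegral_cst// mul0r. Qed.

Lemma cint_sum I (s : seq I) (F : I -> T -> R[i]) :
  (forall i, cintb (F i)) ->
  cint (fun x => \sum_(i <- s) F i x) = \sum_(i <- s) cint (F i).
Proof.
move=> iF; elim: s => [|i s ih].
  by rewrite big_nil -[RHS]cint0; apply: eq_cint => x; rewrite big_nil.
rewrite big_cons -ih -cintD//; last exact: cintb_sum.
by apply: eq_cint => x; rewrite big_cons.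
Qed.

(** The factor 2 comes from treating real and imaginary parts separately; the later uses only ask
    for some bound. *)
Lemma normc_cint_le f : cintb f -> normc (cint f) <= 2 * \int[mu]_x normc (f x).
Proof.
move=> If; have [fr fi] := If; rewrite (le_trans (normc_le_ReIm _))//=.
rewrite mulrDl mul1r lerD//.
  rewrite (le_trans (le_normr_Rintegral _ _))// le_Rintegral//.
  - exact: (integrable_abse fr).
  - exact: cintb_normc.
  - by move=> x _; exact: le_Re_normc.
rewrite (le_trans (le_normr_Rintegral _ _))// le_Rintegral//.
- exact: (integrable_abse fi).
- exact: cintb_normc.
- by move=> x _; exact: le_Im_normc.
Qed.

Lemma cintb_real (r : T -> R) : mu.-integrable setT (EFin \o r) ->
  cintb (fun x => (r x)%:C).
Proof. by move=> ir; split => //=; exact: integrable0. Qed.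

Lemma cint_real (r : T -> R) :
  cint (fun x => (r x)%:C) = (\int[mu]_x r x)%:C.
Proof. by apply: complex_eqP => //=; rewrite Rintegral_cst// mul0r. Qed.

End cint.

Section L2.
Context {d} {T : measurableType d} {R : realType}.
Variable mu : {measure set T -> \bar R}.
Implicit Types f g : T -> R[i].

Definition sq2 f : \bar R := (\int[mu]_x (csq (f x))%:E)%E.

Definition inL2 f : Prop := cmf f /\ (sq2 f < +oo)%E.

Definition n2 f : R := \int[mu]_x csq (f x).

Definition ip f g : R[i] := cint mu (fun x => f x * (g x)^*).

Lemma sq2_ge0 f : (0 <= sq2 f)%E.
Proof. by apply: integral_ge0 => x _; rewrite lee_fin csq_ge0. Qed.

Lemma n2_ge0 f : 0 <= n2 f.
Proof. by apply: Rintegral_ge0 => x _; rewrite csq_ge0. Qed.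

Lemma sq2E f : inL2 f -> sq2 f = (n2 f)%:E.
Proof. by move=> [mf fin]; rewrite /n2 /Rintegral fineK// ge0_fin_numE// sq2_ge0. Qed.

Lemma inL2_csq f : inL2 f -> mu.-integrable setT (fun x => (csq (f x))%:E).
Proof.
move=> [mf fin]; apply/integrableP; split; first exact: measurable_csqE.
rewrite (le_lt_trans _ fin)// ge0_le_integral//.
- by apply: measurableT_comp => //; exact: measurable_csqE.
- exact: measurable_csqE.
- by move=> x _ /=; rewrite lee_fin ger0_norm// csq_ge0.
Qed.

Lemma inL2_dom f (g : T -> R) : cmf f -> mu.-integrable setT (EFin \o g) ->
  (forall x, csq (f x) <= g x) -> inL2 f.
Proof.
move=> mf /integrableP[mg ig] fg; split => //; apply: le_lt_trans ig.
apply: ge0_le_integral => //.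
- by move=> x _; rewrite lee_fin csq_ge0.
- exact: measurable_csqE.
- exact: measurableT_comp.
- by move=> x _ /=; rewrite lee_fin (le_trans (fg x))// ler_norm.
Qed.

Lemma inL2D f g : inL2 f -> inL2 g -> inL2 (fun x => f x + g x).
Proof.
move=> Lf Lg; apply: (@inL2_dom _ (fun x => 2 * csq (f x) + 2 * csq (g x))).
- by apply: cmfD; [exact: Lf.1|exact: Lg.1].
- by apply: intRD => //; apply: intRZ => //; exact: inL2_csq.
- by move=> x; exact: csqD_le.
Qed.

Lemma inL2Z (z : R[i]) f : inL2 f -> inL2 (fun x => z * f x).
Proof.
move=> Lf; apply: (@inL2_dom _ (fun x => csq z * csq (f x))).
- by apply: cmfM; [exact: cmf_cst|exact: Lf.1].
- by apply: intRZ => //; exact: inL2_csq.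
- by move=> x; rewrite csqM.
Qed.

Lemma inL2N f : inL2 f -> inL2 (fun x => - f x).
Proof.
by move=> /(inL2Z (-1)); congr inL2; apply/funext => x; rewrite mulN1r.
Qed.

Lemma inL2B f g : inL2 f -> inL2 g -> inL2 (fun x => f x - g x).
Proof. by move=> Lf Lg; apply: inL2D => //; exact: inL2N. Qed.

Lemma inL20 : inL2 (fun=> 0).
Proof.
split; first exact: cmf_cst.
by rewrite /sq2 (_ : (fun=> _) = cst 0%E) ?integral0//; apply/funext => x; rewrite csq0.
Qed.

Lemma inL2_sum I (s : seq I) (F : I -> T -> R[i]) :
  (forall i, inL2 (F i)) -> inL2 (fun x => \sum_(i <- s) F i x).
Proof.
move=> iF; elim: s => [|i s ih].
  by under eq_fun do rewrite big_nil; exact: inL20.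
by under eq_fun do rewrite big_cons; exact: inL2D.
Qed.

Lemma inL2Mu f (u : T -> R[i]) : inL2 f -> cmf u -> (forall x, csq (u x) <= 1) ->
  inL2 (fun x => f x * u x).
Proof.
move=> Lf mu' u1; apply: (@inL2_dom _ (fun x => csq (f x))).
- by apply: cmfM => //; exact: Lf.1.
- exact: inL2_csq.
- by move=> x; rewrite csqM ler_piMr// csq_ge0.
Qed.

Lemma cintb_ip f g : inL2 f -> inL2 g -> cintb mu (fun x => f x * (g x)^*).
Proof.
move=> Lf Lg; apply: (@cintb_dom _ _ _ _ _ (fun x => csq (f x) + csq (g x))).
- by apply: cmfM; [exact: Lf.1|apply: cmfJ; exact: Lg.1].
- by apply: intRD => //; exact: inL2_csq.
- by move=> x; rewrite (le_trans (normc_le_csq _ _))// csqJ.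
Qed.

Lemma ipZl z f g : inL2 f -> inL2 g -> ip (fun x => z * f x) g = z * ip f g.
Proof.
move=> Lf Lg; rewrite /ip -cintZ; last exact: cintb_ip.
by apply: eq_cint => x; rewrite mulrA.
Qed.

Lemma ipJ f g : inL2 f -> inL2 g -> ip f g = (ip g f)^*.
Proof.
move=> Lf Lg; rewrite /ip -cintJ; last exact: cintb_ip.
by apply: eq_cint => x; rewrite rmorphM /= conjcK mulrC.
Qed.

Lemma ipZr z f g : inL2 f -> inL2 g -> ip f (fun x => z * g x) = z^* * ip f g.
Proof.
move=> Lf Lg; rewrite ipJ//; last exact: inL2Z.
by rewrite ipZl// rmorphM /= [in RHS]ipJ.
Qed.

Lemma ip_sumr n f (F : 'I_n -> T -> R[i]) : inL2 f -> (forall i, inL2 (F i)) ->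
  ip f (fun x => \sum_i F i x) = \sum_i ip f (F i).
Proof.
move=> Lf LF; rewrite /ip -cint_sum.
  by apply: eq_cint => x; rewrite rmorph_sum mulr_sumr.
by move=> i; exact: cintb_ip.
Qed.

Lemma ip_suml n f (F : 'I_n -> T -> R[i]) : inL2 f -> (forall i, inL2 (F i)) ->
  ip (fun x => \sum_i F i x) f = \sum_i ip (F i) f.
Proof.
move=> Lf LF; rewrite /ip -cint_sum.
  by apply: eq_cint => x; rewrite mulr_suml.
by move=> i; exact: cintb_ip.
Qed.

Lemma n2D f g : inL2 f -> inL2 g ->
  n2 (fun x => f x + g x) = n2 f + n2 g + 2 * complex.Re (ip f g).
Proof.
move=> Lf Lg; rewrite /n2 /ip /=.
have [fgr _] := cintb_ip Lf Lg.
rewrite -RintegralZl// -RintegralD//; [|exact: inL2_csq..].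
rewrite -RintegralD//.
- by apply: eq_Rintegral => x _; rewrite /csq !reimE; ring.
- by apply: intRD => //; exact: inL2_csq.
- exact: intRZ.
Qed.

Lemma n2Z z f : inL2 f -> n2 (fun x => z * f x) = csq z * n2 f.
Proof.
move=> Lf; rewrite /n2 -RintegralZl//; last exact: inL2_csq.
by apply: eq_Rintegral => x _; rewrite csqM.
Qed.

Lemma n2N f : n2 (fun x => - f x) = n2 f.
Proof. by apply: eq_Rintegral => x _; rewrite csqN. Qed.

Lemma n2B f g : inL2 f -> inL2 g ->
  n2 (fun x => f x - g x) = n2 f + n2 g - 2 * complex.Re (ip f g).
Proof.
move=> Lf Lg; rewrite n2D//; last exact: inL2N.
rewrite n2N; congr (_ + _); rewrite -mulrN; congr (_ * _).
rewrite -[fun x => - g x]/(fun x => - g x) (_ : (fun x => - g x) = (fun x => -1 * g x)).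
  by rewrite ipZr// !reimE /=; ring.
by apply/funext => x; rewrite mulN1r.
Qed.

(** [ip] is conjugate-linear on the right, so the real part of [ip f (i g)] is the imaginary part of
    [ip f g]. Through this formula an isometry preserves inner products. *)
Lemma ip_polar f g : inL2 f -> inL2 g ->
  ip f g = ((n2 (fun x => f x + g x) - n2 f - n2 g) / 2) +i*
           ((n2 (fun x => f x + 'i%C * g x) - n2 f - n2 g) / 2).
Proof.
move=> Lf Lg; have Lig : inL2 (fun x => 'i%C * g x) by exact: inL2Z.
rewrite (n2D Lf Lg) (n2D Lf Lig) (n2Z _ Lg) ipZr//.
have -> : csq ('i%C : R[i]) = 1 by rewrite /csq /= expr0n expr1n add0r.
by apply: complex_eqP; rewrite !reimE /=; field.
Qed.

Lemma n2_le2 f g : inL2 f -> inL2 g ->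
  n2 (fun x => f x + g x) <= 2 * n2 f + 2 * n2 g.
Proof.
move=> Lf Lg.
rewrite /n2 -!RintegralZl//; [|exact: inL2_csq..].
rewrite -RintegralD//; last 2 first.
- by apply: intRZ => //; exact: inL2_csq.
- by apply: intRZ => //; exact: inL2_csq.
apply: le_Rintegral => //.
- by apply: inL2_csq; exact: inL2D.
- by apply: intRD => //; apply: intRZ => //; exact: inL2_csq.
- by move=> x _; exact: csqD_le.
Qed.

Lemma n2D_eta eta f g : 0 < eta -> inL2 f -> inL2 g ->
  n2 (fun x => f x + g x) <= (1 + eta) * n2 f + (1 + eta^-1) * n2 g.
Proof.
move=> e0 Lf Lg.
rewrite /n2 -!RintegralZl//; [|exact: inL2_csq..].
rewrite -RintegralD//; last 2 first.
- by apply: intRZ => //; exact: inL2_csq.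
- by apply: intRZ => //; exact: inL2_csq.
apply: le_Rintegral => //.
- by apply: inL2_csq; exact: inL2D.
- by apply: intRD => //; apply: intRZ => //; exact: inL2_csq.
- by move=> x _; exact: csqD_eta.
Qed.

Lemma inL2_ae f g : inL2 f -> cmf g -> {ae mu, forall x, f x = g x} -> inL2 g.
Proof.
move=> [mf ff] mg fg; split => //; rewrite /sq2.
rewrite (_ : (\int[mu]_x (csq (g x))%:E)%E = \int[mu]_x (csq (f x))%:E)%E//.
apply: ge0_ae_eq_integral => //; [exact: measurable_csqE|exact: measurable_csqE| | | ].
- by move=> x _; rewrite lee_fin csq_ge0.
- by move=> x _; rewrite lee_fin csq_ge0.
- by apply: filterS fg => x /= ->.
Qed.

Lemma n2_ae f g : cmf f -> cmf g -> {ae mu, forall x, f x = g x} -> n2 f = n2 g.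
Proof.
move=> mf mg fg; rewrite /n2 /Rintegral; congr fine.
apply: ge0_ae_eq_integral => //; [exact: measurable_csqE|exact: measurable_csqE| | | ].
- by move=> x _; rewrite lee_fin csq_ge0.
- by move=> x _; rewrite lee_fin csq_ge0.
- by apply: filterS fg => x /= ->.
Qed.

Lemma n2_eq0 f : inL2 f -> n2 f = 0 -> {ae mu, forall x, f x = 0}.
Proof.
move=> Lf f0; have : ae_eq mu setT (fun x => (csq (f x))%:E) (cst 0%E).
  apply/ae_eq_integral_abs => //; first exact: measurable_csqE Lf.1.
  transitivity (sq2 f); last by rewrite sq2E// f0.
  by apply: eq_integral => x _; rewrite gee0_abs// lee_fin csq_ge0.
by apply: filterS => x /(_ I) [] /csq_eq0.
Qed.

End L2.

Notation cmR := (@cmf _ (measurableTypeR _) _).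

(** * Translations and Fubini *)

Section lebesgue_shift.
Context {R : realType}.
Notation mu := (@lebesgue_measure R).

Definition shiftR (a : R) (x : measurableTypeR R) : measurableTypeR R := x + a.

Lemma measurable_shiftR a : measurable_fun setT (shiftR a).
Proof. by apply: measurable_funD => //; exact: measurable_cst. Qed.

HB.instance Definition _ a := isMeasurableFun.Build _ _ _ _ (shiftR a) (measurable_shiftR a).

Lemma lebesgue_measure_shift a (A : set R) : measurable A ->
  pushforward mu (shiftR a) A = mu A.
Proof.
move=> mA; apply/esym/lebesgue_measure_unique => //= _ [[c b]] _ <-.
rewrite /pushforward.
have -> : shiftR a @^-1` [set` `]c, b]] = [set` `]c - a, b - a]].
  by apply/seteqP; split => x /=; rewrite /shiftR !in_itv /= ltrBlDr lerBrDr.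
rewrite !lebesgue_measure_itv/= !lte_fin ltrD2r; case: ifPn => // _.
by congr EFin; ring.
Qed.

Lemma ge0_integral_shift a (f : R -> \bar R) : measurable_fun setT f ->
  (forall x, 0 <= f x)%E -> (\int[mu]_x f (x + a)%R = \int[mu]_x f x)%E.
Proof.
move=> mf f0.
transitivity (\int[pushforward mu (shiftR a)]_x f x)%E; last first.
  by apply: eq_measure_integral => A mA _; exact: lebesgue_measure_shift.
by rewrite ge0_integral_pushforward// preimage_setT.
Qed.

Lemma ge0_integral_opp (f : R -> \bar R) : measurable_fun setT f ->
  (forall x, 0 <= f x)%E -> (\int[mu]_x f (- x)%R = \int[mu]_x f x)%E.
Proof.
move=> mf f0.
transitivity (\int[pushforward mu (-%R : _ -> measurableTypeR R)]_x f x)%E; last first.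
  by apply: eq_measure_integral => A mA _; exact: lebesgue_measureN.
by rewrite ge0_integral_pushforward// preimage_setT.
Qed.

Lemma integrable_shift a (f : R -> R) : mu.-integrable setT (EFin \o f) ->
  mu.-integrable setT (EFin \o (fun x => f (x + a))).
Proof.
move=> /integrableP[mf fi]; apply/integrableP; split.
  exact: (measurableT_comp mf (measurable_shiftR a)).
rewrite (ge0_integral_shift a (f := fun x => `|(f x)%:E|)%E)//.
exact: measurableT_comp.
Qed.

Lemma integrable_opp (f : R -> R) : mu.-integrable setT (EFin \o f) ->
  mu.-integrable setT (EFin \o (fun x => f (- x))).
Proof.
move=> /integrableP[mf fi]; apply/integrableP; split.
  by apply: (measurableT_comp mf).
rewrite (ge0_integral_opp (f := fun x => `|(f x)%:E|)%E)//.
exact: measurableT_comp.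
Qed.

Lemma Rintegral_shift a (f : R -> R) : mu.-integrable setT (EFin \o f) ->
  \int[mu]_x f (x + a) = \int[mu]_x f x.
Proof.
move=> fi; rewrite /Rintegral; congr fine.
transitivity (\int[pushforward mu (shiftR a)]_x (f x)%:E)%E; last first.
  by apply: eq_measure_integral => A mA _; exact: lebesgue_measure_shift.
rewrite integral_pushforward// ?preimage_setT//.
- exact: measurable_int fi.
- exact: integrable_shift.
Qed.

Lemma Rintegral_opp (f : R -> R) : mu.-integrable setT (EFin \o f) ->
  \int[mu]_x f (- x) = \int[mu]_x f x.
Proof.
move=> fi; rewrite /Rintegral; congr fine.
transitivity (\int[pushforward mu (-%R : _ -> measurableTypeR R)]_x (f x)%:E)%E; last first.
  by apply: eq_measure_integral => A mA _; exact: lebesgue_measureN.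
rewrite integral_pushforward// ?preimage_setT//.
- exact: measurable_int fi.
- exact: integrable_opp.
Qed.

Lemma cmf_shift a (f : R -> R[i]) : cmR f -> cmR (fun x => f (x + a)).
Proof. by apply: cmf_comp; exact: measurable_shiftR. Qed.

Lemma cmf_opp (f : R -> R[i]) : cmR f -> cmR (fun x => f (- x)).
Proof. by apply: cmf_comp. Qed.

Lemma cintb_shift a (f : R -> R[i]) : cintb mu f -> cintb mu (fun x => f (x + a)).
Proof.
by move=> [fr fi]; split; [exact: (integrable_shift a fr)|exact: (integrable_shift a fi)].
Qed.

Lemma cint_shift a (f : R -> R[i]) : cintb mu f ->
  cint mu (fun x => f (x + a)) = cint mu f.
Proof.
move=> [fr fi]; apply: complex_eqP => /=.
  exact: (Rintegral_shift a (f := fun x => complex.Re (f x))).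
exact: (Rintegral_shift a (f := fun x => complex.Im (f x))).
Qed.

Lemma sq2_shift a (f : R -> R[i]) : cmR f -> sq2 mu (fun x : R => f (x + a)) = sq2 mu f.
Proof.
move=> mf; rewrite /sq2 (ge0_integral_shift a (f := fun x => (csq (f x))%:E))//.
  exact: measurable_csqE.
by move=> x; rewrite lee_fin csq_ge0.
Qed.

Lemma sq2_opp (f : R -> R[i]) : cmR f -> sq2 mu (fun x : R => f (- x)) = sq2 mu f.
Proof.
move=> mf; rewrite /sq2 (ge0_integral_opp (f := fun x => (csq (f x))%:E))//.
  exact: measurable_csqE.
by move=> x; rewrite lee_fin csq_ge0.
Qed.

Lemma inL2_shift a (f : R -> R[i]) : inL2 mu f -> inL2 mu (fun x => f (x + a)).
Proof. by move=> [mf ff]; split; [exact: cmf_shift|rewrite sq2_shift]. Qed.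

Lemma inL2_opp (f : R -> R[i]) : inL2 mu f -> inL2 mu (fun x => f (- x)).
Proof. by move=> [mf ff]; split; [exact: cmf_opp|rewrite sq2_opp]. Qed.

Lemma n2_shift a (f : R -> R[i]) : inL2 mu f -> n2 mu (fun x => f (x + a)) = n2 mu f.
Proof.
move=> Lf; apply: EFin_inj; rewrite -!sq2E//; last exact: inL2_shift.
by rewrite sq2_shift//; exact: Lf.1.
Qed.

Lemma n2_opp (f : R -> R[i]) : inL2 mu f -> n2 mu (fun x => f (- x)) = n2 mu f.
Proof.
move=> Lf; apply: EFin_inj; rewrite -!sq2E//; last exact: inL2_opp.
by rewrite sq2_opp//; exact: Lf.1.
Qed.

Lemma ae_shift a (P : R -> Prop) : {ae mu, forall x, P x} -> {ae mu, forall x, P (x + a)}.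
Proof.
move=> [N [mN N0 PN]]; exists ((shiftR a) @^-1` N); split.
- by rewrite -[_ @^-1` _]setTI; exact: measurable_shiftR.
- by have := lebesgue_measure_shift a mN; rewrite /pushforward N0.
- by move=> x /= Px; exact: PN.
Qed.

End lebesgue_shift.

Section fubini_real.
Context {R : realType}.
Notation mu := (@lebesgue_measure R).
Notation RR := (measurableTypeR R).

(** Integrability of every slice, and not of almost every one, makes all inner integrals finite, so
    that [fine] is harmless pointwise. *)
Lemma Rintegral_fubini (f : RR * RR -> R) :
  (mu \x mu)%E.-integrable setT (EFin \o f) ->
  (forall x, mu.-integrable setT (fun y => (f (x, y))%:E)) ->
  (forall y, mu.-integrable setT (fun x => (f (x, y))%:E)) ->
  \int[mu]_x (\int[mu]_y f (x, y)) = \int[mu]_y (\int[mu]_x f (x, y)).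
Proof.
move=> fi f1 f2; rewrite {1 3}/Rintegral; congr fine.
have := Fubini fi => /=.
rewrite (eq_integral (fun x => (\int[mu]_y f (x, y))%:E)); last first.
  by move=> x _; rewrite /Rintegral fineK// integrable_fin_num.
move=> ->; apply: eq_integral => y _.
by rewrite /Rintegral fineK// integrable_fin_num.
Qed.

Lemma cint_fubini (f : RR * RR -> R[i]) (g : RR * RR -> R) : cmf f ->
  (mu \x mu)%E.-integrable setT (EFin \o g) ->
  (forall z, normc (f z) <= g z) ->
  (forall x, cintb mu (fun y => f (x, y))) ->
  (forall y, cintb mu (fun x => f (x, y))) ->
  cint mu (fun x => cint mu (fun y => f (x, y))) =
  cint mu (fun y => cint mu (fun x => f (x, y))).
Proof.
move=> mf ig fg f1 f2; have [fr fi] := cintb_dom mf ig fg.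
apply: complex_eqP => /=.
  apply: (Rintegral_fubini (f := fun z => complex.Re (f z))) => // [x|y].
    exact: (f1 x).1.
  exact: (f2 y).1.
apply: (Rintegral_fubini (f := fun z => complex.Im (f z))) => // [x|y].
  exact: (f1 x).2.
exact: (f2 y).2.
Qed.

Lemma integrable_prodM (p q : R -> R) :
  mu.-integrable setT (EFin \o p) -> mu.-integrable setT (EFin \o q) ->
  (mu \x mu)%E.-integrable setT (EFin \o (fun z : RR * RR => p z.1 * q z.2)).
Proof.
move=> ip iq; have mp := measurable_int _ ip; have mq := measurable_int _ iq.
have mpq : measurable_fun setT (EFin \o (fun z : RR * RR => p z.1 * q z.2)).
  apply/measurable_EFinP; apply: measurable_funM.
    by apply: measurableT_comp => //; exact/measurable_EFinP.
  by apply: measurableT_comp => //; exact/measurable_EFinP.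
apply: (proj2 (@integrable12ltyP _ _ RR RR R mu mu _ mpq)) => /=.
rewrite (eq_integral (fun x : RR => `|(p x)%:E| * \int[mu]_y `|(q y)%:E|)%E); last first.
  move=> x _; rewrite -ge0_integralZl//; last exact: measurableT_comp.
  by apply: eq_integral => y _; rewrite -abseM -EFinM.
rewrite ge0_integralZr//.
- by move/integrableP : ip => [_ ip]; move/integrableP : iq => [_ iq];
    apply: lte_mul_pinfty; [exact: integral_ge0|rewrite ge0_fin_numE//; exact: integral_ge0|].
- exact: measurableT_comp.
- exact: integral_ge0.
Qed.

End fubini_real.

(** * Poisson and Abel kernels *)

Section kernels.
Context {R : realType}.
Notation mu := (@lebesgue_measure R).
Notation RR := (measurableTypeR R).
Implicit Types e t r x : R.

(** The antiderivative is asked for on the positive half-line only, because [abel] has a corner at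
    0. *)
Lemma ge0_even_FTC (f F : R -> R) (l : R) : (forall x, 0 <= f x) ->
  continuous f -> (forall x, f (- x) = f x) ->
  (forall x : R, 0 < x -> is_derive x 1 F (f x)) -> {for 0, continuous F} ->
  F x @[x --> +oo] --> l ->
  (\int[mu]_x (f x)%:E = (2 * (l - F 0))%:E)%E.
Proof.
move=> f0 cf fN dF cF Fl.
rewrite ge0_symfun_integralT//; last by move=> x /=; rewrite fN.
rewrite -set_itvcy (@ge0_continuous_FTC2y _ f F 0 l)//.
- exact: continuous_subspaceT.
- by move=> x x0; have [] := dF _ x0.
- by apply: cvg_at_right_filter; exact: cF.
- move=> x; rewrite in_itv/= andbT => x0; rewrite derive1E.
  by have := dF _ x0 => ?; rewrite derive_val.
Qed.

(** The Poisson kernel of the half-plane at height [e], of total mass 1; [2 * pi] times it is the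
    Fourier integral of the weight [abel e] (see [cint_abel]). *)
Definition poisson (e t : R) : R := e / (pi * (e ^+ 2 + t ^+ 2)).

Definition abel (e x : R) : R := expR (- (e * `|x|)).

Lemma is_derive_scale (c x : R) : is_derive x 1 ( *%R c) c.
Proof.
have := @is_deriveZ R R R id c x 1 1 (is_derive_id x 1).
by rewrite [c *: 1]mulr1.
Qed.

Lemma poisson_ge0 e t : 0 < e -> 0 <= poisson e t.
Proof.
move=> e0; rewrite divr_ge0 ?(ltW e0)// mulr_ge0 ?pi_ge0//.
by rewrite addr_ge0 ?sqr_ge0.
Qed.

Lemma continuous_poisson e : 0 < e -> continuous (poisson e).
Proof.
move=> e0 x; apply: cvgM; first exact: cvg_cst.
apply: cvgV.
  rewrite mulf_neq0 ?gt_eqF ?pi_gt0//.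
  by rewrite ltr_pwDl ?exprn_gt0 ?sqr_ge0.
apply: cvgM; first exact: cvg_cst.
apply: cvgD; first exact: cvg_cst.
exact: exprn_continuous.
Qed.

Lemma integral_poisson e : 0 < e -> (\int[mu]_x (poisson e x)%:E = 1)%E.
Proof.
move=> e0.
pose F (x : R) : R := pi^-1 * atan (e^-1 * x).
transitivity ((2 * (2^-1 - F 0))%:E); last first.
  by rewrite /F mulr0 atan0 mulr0 subr0 divff.
apply: ge0_even_FTC.
- by move=> x; exact: poisson_ge0.
- exact: continuous_poisson.
- by move=> x; rewrite /poisson sqrrN.
- move=> x _.
  have h1 : is_derive x 1 (atan \o ( *%R e^-1)) ((1 + (e^-1 * x) ^+ 2)^-1 * e^-1).
    by apply: is_derive1_comp; exact: is_derive_scale.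
  have h2 := @is_deriveZ R R R (atan \o ( *%R e^-1)) pi^-1 x 1 _ h1.
  apply: (is_derive_eq h2); rewrite /poisson [LHS]/GRing.scale /=.
  have p0 := @pi_gt0 R.
  have ex0 : 0 < e ^+ 2 + x ^+ 2 by rewrite ltr_pwDl ?exprn_gt0 ?sqr_ge0.
  clear h2 h1 F; move: p0; generalize (@pi R) => p p0.
  by field; rewrite !gt_eqF.
- apply: cvgM; first exact: cvg_cst.
  apply: continuous_comp; last exact: continuous_atan.
  exact: mulrl_continuous.
- rewrite (_ : 2^-1 = pi^-1 * (pi / 2)); last first.
    by rewrite mulrA mulVf ?mul1r// gt_eqF// pi_gt0.
  apply: cvgM; first exact: cvg_cst.
  apply: (@cvg_comp _ _ _ ( *%R e^-1) (@atan R) _ (pinfty_nbhs R)); last exact: cvgy_atan.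
  by apply: gt0_cvgMry => //; rewrite invr_gt0.
Qed.

Lemma integrable_poisson e : 0 < e -> mu.-integrable setT (EFin \o poisson e).
Proof.
move=> e0; apply/integrableP; split.
  apply/measurable_EFinP; apply: continuous_measurable_fun.
  exact: continuous_poisson.
rewrite (eq_integral (fun x : RR => (poisson e x)%:E)); last first.
  by move=> x _ /=; rewrite ger0_norm// poisson_ge0.
by rewrite integral_poisson// ltry.
Qed.

(** Away from 0 the kernel is [e] times a fixed integrable function, hence its mass there vanishes
    with [e]. *)
Lemma poisson_tail (e r t : R) : 0 < e -> 0 < r -> r <= `|t| ->
  poisson e t <= e * (1 + r ^- 2) * poisson 1 t.
Proof.
move=> e0 r0 rt; have p0 := @pi_gt0 R.
have t0 : 0 < t ^+ 2 by rewrite -real_normK ?num_real// exprn_gt0// (lt_le_trans r0).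
have rt2 : r ^+ 2 <= t ^+ 2.
  by rewrite -[leRHS]real_normK ?num_real// lerXn2r// nnegrE ltW.
have r20 : 0 < r ^+ 2 by rewrite exprn_gt0.
rewrite /poisson expr1n mul1r -mulrA ler_pM2l//.
rewrite (invfM pi) (invfM pi) mulrCA ler_pM2l ?invr_gt0//.
rewrite ler_pdivlMr; last by rewrite ltr_pwDl// ltW.
rewrite (@le_trans _ _ ((t ^+ 2)^-1 * (1 + t ^+ 2)))//.
  rewrite ler_pM2r; last by rewrite ltr_pwDl// ltW.
  rewrite lef_pV2 ?posrE//; first by rewrite lerDr sqr_ge0.
  by rewrite ltr_wpDl ?sqr_ge0.
rewrite mulrDr mulr1 mulVf ?gt_eqF// addrC lerD2l.
by rewrite lef_pV2.
Qed.

Lemma abel_ge0 e x : 0 <= abel e x.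
Proof. exact: expR_ge0. Qed.

Lemma abel_le1 e x : 0 < e -> abel e x <= 1.
Proof.
move=> e0; rewrite /abel -expR0 ler_expR oppr_le0 mulr_ge0//; exact: ltW.
Qed.

Lemma abelN e x : abel e (- x) = abel e x.
Proof. by rewrite /abel normrN. Qed.

Lemma continuous_abel e : continuous (abel e).
Proof.
move=> x; apply: continuous_comp; last exact: continuous_expR.
apply: cvgN; apply: cvgM; first exact: cvg_cst.
exact: norm_continuous.
Qed.

Lemma measurable_abel e : measurable_fun setT (abel e).
Proof. apply: continuous_measurable_fun; exact: continuous_abel. Qed.

(** Adding 1 to the cosine makes the integrand nonnegative, as [ge0_even_FTC] requires. The case
    [t = 0] gives the integral of [abel e] alone, which [Rintegral_abel_cos] subtracts. *)
Lemma integral_abel_cos e t : 0 < e ->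
  (\int[mu]_x (abel e x * (1 + cos (t * x)))%:E =
   (2 * (e^-1 + e / (e ^+ 2 + t ^+ 2)))%:E)%E.
Proof.
move=> e0; have et0 : 0 < e ^+ 2 + t ^+ 2 by rewrite ltr_pwDl ?exprn_gt0 ?sqr_ge0.
(* The fraction comes from integrating e^(-e x) cos (t x) by parts twice, and [e^-1] from the added
   constant 1. *)
pose G (x : R) : R := (t * sin (t * x) - e * cos (t * x)) / (e ^+ 2 + t ^+ 2) - e^-1.
pose F (x : R) : R := expR (- e * x) * G x.
have dsin (x : R) : is_derive x 1 (sin \o ( *%R t)) (cos (t * x) * t).
  by apply: is_derive1_comp; exact: is_derive_scale.
have dcos (x : R) : is_derive x 1 (cos \o ( *%R t)) (- sin (t * x) * t).
  by apply: is_derive1_comp; exact: is_derive_scale.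
have dexp (x : R) : is_derive x 1 (expR \o ( *%R (- e))) (expR (- e * x) * (- e)).
  by apply: is_derive1_comp; exact: is_derive_scale.
have GE : G = ((t / (e ^+ 2 + t ^+ 2)) \*: (sin \o ( *%R t)) +
              (- (e / (e ^+ 2 + t ^+ 2))) \*: (cos \o ( *%R t)) + cst (- e^-1)).
  by apply/funext => x; rewrite /G /= !fctE /= /GRing.scale /=; ring.
have dG (x : R) : is_derive x 1 G ((t * (cos (t * x) * t) + e * sin (t * x) * t) / (e ^+ 2 + t ^+ 2)).
  rewrite GE; apply: is_derive_eq.
  by rewrite /GRing.scale /=; ring.
have dF (x : R) : is_derive x 1 F (expR (- e * x) * (1 + cos (t * x))).
  have := @is_deriveM R R _ _ x 1 _ _ (dexp x) (dG x).
  rewrite (_ : (expR \o *%R (- e)) * G = F); last by apply/funext.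
  move=> h; apply: (is_derive_eq h).
  rewrite /GRing.scale /= /G.
  by field; rewrite !gt_eqF.
transitivity ((2 * (0 - F 0))%:E); last first.
  by rewrite /F /G !mulr0 sin0 cos0 expR0; congr EFin; field; rewrite !gt_eqF.
apply: ge0_even_FTC.
- move=> x; apply: mulr_ge0; first exact: abel_ge0.
  by have := cos_geN1 (t * x); lra.
- move=> x; apply: cvgM; first exact: continuous_abel.
  apply: cvgD; first exact: cvg_cst.
  apply: continuous_comp; last exact: continuous_cos.
  exact: mulrl_continuous.
- by move=> x; rewrite abelN mulrN cosN.
- by move=> x x0; rewrite /abel gtr0_norm// -mulNr; exact: dF.
- have [dF0 _] := dF 0; apply: differentiable_continuous.
  exact/derivable1_diffP.
pose M := (`|t| + e) / (e ^+ 2 + t ^+ 2) + e^-1.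
have GM x : `|G x| <= M.
  rewrite (le_trans (ler_normB _ _))// lerD//; last by rewrite ger0_norm// invr_ge0 ltW.
  rewrite normrM [X in _ * X]ger0_norm ?invr_ge0 ?(ltW et0)// ler_pM2r ?invr_gt0//.
  rewrite (le_trans (ler_normB _ _))// !normrM (gtr0_norm e0).
  by rewrite lerD// ler_piMr// ?(ltW e0)// ler_norml ?sin_le1 ?sin_geN1 ?cos_le1 ?cos_geN1.
have M0 : 0 <= M by rewrite (le_trans _ (GM 0)).
have cexp : expR (- e * x) @[x --> +oo] --> (0 : R).
  rewrite (_ : (fun x : R => expR (- e * x)) =
               (fun z => expR (- z)) \o (fun z => e * z)); last first.
    by apply: eq_fun => x; rewrite mulNr.
  apply: (@cvg_comp _ _ _ _ _ _ (pinfty_nbhs R)); last exact: cvgr_expR.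
  exact: gt0_cvgMry.
apply: (@squeeze_cvgr _ _ _ _ (fun x => - (expR (- e * x) * M)) (fun x => expR (- e * x) * M)).
- near=> x; rewrite -ler_norml /F normrM ger0_norm ?expR_ge0// ler_wpM2l ?expR_ge0//.
- rewrite -oppr0; apply: cvgN; rewrite -(mul0r M).
  by apply: cvgM => //; exact: cvg_cst.
- by rewrite -(mul0r M); apply: cvgM => //; exact: cvg_cst.
Unshelve. all: by end_near. Qed.

Lemma integrable_abel e : 0 < e -> mu.-integrable setT (EFin \o abel e).
Proof.
move=> e0; apply/integrableP; split; first by apply/measurable_EFinP; exact: measurable_abel.
have := integral_abel_cos 0 e0.
rewrite (eq_integral (fun x : RR => (2%:E * `|(abel e x)%:E|)%E)); last first.
  move=> x _; rewrite /= mul0r cos0 ger0_norm ?abel_ge0// -EFinM; congr EFin; ring.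
rewrite ge0_integralZl//; last first.
  apply: measurableT_comp => //; by apply/measurable_EFinP; exact: measurable_abel.
have : (0 <= \int[mu]_x `|(abel e x)%:E|)%E by exact: integral_ge0.
rewrite /comp /=; case: (\int[mu]_x _)%E => //= [r _|]; first by rewrite ltry.
by rewrite mulry gtr0_sg// mul1e.
Qed.

Lemma integrable_abelM e (g : R -> R) : 0 < e -> measurable_fun setT g ->
  (forall x, `|g x| <= 1) -> mu.-integrable setT (EFin \o (fun x => abel e x * g x)).
Proof.
move=> e0 mg g1; apply: le_integrable (integrable_abel e0) => //.
  by apply/measurable_EFinP; apply: measurable_funM => //; exact: measurable_abel.
move=> x _ /=; rewrite lee_fin normrM ler_piMr//.
Qed.

Lemma measurable_cosM t : measurable_fun setT (fun x : R => cos (t * x)).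
Proof.
apply: continuous_measurable_fun => x.
apply: continuous_comp; last exact: continuous_cos.
exact: mulrl_continuous.
Qed.

Lemma measurable_sinM t : measurable_fun setT (fun x : R => sin (t * x)).
Proof.
apply: continuous_measurable_fun => x.
apply: continuous_comp; last exact: continuous_sin.
exact: mulrl_continuous.
Qed.

Lemma Rintegral_abel_cos e t : 0 < e ->
  \int[mu]_x (abel e x * cos (t * x)) = 2 * pi * poisson e t.
Proof.
move=> e0; have et0 : 0 < e ^+ 2 + t ^+ 2 by rewrite ltr_pwDl ?exprn_gt0 ?sqr_ge0.
have icos s : mu.-integrable setT (EFin \o (fun x => abel e x * cos (s * x))).
  apply: integrable_abelM => //; first exact: measurable_cosM.
  by move=> x; rewrite ler_norml cos_le1 cos_geN1.
have H s : \int[mu]_x (abel e x) + \int[mu]_x (abel e x * cos (s * x)) =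
    2 * (e^-1 + e / (e ^+ 2 + s ^+ 2)).
  rewrite -RintegralD//; last exact: integrable_abel.
  apply: EFin_inj; rewrite -(integral_abel_cos s e0) /Rintegral fineK.
    by apply: eq_integral => x _; rewrite mulrDr mulr1.
  apply: integrable_fin_num => //.
  exact: (intRD measurableT (integrable_abel e0) (icos s)).
have H0 := H 0; have Ht := H t.
have A0 : \int[mu]_x (abel e x * cos (0 * x)) = \int[mu]_x (abel e x).
  by apply: eq_Rintegral => x _; rewrite mul0r cos0 mulr1.
rewrite A0 in H0.
have A : \int[mu]_x (abel e x) = 2 * e^-1.
  have : 2 * \int[mu]_x abel e x = 2 * (2 * e^-1).
    rewrite [LHS]mulr_natl mulr2n H0; field; rewrite gt_eqF//.
  by move/mulfI; apply; rewrite pnatr_eq0.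
move: Ht; rewrite A mulrDr => /addrI ->.
have p0 := @pi_gt0 R; rewrite /poisson; move: p0; generalize (@pi R) => p p0.
by field; rewrite !gt_eqF.
Qed.

Lemma Rintegral_abel_sin e t : 0 < e ->
  \int[mu]_x (abel e x * sin (t * x)) = 0.
Proof.
move=> e0.
have isin : mu.-integrable setT (EFin \o (fun x => abel e x * sin (t * x))).
  apply: integrable_abelM => //; first exact: measurable_sinM.
  by move=> x; rewrite ler_norml sin_le1 sin_geN1.
have := Rintegral_opp isin.
under eq_Rintegral do rewrite abelN mulrN sinN mulrN -mulN1r.
rewrite RintegralZl// mulN1r => /eqP.
by rewrite eq_sym -subr_eq0 opprK -mulr2n mulrn_eq0/= => /eqP.
Qed.

Lemma cint_abel e t : 0 < e ->
  cint mu (fun x => (abel e x)%:C * expi (t * x)) = (2 * pi * poisson e t)%:C.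
Proof.
move=> e0; apply: complex_eqP => /=.
  rewrite -Rintegral_abel_cos//; apply: eq_Rintegral => x _.
  by rewrite mul0r subr0.
rewrite -[RHS](Rintegral_abel_sin t e0); apply: eq_Rintegral => x _.
by rewrite mul0r addr0.
Qed.

End kernels.

(** * Continuity of translations in L2 *)

Section L2_convergence.
Context {d} {T : measurableType d} {R : realType}.
Variable mu : {measure set T -> \bar R}.

Lemma n2_dct (f_ : nat -> T -> R[i]) (g : T -> R) :
  (forall n, cmf (f_ n)) -> mu.-integrable setT (EFin \o g) ->
  (forall n x, csq (f_ n x) <= g x) ->
  (forall x, csq (f_ n x) @[n --> \oo] --> 0) ->
  n2 mu (f_ n) @[n --> \oo] --> 0.
Proof.
move=> mf ig fg f0.
have [||||_ _ H] := @dominated_convergence _ T R mu setT measurableT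
  (fun n x => (csq (f_ n x))%:E) (cst 0%E) (EFin \o g) _ _ _ ig _.
- by move=> n; exact: measurable_csqE.
- exact: measurable_cst.
- apply: aeW => x _; apply/fine_cvgP; split; first exact: nearW.
  exact: f0.
- by apply: aeW => x n _ /=; rewrite lee_fin ger0_norm ?csq_ge0.
rewrite integral0 in H.
exact: (fine_cvg H).
Qed.

Lemma n2B_le3 (f g k : T -> R[i]) : inL2 mu f -> inL2 mu g -> inL2 mu k ->
  n2 mu (fun x => f x - g x) <=
  2 * n2 mu (fun x => f x - k x) + 2 * n2 mu (fun x => k x - g x).
Proof.
move=> Lf Lg Lk; apply: le_trans (n2_le2 (inL2B Lf Lk) (inL2B Lk Lg)).
by rewrite le_eqVlt; apply/orP; left; apply/eqP; congr n2; apply/funext => x; ring.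
Qed.

End L2_convergence.

Section translation.
Context {R : realType}.
Notation mu := (@lebesgue_measure R).
Notation RR := (measurableTypeR R).

Definition shift_cont (u : RR -> R[i]) : Prop :=
  forall e : R, 0 < e -> exists2 r : R, 0 < r &
    forall y : R, `|y| < r -> n2 mu (fun x => u (x + y) - u x) <= e.

Lemma shift_contD u v : inL2 mu u -> inL2 mu v -> shift_cont u -> shift_cont v ->
  shift_cont (fun x => u x + v x).
Proof.
move=> Lu Lv cu cv e e0; have e40 : 0 < e / 4 by rewrite divr_gt0.
have [r r0 ru] := cu _ e40; have [s s0 sv] := cv _ e40.
exists (Num.min r s); first by rewrite lt_min r0.
move=> y; rewrite lt_min => /andP[yr ys].
rewrite (_ : (fun x => _) = fun x => (u (x + y) - u x) + (v (x + y) - v x)); last first.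
  by apply/funext => x; ring.
apply: (le_trans (n2_le2 _ _)).
- by apply: inL2B => //; exact: inL2_shift.
- by apply: inL2B => //; exact: inL2_shift.
have := ru _ yr; have := sv _ ys; lra.
Qed.

Lemma shift_contZ z u : inL2 mu u -> shift_cont u -> shift_cont (fun x => z * u x).
Proof.
move=> Lu cu e e0; have z0 : 0 < csq z + 1 by rewrite ltr_wpDl ?csq_ge0.
have [r r0 ru] := cu _ (divr_gt0 e0 z0).
exists r => // y yr.
rewrite (_ : (fun x => _) = fun x => z * (u (x + y) - u x)); last first.
  by apply/funext => x; ring.
rewrite n2Z; last by apply: inL2B => //; exact: inL2_shift.
have := ru _ yr; rewrite ler_pdivlMr// => h.
have := n2_ge0 mu (fun x => u (x + y) - u x); have := csq_ge0 z; nra.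
Qed.

Lemma shift_cont_dense (u : RR -> R[i]) : inL2 mu u ->
  (forall e : R, 0 < e -> exists v, [/\ inL2 mu v, shift_cont v & n2 mu (fun x => u x - v x) <= e]) ->
  shift_cont u.
Proof.
(* Two uses of [n2B_le3] multiply the error by 2 + 2 (2 + 2) = 10. *)
move=> Lu H e e0; have e20 : 0 < e / 20 by rewrite divr_gt0.
have [v [Lv cv uv]] := H _ e20; have [r r0 rv] := cv _ e20; exists r => // y yr.
have Ly := inL2_shift y.
rewrite (le_trans (n2B_le3 (Ly _ Lu) Lu (Ly _ Lv)))//.
have h1 : n2 mu (fun x => u (x + y) - v (x + y)) <= e / 20.
  by have /= -> := n2_shift y (inL2B Lu Lv).
have h2 := n2B_le3 (Ly _ Lv) Lu Lv.
have h3 : n2 mu (fun x => v x - u x) <= e / 20.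
  rewrite (le_trans _ uv)// -n2N le_eqVlt; apply/orP; left; apply/eqP.
  by congr n2; apply/funext => x; rewrite opprB.
have := rv _ yr; lra.
Qed.

(** Dominated convergence works along sequences, so the failure of continuity is first turned into
    shifts [y n] tending to 0. *)
Lemma shift_cont_continuous (v : R -> R) (M N : R) : continuous v ->
  (forall x, `|v x| <= M) -> (forall x, N < `|x| -> v x = 0) ->
  shift_cont (fun x => (v x)%:C).
Proof.
move=> cv vM vN e e0; apply/not_exists2P => H.
have {}H n : exists y, `|y| < n.+1%:R^-1 /\
    e < n2 mu (fun x => (v (x + y))%:C - (v x)%:C).
  have [|/existsNP[y /not_implyP[yn /negP]]] := H n.+1%:R^-1; first by [].
  by rewrite -ltNge; exists y.
have [y Hy] := choice H.
have y0 : y n @[n --> \oo] --> 0.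
  apply/cvgr0Pnorm_le => eps eps0; near=> n.
  rewrite (le_trans (ltW (Hy n).1))//; apply: ltW; near: n.
  exact: (near_infty_natSinv_lt (PosNum eps0)).
have y1 n : `|y n| <= 1.
  by rewrite (le_trans (ltW (Hy n).1))// invf_le1// ler1n.
have mv : measurable_fun [set: RR] v by exact: continuous_measurable_fun.
suff /cvgr0Pnorm_lt/(_ _ e0) [n _ /(_ n (leqnn _))] :
    n2 mu (fun x => (v (x + y n))%:C - (v x)%:C) @[n --> \oo] --> 0.
  rewrite ger0_norm ?n2_ge0// => /(lt_trans (Hy n).2).
  by rewrite ltxx.
(* The shifts are at most 1, so the differences are supported in the band widened by 1 and bounded
   by [2 * M]. *)
apply: (@n2_dct _ _ _ mu (fun n x => (v (x + y n))%:C - (v x)%:C)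
  (fun x => 4 * M ^+ 2 * \1_(`[- (N + 1), N + 1]%classic) x)).
- move=> n; apply: cmfB; last exact: cmf_real.
  by apply: cmf_real; exact: (measurableT_comp mv (measurable_shiftR (y n))).
- apply: intRZ => //; exact: integrable_indic_itv.
- move=> n x; rewrite -rmorphB csq_real.
  have M0 : 0 <= M by rewrite (le_trans _ (vM 0)).
  have [xN|xN] := leP `|x| (N + 1).
    rewrite indicE mem_set/= ?in_itv/= -?ler_norml// mulr1.
    rewrite -real_normK ?num_real//.
    have : `|v (x + y n) - v x| <= 2 * M.
      by rewrite (le_trans (ler_normB _ _))// mulr_natl mulr2n lerD.
    by have := normr_ge0 (v (x + y n) - v x); nra.
  rewrite !vN ?subrr ?expr0n/=.
  - by rewrite !mulr_ge0// sqr_ge0.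
  - by rewrite (lt_trans _ xN)// ltrDl.
  - have := lerB_normD x (y n); have := y1 n; lra.
- move=> x; under eq_fun do rewrite -rmorphB csq_real.
  rewrite (_ : 0 = (v x - v x) ^+ 2); last by rewrite subrr expr0n.
  apply: (@cvg_comp _ _ _ (fun n => v (x + y n) - v x) (fun z => z ^+ 2) _ (nbhs (v x - v x)));
    last exact: exprn_continuous.
  apply: cvgB; last exact: cvg_cst.
  apply: (@cvg_comp _ _ _ (fun n => x + y n) v _ (nbhs x)); last exact: cv.
  rewrite -[X in _ `=>` nbhs X]addr0; apply: (@cvgD _ _ _ _ _ (fun=> x) y) => //.
  exact: cvg_cst.
Unshelve. all: by end_near. Qed.

Lemma clip_continuous (a b : R) (g : R -> R) : continuous g ->
  continuous (fun x => Num.max a (Num.min b (g x))).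
Proof.
move=> cg; apply: (@max_fun_continuous _ _ _ (fun=> a) (fun x => Num.min b (g x))).
  exact: cst_continuous.
apply: (@min_fun_continuous _ _ _ (fun=> b) g) => //.
exact: cst_continuous.
Qed.

Lemma clip_le (M x : R) : 0 <= M -> `|Num.max (- M) (Num.min M x)| <= M.
Proof.
by move=> M0; rewrite ler_norml le_max lexx/= ge_max ge_min lexx/= andbT ge0_cp.
Qed.

Lemma clip_dist (M x r : R) : `|r| <= M ->
  `|r - Num.max (- M) (Num.min M x)| <= `|r - x|.
Proof.
rewrite ler_norml => /andP[r1 r2].
have [xM|xM] := leP M x.
  rewrite max_r; last by lra.
  rewrite ler0_norm; last by lra.
  by rewrite ler0_norm; lra.
have [xM'|xM'] := leP x (- M); last by [].
rewrite ger0_norm; last by lra.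
by rewrite ger0_norm; lra.
Qed.

(** Continuous functions are dense in L1 of a bounded interval. Clipping the approximant at [M] and
    multiplying it by the trapezoid [chi] does not increase its distance to [r]; between functions
    bounded by [M] the squared L2 distance is at most [2 * M] times the L1 distance. *)
Lemma shift_cont_bounded (r : R -> R) (M : R) : 0 < M -> measurable_fun setT r ->
  (forall x, `|r x| <= M) -> (forall x, M < `|x| -> r x = 0) ->
  shift_cont (fun x => (r x)%:C).
Proof.
move=> M0 mr rM rM0; pose E := `[- (M + 1), M + 1]%classic : set RR.
have mE : measurable E by exact: measurable_itv.
have EE x : E x = (`|x| <= M + 1) by rewrite /E /= in_itv/= ler_norml.
have muE : (mu E < +oo)%E.
  by rewrite /E lebesgue_measure_itv/= ; case: ifPn => // _; rewrite ltry.
have L2M (f : RR -> R) : measurable_fun setT f -> (forall x, `|f x| <= M) ->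
    (forall x, M + 1 < `|x| -> f x = 0) -> inL2 mu (fun x => (f x)%:C).
  move=> mf fM f0; apply: (@inL2_dom _ _ _ _ _ (fun x => M ^+ 2 * \1_E x)).
  - exact: cmf_real.
  - by apply: intRZ => //; exact: integrable_indic_itv.
  - move=> x; rewrite csq_real; have [xN|xN] := leP `|x| (M + 1).
      rewrite indicE mem_set ?EE// mulr1.
      by rewrite -real_normK ?num_real// lerXn2r// ?nnegrE// ltW.
    by rewrite f0// expr0n/= mulr_ge0// sqr_ge0.
have Lr : inL2 mu (fun x => (r x)%:C).
  by apply: L2M => // x xM; rewrite rM0// (lt_trans _ xM)// ltrDl.
apply: shift_cont_dense => // e e0.
have ir : mu.-integrable E (EFin \o r).
  apply: measurable_bounded_integrable => //; first exact: measurable_funTS.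
  exists M; split; first exact: num_real.
  by move=> y My x _ /=; exact: le_trans (rM x) (ltW My).
have [g [cg ig gr]] := approximation_continuous_integrable mE muE ir.
have e2M : 0 < e / (2 * M) by rewrite divr_gt0// mulr_gt0.
have [n gn] : exists n, (\int[mu]_(z in E) `|(r z - g n z)%:E| < (e / (2 * M))%:E)%E.
  move/fine_cvgP : gr => [gfin /cvgr0Pnorm_lt gr0].
  have [n [gf gl]] := filter_ex (filterI gfin (gr0 _ e2M)).
  by exists n; rewrite -(fineK gf) lte_fin (le_lt_trans (ler_norm _) gl).
pose chi (x : R) : R := Num.max 0 (Num.min 1 (M + 1 - `|x|)).
have chi01 x : 0 <= chi x <= 1.
  by rewrite /chi le_max lexx/= ge_max ler01 ge_min lexx.
have cchi : continuous chi.
  apply: (@clip_continuous 0 1 (fun x : R => M + 1 - `|x|)) => x.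
  apply: cvgB; first exact: cvg_cst.
  exact: norm_continuous.
pose G (x : R) : R := Num.max (- M) (Num.min M (g n x)).
have cG : continuous G by apply: clip_continuous; exact: cg.
have GM x : `|G x| <= M by apply: clip_le; exact: ltW.
pose v (x : R) : R := G x * chi x.
have cv : continuous v.
  move=> x; apply: cvgM; last exact: cchi.
  exact: cG.
have vM x : `|v x| <= M.
  have /andP[c0 c1] := chi01 x.
  by rewrite normrM (ger0_norm c0) (le_trans _ (GM x))// ler_piMr.
have v0 x : M + 1 < `|x| -> v x = 0.
  move=> xM; rewrite /v /chi max_l ?mulr0//.
  by rewrite ge_min; apply/orP; right; rewrite subr_le0 ltW.
have mv : measurable_fun [set: RR] v by exact: continuous_measurable_fun.
have Lv : inL2 mu (fun x => (v x)%:C) by exact: L2M.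
exists (fun x => (v x)%:C); split => //.
  exact: (@shift_cont_continuous _ M (M + 1)).
have key x : csq ((r x)%:C - (v x)%:C) <= 2 * M * (`|r x - g n x| * \1_E x).
  rewrite -rmorphB csq_real -real_normK ?num_real//.
  have d2M : `|r x - v x| <= 2 * M.
    by rewrite (le_trans (ler_normB _ _))// mulr_natl mulr2n lerD.
  suff d : `|r x - v x| <= `|r x - g n x| * \1_E x.
    by rewrite expr2 ler_pM.
  have [xM1|xM1] := leP `|x| (M + 1); last first.
    rewrite v0// rM0 ?subrr ?normr0 ?mulr_ge0//.
    by rewrite (lt_trans _ xM1)// ltrDl.
  rewrite indicE mem_set ?EE// mulr1.
  have [xM|xM] := leP `|x| M.
    rewrite /v (_ : chi x = 1) ?mulr1; first exact: clip_dist.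
    by rewrite /chi min_l ?max_r ?ler01//; lra.
  rewrite rM0// /v sub0r normrN normrM.
  have /andP[c0 c1] := chi01 x; rewrite (ger0_norm c0).
  have := @clip_dist M (g n x) 0; rewrite normr0 !sub0r !normrN => /(_ (ltW M0)) h.
  by rewrite (le_trans _ h)// ler_piMr.
have mgr : measurable_fun E (fun x => (r x - g n x)).
  apply: measurable_funB; first exact: measurable_funTS.
  by apply: measurable_funTS; exact: continuous_measurable_fun.
have : (sq2 mu (fun x => (r x)%:C - (v x)%:C)%R <= e%:E)%E.
  apply: (@le_trans _ _ (\int[mu]_x ((2 * M)%:E * ((fun x => `|(r x - g n x)%:E|) \_ E) x))%E).
    apply: ge0_le_integral => //.
    - by move=> x _; rewrite lee_fin csq_ge0.
    - by apply: measurable_csqE; apply: cmfB; exact: cmf_real.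
    - apply: measurable_funeM; apply/(measurable_restrictT _ mE).
      by apply: measurableT_comp => //; exact/measurable_EFinP.
    - move=> x _; rewrite (le_trans _ (_ : ((2 * M * (`|r x - g n x| * \1_E x))%R%:E <= _)%E))//.
        by rewrite lee_fin.
      rewrite patchE indicE; case: ifPn => _; first by rewrite mulr1.
      by rewrite !mulr0 mule0.
  rewrite ge0_integralZl//; last 3 first.
  - apply/(measurable_restrictT _ mE).
    by apply: measurableT_comp => //; exact/measurable_EFinP.
  - by move=> x _; rewrite patchE; case: ifPn.
  - by rewrite lee_fin mulr_ge0// ltW.
  rewrite -integral_mkcond.
  have -> : e%:E = ((2 * M)%:E * (e / (2 * M))%:E)%E.
    by rewrite -EFinM; congr EFin; field; rewrite gt_eqF.
  by rewrite lee_pmul2l ?ltW// lte_fin mulr_gt0.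
by rewrite sq2E ?lee_fin//; exact: inL2B.
Qed.

(** Truncating both the argument and the value leads back to [shift_cont_bounded]; the error is
    dominated by the square of [r]. *)
Lemma shift_cont_real (r : R -> R) : inL2 mu (fun x : RR => (r x)%:C) ->
  shift_cont (fun x => (r x)%:C).
Proof.
move=> Lr; have mr : measurable_fun [set: RR] r by exact: Lr.1.1.
pose A n := [set x : RR | `|x| <= n.+1%:R /\ `|r x| <= n.+1%:R].
have mA n : measurable (A n).
  have -> : A n = (fun x : RR => `|x|) @^-1` `]-oo, n.+1%:R] `&`
      (fun x : RR => `|r x|) @^-1` `]-oo, n.+1%:R].
    by apply/seteqP; split => x /=; rewrite !in_itv.
  apply: measurableI; rewrite -[X in measurable X]setTI.
    by apply: (@normr_measurable R setT).
  by have : measurable_fun [set: RR] (fun x => `|r x|) by [exact: measurableT_comp]; apply.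
pose rn n x := r x * \1_(A n) x.
have mrn n : measurable_fun [set: RR] (rn n).
  by apply: measurable_funM => //; exact: measurable_indic.
have rnr n x : csq ((r x)%:C - (rn n x)%:C) <= csq (r x)%:C.
  rewrite -rmorphB !csq_real /rn indicE; case: (x \in _); rewrite ?mulr1 ?subrr ?mulr0 ?subr0//.
  by rewrite expr0n sqr_ge0.
have Lrn n : inL2 mu (fun x => (rn n x)%:C).
  apply: (@inL2_dom _ _ _ _ _ (fun x : RR => csq (r x)%:C)).
  - exact: cmf_real.
  - exact: inL2_csq.
  - move=> x; rewrite !csq_real /rn exprMn ler_piMr ?sqr_ge0//.
apply: shift_cont_dense => // e e0.
have : n2 mu (fun x => (r x)%:C - (rn n x)%:C) @[n --> \oo] --> 0.
  apply: (@n2_dct _ _ _ _ (fun n (x : RR) => (r x)%:C - (rn n x)%:C) (fun x : RR => csq (r x)%:C)).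
  - by move=> n; apply: cmfB; exact: cmf_real.
  - exact: inL2_csq.
  - exact: rnr.
  - move=> x; apply: cvg_near_cst.
    exists (Num.trunc (`|x| + `|r x|)) => // n /= hn.
    rewrite /rn indicE mem_set ?mulr1 ?subrr ?csq0//.
    have : `|x| + `|r x| < n.+1%:R by rewrite -truncn_le_nat.
    by rewrite /A /=; have := normr_ge0 x; have := normr_ge0 (r x); lra.
move=> /cvgr0Pnorm_le/(_ _ e0) [n _ /(_ n (leqnn _))].
rewrite ger0_norm ?n2_ge0// => h; exists (fun x => (rn n x)%:C); split => //.
apply: (@shift_cont_bounded _ n.+1%:R) => //.
- exact: mrn.
- move=> x; rewrite /rn indicE; case: (boolP (x \in _)); rewrite ?mulr0 ?normr0// inE mulr1.
  by case.
- move=> x nx; rewrite /rn indicE memNset ?mulr0//.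
  by case => /(lt_le_trans nx); rewrite ltxx.
Qed.

Lemma shift_cont_L2 (u : R -> R[i]) : inL2 mu u -> shift_cont u.
Proof.
move=> Lu.
have Lr : inL2 mu (fun x => (complex.Re (u x))%:C).
  apply: (@inL2_dom _ _ _ _ _ (fun x : RR => csq (u x))).
  - by apply: cmf_real; exact: Lu.1.1.
  - exact: inL2_csq.
  - by move=> x; rewrite csq_real /csq lerDl sqr_ge0.
have Li : inL2 mu (fun x => (complex.Im (u x))%:C).
  apply: (@inL2_dom _ _ _ _ _ (fun x : RR => csq (u x))).
  - by apply: cmf_real; exact: Lu.1.2.
  - exact: inL2_csq.
  - by move=> x; rewrite csq_real /csq lerDr sqr_ge0.
rewrite (_ : u = fun x => (complex.Re (u x))%:C + 'i%C * (complex.Im (u x))%:C).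
  apply: shift_contD => //; first exact: inL2Z.
    exact: shift_cont_real.
  by apply: shift_contZ => //; exact: shift_cont_real.
by apply/funext => x; apply: complex_eqP; rewrite !reimE /=; ring.
Qed.

End translation.

(** * Fourier integrals *)

Section parametric.
Context {R : realType}.
Notation mu := (@lebesgue_measure R).
Notation RR := (measurableTypeR R).

Lemma measurable_Rintegral_param (f : RR * RR -> R) :
  (mu \x mu)%E.-integrable setT (EFin \o f) ->
  measurable_fun [set: RR] (fun x => \int[mu]_y f (x, y)).
Proof.
move=> fi; have := measurable_fubini_F fi => mF.
by apply: (measurableT_comp _ mF); exact: fine_measurable.
Qed.

Lemma cmf_cint_param (f : RR * RR -> R[i]) : cintb (mu \x mu)%E f ->
  cmR (fun x : RR => cint mu (fun y => f (x, y))).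
Proof.
move=> [fr fi]; split => /=.
  exact: (measurable_Rintegral_param fr).
exact: (measurable_Rintegral_param fi).
Qed.

Lemma cmf_prodM (p q : RR -> R[i]) : cmR p -> cmR q ->
  cmf (fun z : RR * RR => p z.1 * q z.2).
Proof. by move=> mp mq; apply: cmfM; exact: cmf_comp. Qed.

(** The unnormalized transform with the sign of the phase as a parameter: [s = -1] is the direct
    transform and [s = 1] the inverse one. *)
Definition FTs (s : R) (q : RR -> R[i]) (x : RR) : R[i] :=
  cint mu (fun y => q y * expi (s * (x * y))).

Lemma measurable_phase (s x : R) : measurable_fun [set: RR] (fun y : RR => s * (x * y)).
Proof. by apply: measurable_funM => //; apply: measurable_funM. Qed.

Lemma cintbMu (q u : RR -> R[i]) : cintb mu q -> cmR u -> (forall x, csq (u x) <= 1) ->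
  cintb mu (fun x => q x * u x).
Proof.
move=> iq cu u1; apply: (@cintb_dom _ _ _ _ _ (fun x => normc (q x))).
- by apply: cmfM => //; exact: cintb_cmf iq.
- exact: cintb_normc.
- move=> x; rewrite normcM ler_piMr ?normc_ge0// normc_sqrt.
  by rewrite -sqrtr1 ler_wsqrtr.
Qed.

Lemma cintb_FTs s q x : cintb mu q -> cintb mu (fun y => q y * expi (s * (x * y))).
Proof.
move=> iq; apply: cintbMu => //; last by move=> y; rewrite csq_expi.
by apply: cmf_expi; exact: measurable_phase.
Qed.

Lemma cintb_FTs_prod s p q : cintb mu p -> cintb mu q ->
  cintb (mu \x mu)%E (fun z : RR * RR => p z.1 * q z.2 * expi (s * (z.1 * z.2))).
Proof.
move=> ip iq; have mp := cintb_cmf ip; have mq := cintb_cmf iq.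
apply: (@cintb_dom _ _ _ _ _ (fun z : RR * RR => normc (p z.1) * normc (q z.2))).
- apply: cmfM; first exact: cmf_prodM.
  by apply: cmf_expi; apply: measurable_funM => //; exact: measurable_funM.
- by apply: (@integrable_prodM _ (fun x => normc (p x)) (fun y => normc (q y)));
    exact: cintb_normc.
- by move=> z; rewrite !normcM [X in _ * X]normc_sqrt csq_expi sqrtr1 mulr1.
Qed.

(** Fubini: the phase [s * (x * y)] is symmetric in the two variables. *)
Lemma multiplication_formula s (p q : RR -> R[i]) : cintb mu p -> cintb mu q ->
  cint mu (fun x => p x * FTs s q x) = cint mu (fun y => q y * FTs s p y).
Proof.
move=> ip iq; have mp := cintb_cmf ip; have mq := cintb_cmf iq.
pose f (z : RR * RR) := p z.1 * q z.2 * expi (s * (z.1 * z.2)).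
transitivity (cint mu (fun x => cint mu (fun y => f (x, y)))).
  apply: eq_cint => x; rewrite -cintZ; last exact: cintb_FTs.
  by apply: eq_cint => y; rewrite mulrA.
have [fr fi] := cintb_FTs_prod s ip iq.
rewrite (@cint_fubini _ f (fun z => normc (p z.1) * normc (q z.2))).
- apply: eq_cint => y; rewrite -cintZ; last exact: cintb_FTs.
  by apply: eq_cint => x; rewrite /f /= [y * x]mulrC; ring.
- exact: (cintb_cmf (cintb_FTs_prod s ip iq)).
- by apply: (@integrable_prodM _ (fun x => normc (p x)) (fun y => normc (q y)));
    exact: cintb_normc.
- by move=> z; rewrite /f !normcM [X in _ * X]normc_sqrt csq_expi sqrtr1 mulr1.
- move=> x; rewrite /f /=.
  under eq_fun do rewrite -mulrA.
  by apply: cintbZ; exact: cintb_FTs.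
- move=> y; rewrite /f /=.
  under eq_fun do rewrite [p _ * _]mulrC -mulrA [_ * y]mulrC.
  by apply: cintbZ; exact: cintb_FTs.
Qed.

Lemma cintb_abel (e : R) : 0 < e -> cintb mu (fun x : RR => (abel e x)%:C).
Proof. by move=> e0; apply: cintb_real; exact: integrable_abel. Qed.

(** Measurability in the parameter is inherited from integrability on the plane, which [q y] times a
    phase does not have. The positive factor [abel 1 x] provides it and is divided out
    afterwards. *)
Lemma cmf_FTs s q : cintb mu q -> cmR (FTs s q).
Proof.
move=> iq; have ia := cintb_abel (@ltr01 R).
have := cmf_cint_param (cintb_FTs_prod s ia iq) => /= H.
rewrite (_ : FTs s q = fun x : RR => ((abel 1 x)^-1)%:C *
  cint mu (fun y => (abel 1 x)%:C * q y * expi (s * (x * y)))).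
  apply: cmfM => //; apply: cmf_real.
  apply: continuous_measurable_fun => x; apply: cvgV; last exact: continuous_abel.
  by rewrite gt_eqF// expR_gt0.
apply/funext => x; rewrite /FTs.
under [in RHS]eq_fun do rewrite -mulrA.
rewrite [in RHS]cintZ; last exact: cintb_FTs.
by rewrite mulrA -rmorphM mulVf ?mul1r// gt_eqF// expR_gt0.
Qed.

Lemma FTs_bounded s q : cintb mu q -> forall x, normc (FTs s q x) <= 2 * \int[mu]_x normc (q x).
Proof.
move=> iq x; rewrite (le_trans (normc_cint_le (cintb_FTs s x iq)))//.
rewrite le_eqVlt; apply/orP; left; apply/eqP; congr (_ * _).
by apply: eq_Rintegral => y _; rewrite normcM [X in _ * X]normc_sqrt csq_expi sqrtr1 mulr1.
Qed.

Lemma cintb_boundedM (p q : RR -> R[i]) (B : R) : cintb mu p -> cmR q ->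
  (forall x, normc (q x) <= B) -> cintb mu (fun x => p x * q x).
Proof.
move=> ip mq qB; apply: (@cintb_dom _ _ _ _ _ (fun x => B * normc (p x))).
- by apply: cmfM => //; exact: cintb_cmf ip.
- by apply: intRZ => //; exact: cintb_normc.
- by move=> x; rewrite normcM mulrC ler_wpM2r ?normc_ge0.
Qed.

Lemma FTsJ s q x : cintb mu q -> (FTs s q x)^* = FTs (- s) (fun y => (q y)^*) x.
Proof.
move=> iq; rewrite /FTs -cintJ; last exact: cintb_FTs.
by apply: eq_cint => y; rewrite conjcM expiJ mulNr.
Qed.

(** Two uses of the multiplication formula free [u] and then [v] from their transforms; what remains
    is the Fourier integral of the Abel weight at [s - t], a Poisson kernel. *)
Lemma abel_FTs_pair (e : R) (u v : RR -> R[i]) : 0 < e -> cintb mu u -> cintb mu v ->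
  cint mu (fun x : RR => (abel e x)%:C * (FTs (-1) u x * (FTs (-1) v x)^*)) =
  cint mu (fun t => u t * cint mu (fun s => (v s)^* * (2 * pi * poisson e (s - t))%:C)).
Proof.
move=> e0 iu iv; have ivJ := cintbJ iv.
pose p (x : RR) := (abel e x)%:C * (FTs (-1) v x)^*.
have ip : cintb mu p.
  apply: (@cintb_boundedM _ _ (2 * \int[mu]_x normc (v x))).
  - exact: cintb_abel.
  - by apply: cmfJ; exact: cmf_FTs.
  - by move=> x; rewrite normc_sqrt csqJ -normc_sqrt; exact: FTs_bounded.
transitivity (cint mu (fun x => p x * FTs (-1) u x)).
  by apply: eq_cint => x; rewrite /p mulrAC mulrA.
rewrite (multiplication_formula (-1) ip iu); apply: eq_cint => t; congr (u t * _).
pose p' (x : RR) := (abel e x)%:C * expi (- 1 * (t * x)).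
have ip' : cintb mu p' by apply: cintb_FTs; exact: cintb_abel.
rewrite /FTs; transitivity (cint mu (fun x => p' x * FTs 1 (fun y => (v y)^*) x)).
  by apply: eq_cint => x; rewrite /p FTsJ// opprK mulrAC.
rewrite (multiplication_formula 1 ip' ivJ); apply: eq_cint => s; congr ((v s)^* * _).
rewrite -cint_abel//; apply: eq_cint => x.
by rewrite /p' -mulrA -expiD; congr (_ * expi _); ring.
Qed.

Lemma cintb_cint_param (f : RR * RR -> R[i]) : cintb (mu \x mu)%E f ->
  (forall x, cintb mu (fun y => f (x, y))) ->
  cintb mu (fun x : RR => cint mu (fun y => f (x, y))).
Proof.
move=> [fr fi] f1; split => /=.
  have := integrable_fubini_F fr; apply: eq_integrable => // x _ /=.
  by rewrite /Rintegral fineK//; apply: integrable_fin_num => //; exact: (f1 x).1.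
have := integrable_fubini_F fi; apply: eq_integrable => // x _ /=.
by rewrite /Rintegral fineK//; apply: integrable_fin_num => //; exact: (f1 x).2.
Qed.

(** This is the majorant for Fubini in [autocorrelation_cintb]; by translation invariance its inner
    integral is [2 * n2 mu u * k y]. *)
Lemma integrable_autocorrelation (k : R -> R) (u : RR -> R[i]) :
  (forall y, 0 <= k y) -> mu.-integrable setT (EFin \o k) -> inL2 mu u ->
  (mu \x mu)%E.-integrable setT
    (EFin \o (fun z : RR * RR => k z.1 * (csq (u z.2) + csq (u (z.2 + z.1))))).
Proof.
move=> k0 ik Lu; have mu' := Lu.1.
have mk : measurable_fun [set: RR] k by apply/measurable_EFinP; exact: measurable_int ik.
have mg : measurable_fun setT (EFin \o (fun z : RR * RR => k z.1 * (csq (u z.2) + csq (u (z.2 + z.1))))).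
  apply/measurable_EFinP; apply: measurable_funM.
    by apply: measurableT_comp.
  apply: measurable_funD; first by apply: measurable_csq; exact: cmf_comp.
  apply: measurable_csq; apply: (@cmf_comp _ _ _ _ _ u (fun z : RR * RR => z.2 + z.1)) => //.
  exact: measurable_funD.
have g0 z : 0 <= k z.1 * (csq (u z.2) + csq (u (z.2 + z.1))).
  by rewrite mulr_ge0// addr_ge0// csq_ge0.
apply: (proj2 (@integrable12ltyP _ _ RR RR R mu mu _ mg)) => /=.
rewrite (eq_integral (fun y : RR => ((2 * n2 mu u)%:E * (k y)%:E)%E)); last first.
  move=> y _; have Ly := inL2_shift y Lu.
  rewrite (eq_integral
    (fun t : RR => ((k y)%:E * ((csq (u t))%:E + (csq (u (t + y)))%:E))%E)); last first.
    by move=> t _; rewrite ger0_norm// ?(g0 (y, t)).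
  rewrite ge0_integralZl//; last 3 first.
  - by apply: emeasurable_funD; apply: measurable_csqE => //; exact: cmf_shift.
  - by move=> x _; rewrite adde_ge0// lee_fin csq_ge0.
  - by rewrite lee_fin.
  rewrite ge0_integralD//.
  - rewrite muleC; congr (_ * _)%E.
    by rewrite -/(sq2 mu u) -/(sq2 mu (fun t => u (t + y))) !sq2E// n2_shift// -EFinD mulr_natl mulr2n.
  - by move=> x _; rewrite lee_fin csq_ge0.
  - exact: measurable_csqE.
  - by move=> x _; rewrite lee_fin csq_ge0.
  - by apply: measurable_csqE; exact: cmf_shift.
have := intRZ measurableT (2 * n2 mu u) ik => /integrable_lty.
by under eq_integral do rewrite /= EFinM; apply.
Qed.

(** Substitute [s = t + y] and exchange the integrals. Integrability of [u] and the bound [B] on [k]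
    make the slices in [y] integrable for every [t]. *)
Lemma autocorrelation_cintb (k : R -> R) (B : R) (u : RR -> R[i]) :
  (forall y, 0 <= k y) -> (forall y, k y <= B) ->
  mu.-integrable setT (EFin \o k) -> cintb mu u -> inL2 mu u ->
  cintb mu (fun y : RR => (k y)%:C * ip mu u (fun t => u (t + y))) /\
  cint mu (fun t => u t * cint mu (fun s => (u s)^* * (k (s - t))%:C)) =
  cint mu (fun y : RR => (k y)%:C * ip mu u (fun t => u (t + y))).
Proof.
move=> k0 kB ik iu Lu; have mu' := Lu.1.
have mk : measurable_fun [set: RR] k by apply/measurable_EFinP; exact: measurable_int ik.
pose f (z : RR * RR) := (k z.1)%:C * (u z.2 * (u (z.2 + z.1))^*).
have mf : cmf f.
  apply: cmfM; first by apply: cmf_real; exact: measurableT_comp.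
  apply: cmfM; first exact: cmf_comp.
  apply: cmfJ; apply: (@cmf_comp _ _ _ _ _ u (fun z : RR * RR => z.2 + z.1)) => //.
  exact: measurable_funD.
have fg z : normc (f z) <= k z.1 * (csq (u z.2) + csq (u (z.2 + z.1))).
  rewrite /f normcM [X in X * _]normc_sqrt csq_real sqrtr_sqr ger0_norm//.
  by rewrite ler_wpM2l// (le_trans (normc_le_csq _ _))// csqJ.
have ig := integrable_autocorrelation k0 ik Lu.
have f1 y : cintb mu (fun t => f (y, t)).
  rewrite /f /=; apply: cintbZ; apply: cintb_ip => //; exact: inL2_shift.
have f2 t : cintb mu (fun y => f (y, t)).
  rewrite (_ : (fun y => _) = fun y : RR => u t * ((u (y + t))^* * (k y)%:C)).
    apply: cintbZ; apply: (@cintb_boundedM _ _ B).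
    - apply: cintbJ; exact: cintb_shift.
    - exact: cmf_real.
    - by move=> x; rewrite normc_sqrt csq_real sqrtr_sqr ger0_norm.
  by apply/funext => y; rewrite /f /= [t + y]addrC; ring.
have E y : cint mu (fun t => f (y, t)) = (k y)%:C * ip mu u (fun t => u (t + y)).
  by rewrite /f /= cintZ//; apply: cintb_ip => //; exact: inL2_shift.
have -> : (fun y : RR => (k y)%:C * ip mu u (fun t => u (t + y))) =
    fun y : RR => cint mu (fun t => f (y, t)) by apply/funext => y; rewrite E.
split; first by apply: cintb_cint_param => //; exact: cintb_dom mf ig fg.
rewrite (cint_fubini mf ig fg f1 f2); apply: eq_cint => t.
rewrite -(cint_shift t); last first.
  apply: (@cintb_boundedM _ _ B).
  - exact: cintbJ.
  - by apply: cmf_real; exact: (measurableT_comp mk (measurable_shiftR (- t))).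
  - by move=> x; rewrite normc_sqrt csq_real sqrtr_sqr ger0_norm.
rewrite -cintZ; last first.
  apply: (@cintb_boundedM _ _ B).
  - apply: cintbJ; exact: cintb_shift.
  - by apply: cmf_real; apply: (measurableT_comp mk);
      apply: (measurableT_comp (measurable_shiftR (- t)) (measurable_shiftR t)).
  - by move=> x; rewrite normc_sqrt csq_real sqrtr_sqr ger0_norm.
by apply: eq_cint => y; rewrite /f /= addrK [t + y]addrC; ring.
Qed.

Lemma poisson_le (e y : R) : 0 < e -> poisson e y <= (pi * e)^-1.
Proof.
move=> e0; rewrite /poisson; have := @pi_gt0 R; generalize (@pi R) => p p0.
have ey : 0 < e ^+ 2 + y ^+ 2 by rewrite ltr_pwDl ?exprn_gt0 ?sqr_ge0.
rewrite ler_pdivrMr ?mulr_gt0// mulrC ler_pdivlMr ?mulr_gt0//.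
by rewrite mulrCA ler_pM2l// -expr2 lerDl sqr_ge0.
Qed.

Lemma Re_ip_shift (u : RR -> R[i]) (y : R) : inL2 mu u ->
  complex.Re (ip mu u (fun t => u (t + y))) =
  n2 mu u - n2 mu (fun t => u (t + y) - u t) / 2.
Proof.
move=> Lu; rewrite (n2B (inL2_shift y Lu) Lu) (n2_shift y Lu) (ipJ Lu (inL2_shift y Lu)) cReJ.
by field.
Qed.

Lemma Re_cint (f : RR -> R[i]) : complex.Re (cint mu f) = \int[mu]_x complex.Re (f x).
Proof. by []. Qed.

Lemma abel_plancherel_defect (e : R) (u : RR -> R[i]) : 0 < e -> cintb mu u -> inL2 mu u ->
  let w y := n2 mu (fun t => u (t + y) - u t) in
  mu.-integrable setT (EFin \o (fun y => poisson e y * w y)) /\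
  \int[mu]_x (abel e x * csq (FTs (-1) u x)) =
    2 * pi * n2 mu u - pi * \int[mu]_y (poisson e y * w y).
Proof.
move=> e0 iu Lu w; have p0 := @pi_gt0 R.
pose k y := 2 * pi * poisson e y.
have pi2 : 0 < 2 * pi :> R by apply: mulr_gt0.
have k0 y : 0 <= k y by apply: mulr_ge0; [exact: ltW|exact: poisson_ge0].
have kB y : k y <= 2 * pi * (pi * e)^-1.
  by rewrite ler_pM2l// poisson_le.
have ip0 := integrable_poisson e0.
have ik : mu.-integrable setT (EFin \o k) by exact: intRZ.
have kE (y : RR) : complex.Re ((k y)%:C * ip mu u (fun t => u (t + y))) =
    n2 mu u * k y - pi * (poisson e y * w y).
  by rewrite cReMr Re_ip_shift// /k /w; field.
have i2 : mu.-integrable setT (EFin \o (fun y => n2 mu u * k y - pi * (poisson e y * w y))) /\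
    \int[mu]_x (abel e x * csq (FTs (-1) u x)) =
    \int[mu]_y (n2 mu u * k y - pi * (poisson e y * w y)).
  have [[i1 _] E] := autocorrelation_cintb k0 kB ik iu Lu.
  split; first exact: eq_integrable measurableT _ _ (fun y _ => congr1 EFin (kE y)) i1.
  rewrite -[RHS](eq_Rintegral _ (fun y _ => kE y)) -Re_cint -[cint _ _ in RHS]E.
  rewrite -(abel_FTs_pair e0 iu iu) Re_cint; apply: eq_Rintegral => x _.
  by rewrite csqE -rmorphM.
clear kE; have [{}i2 ->] := i2.
(* Measurability of [w] is not shown directly: integrability of [poisson e * w] is read off, by
   subtraction, from that of the weighted autocorrelation. *)
have iw : mu.-integrable setT (EFin \o (fun y => poisson e y * w y)).
  have := intRZ measurableT (pi^-1) (intRB measurableT (intRZ measurableT (n2 mu u) ik) i2).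
  apply: eq_integrable => // y _; rewrite [LHS]/= [RHS]/=; congr EFin.
  by rewrite opprB addrCA subrr addr0 mulrA mulVf ?mul1r// gt_eqF.
split; first exact: iw.
rewrite (RintegralB measurableT (intRZ measurableT _ ik) (intRZ measurableT _ iw)).
rewrite (RintegralZl _ measurableT ik) (RintegralZl _ measurableT iw).
rewrite (RintegralZl _ measurableT ip0).
rewrite [X in _ * (_ * X)](_ : _ = 1); last first.
  by rewrite /Rintegral integral_poisson.
by rewrite mulr1 mulrC.
Qed.

(** For [y] small the defect is small by continuity of translations and the kernel has mass 1;
    elsewhere the defect is at most [4 * n2 mu u] and the kernel has little mass by
    [poisson_tail]. *)
Lemma poisson_defect_cvg (u : RR -> R[i]) : cintb mu u -> inL2 mu u ->
  \int[mu]_y (poisson n.+1%:R^-1 y * n2 mu (fun t => u (t + y) - u t)) @[n --> \oo] --> 0.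
Proof.
move=> iu Lu; pose w y := n2 mu (fun t => u (t + y) - u t).
have w0 y : 0 <= w y by exact: n2_ge0.
have w4 y : w y <= 4 * n2 mu u.
  rewrite (le_trans (n2_le2 (inL2_shift y Lu) (inL2N Lu)))// n2N n2_shift//; lra.
apply/cvgr0Pnorm_le => e e0.
have e20 : 0 < e / 2 by rewrite divr_gt0.
have [r r0 rw] := shift_cont_L2 Lu e20.
pose C := 4 * n2 mu u * (1 + r ^- 2).
have C0 : 0 <= C.
  by rewrite !mulr_ge0 ?n2_ge0// addr_ge0// invr_ge0 exprn_ge0// ltW.
have eC : 0 < e / 2 / (C + 1) by rewrite divr_gt0// ltr_wpDl.
near=> n.
have n0 : 0 < n.+1%:R^-1 :> R by rewrite invr_gt0.
have [iw _] := abel_plancherel_defect n0 iu Lu.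
rewrite ger0_norm; last first.
  by apply: Rintegral_ge0 => y _; apply: mulr_ge0; [exact: poisson_ge0|exact: n2_ge0].
have h : \int[mu]_y (e / 2 * poisson n.+1%:R^-1 y + C * n.+1%:R^-1 * poisson 1 y) =
    e / 2 + C * n.+1%:R^-1.
  rewrite RintegralD//; [|by apply: intRZ => //; exact: integrable_poisson..].
  rewrite (RintegralZl _ measurableT (integrable_poisson n0)).
  rewrite (RintegralZl _ measurableT (integrable_poisson ltr01)).
  by rewrite /Rintegral !integral_poisson// !mulr1.
apply: (@le_trans _ _ (e / 2 + C * n.+1%:R^-1)).
  rewrite -h; apply: le_Rintegral => //.
    by apply: intRD => //; apply: intRZ => //; exact: integrable_poisson.
  move=> y _; have pn0 := poisson_ge0 y n0; have p10 := poisson_ge0 y (@ltr01 R).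
  have [yr|yr] := ltP `|y| r.
    rewrite -[leLHS]addr0 lerD//; first by rewrite mulrC ler_wpM2r// rw.
    by apply: mulr_ge0 => //; apply: mulr_ge0 => //; exact: ltW.
  rewrite -[leLHS]add0r lerD//; first by apply: mulr_ge0 => //; exact: ltW.
  have := poisson_tail n0 r0 yr => pt.
  rewrite (@le_trans _ _ (n.+1%:R^-1 * (1 + r ^- 2) * poisson 1 y * (4 * n2 mu u)))//.
    by apply: ler_pM => //; [exact: w0|exact: w4].
  by rewrite le_eqVlt; apply/orP; left; apply/eqP; rewrite /C; ring.
have : C * n.+1%:R^-1 <= e / 2.
  rewrite (@le_trans _ _ ((C + 1) * (e / 2 / (C + 1))))//; last first.
    by rewrite mulrC divfK// gt_eqF// ltr_wpDl.
  rewrite ler_pM//; first by rewrite lerDl.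
  by apply: ltW; near: n; exact: (near_infty_natSinv_lt (PosNum eC)).
by move=> hC; rewrite [leRHS](splitr e) lerD2l.
Unshelve. all: by end_near. Qed.

End parametric.

(** * Plancherel *)

Section ae.
Context {d} {T : measurableType d} {R : realType}.
Variable mu : {measure set T -> \bar R}.

Lemma ae_imp (P Q : T -> Prop) : (forall x, P x -> Q x) ->
  {ae mu, forall x, P x} -> {ae mu, forall x, Q x}.
Proof. by move=> PQ; apply: filterS. Qed.

Lemma ae_and (P Q : T -> Prop) : {ae mu, forall x, P x} -> {ae mu, forall x, Q x} ->
  {ae mu, forall x, P x /\ Q x}.
Proof. by move=> aP aQ; apply: filterS2 aP aQ => x; split. Qed.

End ae.

Section plancherel.
Context {R : realType}.
Notation mu := (@lebesgue_measure R).
Notation RR := (measurableTypeR R).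

Lemma abel_nd (x : R) (m n : nat) : (m <= n)%N -> abel m.+1%:R^-1 x <= abel n.+1%:R^-1 x.
Proof.
move=> mn; rewrite /abel ler_expR lerN2 ler_wpM2r// lef_pV2 ?posrE//.
by rewrite ler_nat ltnS.
Qed.

Lemma abel_cvg1 (x : R) : abel n.+1%:R^-1 x @[n --> \oo] --> (1 : R).
Proof.
rewrite /abel -[X in _ --> X](@expR0 R).
apply: (@cvg_comp _ _ _ (fun n => - (n.+1%:R^-1 * `|x|)) expR _ (nbhs (0 : R))); last first.
  exact: continuous_expR.
rewrite -oppr0; apply: cvgN; rewrite -(mul0r `|x|).
by apply: cvgM; [exact: cvg_harmonic|exact: cvg_cst].
Qed.

(** Monotone rather than dominated convergence: the limit may be infinite, since square
    integrability of a transform is deduced from this statement. *)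
Lemma abel_integral_cvg (F : RR -> R[i]) : cmR F ->
  (\int[mu]_x (abel n.+1%:R^-1 x * csq (F x))%:E)%E @[n --> \oo] --> sq2 mu F.
Proof.
move=> mF.
have := @cvg_monotone_convergence _ RR R mu setT measurableT
  (fun n x => (abel n.+1%:R^-1 x * csq (F x))%:E).
rewrite (_ : (\int[mu]_(x in setT) limn _)%E = sq2 mu F); last first.
  apply: eq_integral => x _; apply/cvg_lim => //.
  apply/fine_cvgP; split; first exact: nearW.
  rewrite -[X in _ --> X]mul1r; apply: cvgM; last exact: cvg_cst.
  exact: abel_cvg1.
apply.
- move=> n; apply/measurable_EFinP; apply: measurable_funM; last exact: measurable_csq.
  exact: measurable_abel.
- by move=> n x _; rewrite lee_fin mulr_ge0 ?abel_ge0 ?csq_ge0.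
- by move=> x _ m n mn; rewrite lee_fin ler_wpM2r ?csq_ge0// abel_nd.
Qed.

Lemma FTs_plancherel (u : RR -> R[i]) : cintb mu u -> inL2 mu u ->
  sq2 mu (FTs (-1) u) = (2 * pi * n2 mu u)%:E.
Proof.
move=> iu Lu; have mF := cmf_FTs (-1) iu.
have H := abel_integral_cvg mF; apply: (cvg_unique _ H) => //.
have ib (n : nat) : mu.-integrable setT (EFin \o (fun x => abel n.+1%:R^-1 x * csq (FTs (-1) u x))).
  have n0 : 0 < n.+1%:R^-1 :> R by rewrite invr_gt0.
  pose B := 2 * \int[mu]_x normc (u x).
  apply: le_integrable (intRZ measurableT (B ^+ 2) (integrable_abel n0)) => //.
    apply/measurable_EFinP; apply: measurable_funM; last exact: measurable_csq.
    exact: measurable_abel.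
  move=> x _ /=; rewrite lee_fin ger0_norm ?mulr_ge0 ?abel_ge0 ?csq_ge0//.
  rewrite (@ger0_norm _ (B ^+ 2 * _)); last by rewrite mulr_ge0 ?sqr_ge0 ?abel_ge0.
  rewrite mulrC ler_wpM2r ?abel_ge0//.
  by rewrite -normc_sq lerXn2r ?nnegrE ?normc_ge0 ?FTs_bounded//
      (le_trans (normc_ge0 _) (FTs_bounded _ iu x)).
rewrite (_ : (fun n : nat => _) = EFin \o (fun n : nat => 2 * pi * n2 mu u - pi *
    \int[mu]_y (poisson n.+1%:R^-1 y * n2 mu (fun t => u (t + y) - u t)))); last first.
  apply/funext => n /=.
  have n0 : 0 < n.+1%:R^-1 :> R by rewrite invr_gt0.
  have [_ <-] := abel_plancherel_defect n0 iu Lu.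
  by rewrite /Rintegral fineK//; apply: integrable_fin_num => //; exact: ib.
apply/fine_cvgP; split; first exact: nearW.
rewrite -[X in _ --> X]subr0 -(mulr0 pi); apply: cvgB; first exact: cvg_cst.
apply: cvgM; first exact: cvg_cst.
exact: poisson_defect_cvg.
Qed.

Lemma fourier_L1E (u : R -> R[i]) (xi : R) :
  fourier_L1 u xi = ((Num.sqrt (2 * pi))^-1)%:C * FTs (-1) u xi.
Proof.
rewrite /fourier_L1; congr (_ * _); apply: eq_cint => t.
by rewrite mulN1r [xi * t]mulrC.
Qed.

Lemma fourier_L1_plancherel (u : R -> R[i]) : cintb mu u -> inL2 mu u ->
  inL2 mu (fourier_L1 u) /\ n2 mu (fourier_L1 u) = n2 mu u.
Proof.
move=> iu Lu; have LF : inL2 mu (FTs (-1) u).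
  by split; [exact: cmf_FTs|rewrite FTs_plancherel// ltry].
have -> : fourier_L1 u = fun xi : RR => ((Num.sqrt (2 * pi))^-1)%:C * FTs (-1) u xi.
  by apply/funext => xi; rewrite fourier_L1E.
split; first exact: inL2Z.
rewrite n2Z// csq_real exprVn sqr_sqrtr; last first.
  by apply: mulr_ge0 => //; exact: pi_ge0.
have := FTs_plancherel iu Lu; rewrite sq2E// => -[->].
by rewrite mulrA mulVf ?mul1r// mulf_neq0// gt_eqF// pi_gt0.
Qed.

Lemma L2norm_sqE (f : R -> R[i]) : L2norm_sq f = sq2 mu f.
Proof. by apply: eq_integral => x _; rewrite normc_sq. Qed.

Lemma L2E (f : R -> R[i]) : L2 f = inL2 mu f.
Proof. by rewrite /L2 /= L2norm_sqE. Qed.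

Lemma L1E (f : R -> R[i]) : L1 f <-> cintb mu f.
Proof.
split=> [[mf f1]|cf]; first exact: cintb_fin.
split; first exact: cintb_cmf cf.
have := cintb_normc cf => /integrableP[_]; apply: le_lt_trans.
rewrite /L1norm le_eqVlt; apply/orP; left; apply/eqP.
by apply: eq_integral => x _; rewrite gee0_abs// lee_fin normc_ge0.
Qed.

Lemma L2cvgE (u : nat -> R -> R[i]) f : (forall n, inL2 mu (u n)) -> inL2 mu f ->
  L2cvg u f <-> n2 mu (fun x => u n x - f x) @[n --> \oo] --> 0.
Proof.
move=> Lu Lf; rewrite /L2cvg.
rewrite (_ : (fun n => _) = fun n => (n2 mu (fun x => u n x - f x))%:E); last first.
  by apply/funext => n; rewrite L2norm_sqE sq2E//; exact: inL2B.
split=> [/fine_cvgP[]//|H].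
by apply/fine_cvgP; split=> //; exact: nearW.
Qed.

(* The weighted inequality [|a + b|^2 <= (1 + eta) |a|^2 + (1 + 1/eta) |b|^2] replaces the triangle
   inequality, as [n2] is the squared norm. *)
Lemma L2cvg_le (u v : nat -> RR -> R[i]) f g :
  (forall n, inL2 mu (u n)) -> (forall n, inL2 mu (v n)) -> inL2 mu f -> inL2 mu g ->
  n2 mu (fun x => u n x - f x) @[n --> \oo] --> 0 ->
  n2 mu (fun x => v n x - g x) @[n --> \oo] --> 0 ->
  (forall n, n2 mu (u n) <= n2 mu (v n)) -> n2 mu f <= n2 mu g.
Proof.
move=> Lu Lv Lf Lg uf vg uv; apply/ler_addgt0Pr => e e0.
have G0 := n2_ge0 mu g; set G := n2 mu g in G0 *.
(* As [eta <= 1], one has [(1 + eta) ^+ 2 * G <= G + 3 * eta * G]. Half of [e] is spent on this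
   excess, the rest on the two approximation errors. *)
pose eta := Num.min 1 (e / (6 * (G + 1))).
have G1 : 0 < 6 * (G + 1) by rewrite mulr_gt0// ltr_wpDl.
have eta0 : 0 < eta by rewrite lt_min ltr01 divr_gt0.
have eta1 : eta <= 1 by rewrite ge_min lexx.
have etaG : 3 * eta * G <= e / 2.
  have : eta <= e / (6 * (G + 1)) by rewrite ge_min lexx orbT.
  rewrite ler_pdivlMr// => h.
  have : eta * (6 * G) <= e by rewrite (le_trans _ h)// ler_wpM2l ?ltW//; lra.
  by lra.
pose C := 1 + eta^-1.
have C0 : 0 < C by rewrite addr_gt0// invr_gt0.
have e'0 : 0 < e / 8 / C by rewrite !divr_gt0.
move/cvgr0Pnorm_le : uf => /(_ _ e'0) uf; move/cvgr0Pnorm_le : vg => /(_ _ e'0) vg.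
have [n [un vn]] := filter_ex (filterI uf vg).
rewrite ger0_norm ?n2_ge0// in un; rewrite ger0_norm ?n2_ge0// in vn.
have h1 : n2 mu f <= (1 + eta) * n2 mu (u n) + C * n2 mu (fun x => u n x - f x).
  have := n2D_eta eta0 (Lu n) (inL2B Lf (Lu n)).
  rewrite (_ : (fun x => u n x + _) = f); last by apply/funext => x; rewrite addrC subrK.
  rewrite -(n2N mu (fun x => f x - u n x)).
  by rewrite (_ : (fun x => - _) = fun x => u n x - f x)//; apply/funext => x; rewrite opprB.
have h2 : n2 mu (v n) <= (1 + eta) * G + C * n2 mu (fun x => v n x - g x).
  have := n2D_eta eta0 Lg (inL2B (Lv n) Lg).
  by rewrite (_ : (fun x => g x + _) = v n)//; apply/funext => x; rewrite addrC subrK.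
have un' : C * n2 mu (fun x => u n x - f x) <= e / 8.
  by rewrite mulrC -ler_pdivlMr.
have vn' : C * n2 mu (fun x => v n x - g x) <= e / 8.
  by rewrite mulrC -ler_pdivlMr.
have uvn := uv n.
have h3 : n2 mu f <= (1 + eta) * ((1 + eta) * G + e / 8) + e / 8.
  rewrite (le_trans h1)// lerD// ler_wpM2l//; first by rewrite addr_ge0// ltW.
  by rewrite (le_trans uvn)// (le_trans h2)// lerD2l.
have : eta * (e / 8) <= e / 8 by rewrite ler_piMl// divr_ge0// ltW.
have : eta * eta * G <= eta * G by rewrite ler_wpM2r// ler_piMl// ltW.
move: h3; rewrite (_ : (1 + eta) * _ + _ =
    G + 2 * (eta * G) + eta * eta * G + e / 8 + eta * (e / 8) + e / 8); last by ring.
lra.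
Qed.

Lemma L2cvg_eq (u v : nat -> RR -> R[i]) f g :
  (forall n, inL2 mu (u n)) -> (forall n, inL2 mu (v n)) -> inL2 mu f -> inL2 mu g ->
  n2 mu (fun x => u n x - f x) @[n --> \oo] --> 0 ->
  n2 mu (fun x => v n x - g x) @[n --> \oo] --> 0 ->
  (forall n, n2 mu (u n) = n2 mu (v n)) -> n2 mu f = n2 mu g.
Proof.
move=> Lu Lv Lf Lg uf vg uv; apply/eqP; rewrite eq_le; apply/andP; split.
  by apply: (L2cvg_le Lu Lv) => // n; rewrite uv.
by apply: (L2cvg_le Lv Lu) => // n; rewrite uv.
Qed.

Lemma fourierP (f g : R -> R[i]) : fourier f g <->
  [/\ inL2 mu f, inL2 mu g & exists u : nat -> R -> R[i],
     [/\ forall n, cintb mu (u n) /\ inL2 mu (u n),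
       n2 mu (fun x => u n x - f x) @[n --> \oo] --> 0 &
       n2 mu (fun x => fourier_L1 (u n) x - g x) @[n --> \oo] --> 0]].
Proof.
rewrite /fourier !L2E; split=> -[Lf Lg [u [Lu uf ug]]]; split => //; exists u.
  have Lu' n : cintb mu (u n) /\ inL2 mu (u n).
    by have [/L1E ? +] := Lu n; rewrite L2E.
  split => //; first by apply/L2cvgE => // n; exact: (Lu' n).2.
  apply/L2cvgE => // n; exact: (fourier_L1_plancherel (Lu' n).1 (Lu' n).2).1.
split => [n||].
- by split; [apply/L1E; exact: (Lu n).1|rewrite L2E; exact: (Lu n).2].
- by apply/L2cvgE => // n; exact: (Lu n).2.
- by apply/L2cvgE => // n; exact: (fourier_L1_plancherel (Lu n).1 (Lu n).2).1.
Qed.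

Lemma fourier_isometry f g : fourier f g -> n2 mu f = n2 mu g.
Proof.
move=> /fourierP[Lf Lg [u [Lu uf ug]]].
apply: (@L2cvg_eq u (fun n => fourier_L1 (u n))) => // n.
- exact: (Lu n).2.
- exact: (fourier_L1_plancherel (Lu n).1 (Lu n).2).1.
- by rewrite (fourier_L1_plancherel (Lu n).1 (Lu n).2).2.
Qed.

Lemma L2cvgD (u v : nat -> RR -> R[i]) f g :
  (forall n, inL2 mu (u n)) -> (forall n, inL2 mu (v n)) -> inL2 mu f -> inL2 mu g ->
  n2 mu (fun x => u n x - f x) @[n --> \oo] --> 0 ->
  n2 mu (fun x => v n x - g x) @[n --> \oo] --> 0 ->
  n2 mu (fun x => (u n x + v n x) - (f x + g x)) @[n --> \oo] --> 0.
Proof.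
move=> Lu Lv Lf Lg uf vg.
apply: (@squeeze_cvgr _ _ _ _ (fun=> 0) (fun n =>
  2 * n2 mu (fun x => u n x - f x) + 2 * n2 mu (fun x => v n x - g x))).
- apply: nearW => n; rewrite n2_ge0/=.
  rewrite (le_trans _ (n2_le2 (inL2B (Lu n) Lf) (inL2B (Lv n) Lg)))//.
  by rewrite le_eqVlt; apply/orP; left; apply/eqP; congr n2; apply/funext => x; ring.
- exact: cvg_cst.
- rewrite -[X in _ --> X](addr0 0) -(mulr0 2).
  by apply: cvgD; apply: cvgM => //; exact: cvg_cst.
Qed.

Lemma fourierD (f g f' g' : R -> R[i]) : fourier f g -> fourier f' g' ->
  fourier (fun x => f x + f' x) (fun x => g x + g' x).
Proof.
move=> /fourierP[Lf Lg [u [Lu uf ug]]] /fourierP[Lf' Lg' [v [Lv vf vg]]].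
apply/fourierP; split; [exact: inL2D|exact: inL2D|].
exists (fun n x => u n x + v n x); split.
- by move=> n; split; [exact: cintbD (Lu n).1 (Lv n).1|exact: inL2D (Lu n).2 (Lv n).2].
- by apply: L2cvgD => // n; [exact: (Lu n).2|exact: (Lv n).2].
- rewrite (_ : (fun n : nat => _) = fun n => n2 mu (fun x =>
    (fourier_L1 (u n) x + fourier_L1 (v n) x) - (g x + g' x))).
    apply: (L2cvgD (u := fun n => fourier_L1 (u n)) (v := fun n => fourier_L1 (v n))) => // n.
      exact: (fourier_L1_plancherel (Lu n).1 (Lu n).2).1.
    exact: (fourier_L1_plancherel (Lv n).1 (Lv n).2).1.
  apply/funext => n; congr n2; apply/funext => x; congr (_ - _).
  rewrite !fourier_L1E -mulrDr -cintD; [|exact: cintb_FTs (Lu n).1|exact: cintb_FTs (Lv n).1].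
  by congr (_ * _); apply: eq_cint => y; rewrite mulrDl.
Qed.

Lemma fourierZ z (f g : R -> R[i]) : fourier f g -> fourier (fun x => z * f x) (fun x => z * g x).
Proof.
move=> /fourierP[Lf Lg [u [Lu uf ug]]].
have scale (v : nat -> RR -> R[i]) h : (forall n, inL2 mu (v n)) -> inL2 mu h ->
    n2 mu (fun x => v n x - h x) @[n --> \oo] --> 0 ->
    n2 mu (fun x => z * v n x - z * h x) @[n --> \oo] --> 0.
  move=> Lv Lh vh; rewrite (_ : (fun n : nat => _) = fun n => csq z * n2 mu (fun x => v n x - h x)).
    by rewrite -(mulr0 (csq z)); apply: cvgM => //; exact: cvg_cst.
  apply/funext => n; rewrite -n2Z; last exact: inL2B.
  by congr n2; apply/funext => x; rewrite mulrBr.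
apply/fourierP; split; [exact: inL2Z|exact: inL2Z|].
exists (fun n x => z * u n x); split.
- by move=> n; split; [exact: cintbZ (Lu n).1|exact: inL2Z (Lu n).2].
- by apply: scale => // n; exact: (Lu n).2.
- rewrite (_ : (fun n : nat => _) = fun n => n2 mu (fun x =>
    z * fourier_L1 (u n) x - z * g x)).
    apply: (scale (fun n => fourier_L1 (u n))) => // n.
    exact: (fourier_L1_plancherel (Lu n).1 (Lu n).2).1.
  apply/funext => n; congr n2; apply/funext => x; congr (_ - _).
  rewrite !fourier_L1E mulrCA; congr (_ * _); rewrite /FTs -cintZ; last first.
    exact: cintb_FTs (Lu n).1.
  by apply: eq_cint => y; rewrite -mulrA.
Qed.

Lemma fourier_shift a (f g : R -> R[i]) : fourier f g ->
  fourier (fun x => f (x + a)) (fun x => g x * expi (a * x)).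
Proof.
move=> /fourierP[Lf Lg [u [Lu uf ug]]].
have me : cmR (fun x => expi (a * x)) by apply: cmf_expi; exact: mulrl_measurable.
have Le h : inL2 mu h -> inL2 mu (fun x => h x * expi (a * x)).
  by move=> Lh; apply: inL2Mu => // x; rewrite csq_expi.
apply/fourierP; split; [exact: inL2_shift|exact: Le|].
exists (fun n x => u n (x + a)); split.
- by move=> n; split; [exact: cintb_shift (Lu n).1|exact: inL2_shift (Lu n).2].
- rewrite (_ : (fun n : nat => _) = fun n => n2 mu (fun x => u n x - f x))//.
  apply/funext => n; exact: (n2_shift a (inL2B (Lu n).2 Lf)).
- rewrite (_ : (fun n : nat => _) = fun n => n2 mu (fun x => fourier_L1 (u n) x - g x))//.
  apply/funext => n.
  transitivity (n2 mu (fun x => (fourier_L1 (u n) x - g x) * expi (a * x))); last first.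
    by apply: eq_Rintegral => x _; rewrite csqMexpi.
  congr n2; apply/funext => x; rewrite mulrBl; congr (_ - _).
  rewrite !fourier_L1E -mulrA; congr (_ * _).
  rewrite /FTs -(cint_shift (- a) (cintb_FTs (-1) x (cintb_shift a (Lu n).1))) -cintZr;
    last exact: cintb_FTs (Lu n).1.
  apply: eq_cint => y; rewrite subrK -mulrA -expiD; congr (_ * expi _); ring.
Qed.

Lemma fourierN (f g : R -> R[i]) : fourier f g -> fourier (fun x => - f x) (fun x => - g x).
Proof.
move=> /(fourierZ (-1)); congr fourier; apply/funext => x; exact: mulN1r.
Qed.

Lemma fourier0 : fourier (fun=> 0) (fun=> 0 : R[i]).
Proof.
have h : n2 mu (fun x : RR => 0 - 0) = 0.
  by rewrite /n2 /Rintegral; under eq_integral do rewrite subrr csq0; rewrite integral0.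
apply/fourierP; split; [exact: inL20|exact: inL20|].
exists (fun _ _ => 0); split.
- by move=> n; split; [exact: cintb0|exact: inL20].
- by rewrite h; exact: cvg_cst.
- rewrite (_ : (fun n : nat => _) = fun=> 0); first exact: cvg_cst.
  apply/funext => n; rewrite -h; congr n2; apply/funext => x; congr (_ - _).
  rewrite fourier_L1E /FTs (@eq_cint _ _ _ _ _ (fun=> 0)) ?cint0 ?mulr0// => y.
  by rewrite mul0r.
Qed.

Lemma fourier_sum I (s : seq I) (F G : I -> R -> R[i]) :
  (forall i, fourier (F i) (G i)) ->
  fourier (fun x => \sum_(i <- s) F i x) (fun x => \sum_(i <- s) G i x).
Proof.
move=> FG; elim: s => [|i s ih].
  have := fourier0; congr fourier; by apply/funext => x; rewrite big_nil.
have := fourierD (FG i) ih; congr fourier; by apply/funext => x; rewrite big_cons.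
Qed.

Lemma fourier_inL2 f g : fourier f g -> inL2 mu f /\ inL2 mu g.
Proof. by move=> /fourierP[]. Qed.

(** By linearity the difference of two transforms of [f] is a transform of 0, and the isometry makes
    it null. *)
Lemma fourier_unique f g g' : fourier f g -> fourier f g' -> {ae mu, forall x, g x = g' x}.
Proof.
move=> fg fg'; have [_ Lg] := fourier_inL2 fg; have [_ Lg'] := fourier_inL2 fg'.
have h := fourierD fg (fourierN fg').
have := n2_eq0 (inL2D Lg (inL2N Lg')).
rewrite -(fourier_isometry h) (_ : (fun x => f x - f x) = fun=> 0); last first.
  by apply/funext => x; rewrite subrr.
have -> : n2 mu (fun=> 0 : R[i]) = 0.
  by rewrite /n2 /Rintegral; under eq_integral do rewrite csq0; rewrite integral0.
by move=> /(_ erefl); apply: ae_imp => x /eqP; rewrite subr_eq0 => /eqP.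
Qed.

Lemma fourier_ip f g f' g' : fourier f g -> fourier f' g' -> ip mu f f' = ip mu g g'.
Proof.
move=> fg fg'; have [Lf Lg] := fourier_inL2 fg; have [Lf' Lg'] := fourier_inL2 fg'.
rewrite (ip_polar Lf Lf') (ip_polar Lg Lg').
rewrite (fourier_isometry (fourierD fg fg')) (fourier_isometry fg) (fourier_isometry fg').
by rewrite (fourier_isometry (fourierD fg (fourierZ 'i%C fg'))).
Qed.

Lemma fourier_ae f g g' : fourier f g -> cmR g' -> {ae mu, forall x, g x = g' x} -> fourier f g'.
Proof.
move=> /fourierP[Lf Lg [u [Lu uf ug]]] mg' gg'.
apply/fourierP; split=> //; first exact: inL2_ae Lg mg' gg'.
exists u; split => //.
rewrite (_ : (fun n : nat => _) = fun n => n2 mu (fun x => fourier_L1 (u n) x - g x))//.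
apply/funext => n; have [[mFu _] _] := fourier_L1_plancherel (Lu n).1 (Lu n).2.
apply: n2_ae; [exact: cmfB|by apply: cmfB => //; exact: Lg.1|].
by apply: ae_imp gg' => x ->.
Qed.

End plancherel.

(** * Inversion and Bessel's inequality *)

Section inversion.
Context {R : realType}.
Notation mu := (@lebesgue_measure R).
Notation RR := (measurableTypeR R).

Lemma FTs_opp s (q : RR -> R[i]) x : FTs (- s) q x = FTs s q (- x).
Proof. by apply: eq_cint => y; rewrite !mulNr mulrN. Qed.

(** [f] is the inverse Fourier integral of [g]; its Abel truncations [u n] are the integrable
    approximants that [fourier] asks for. Their transforms converge to [g] by expanding the squared
    distance: the cross term is the integral of [abel] times the squared modulus of [f], which tends
    to [n2 mu f = n2 mu g], while [n2 mu (u n) <= n2 mu f]. *)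
Lemma fourier_surj (g : R -> R[i]) : cintb mu g -> inL2 mu g -> exists f, fourier f g.
Proof.
move=> ig Lg; set c0 : R := (Num.sqrt (2 * pi))^-1.
have c00 : 0 <= c0 by rewrite invr_ge0 sqrtr_ge0.
pose f (t : RR) := c0%:C * FTs 1 g t.
have fE : f = fun t => fourier_L1 g (- t).
  by apply/funext => t; rewrite fourier_L1E -FTs_opp opprK.
have [LFg n2Fg] := fourier_L1_plancherel ig Lg.
have Lf : inL2 mu f by rewrite fE; exact: inL2_opp LFg.
have n2f : n2 mu f = n2 mu g by rewrite fE -n2Fg; exact: n2_opp LFg.
pose u (n : nat) (t : RR) := (abel n.+1%:R^-1 t)%:C * f t.
have n0 (n : nat) : 0 < n.+1%:R^-1 :> R by rewrite invr_gt0.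
have abel01 (n : nat) (x : R) : 0 <= abel n.+1%:R^-1 x <= 1.
  by rewrite abel_ge0 abel_le1.
have ma (n : nat) : cmR (fun x : RR => (abel n.+1%:R^-1 x)%:C).
  by apply: cmf_real; exact: measurable_abel.
have iu n : cintb mu (u n).
  apply: (@cintb_boundedM _ _ _ (c0 * (2 * \int[mu]_x normc (g x)))).
  - exact: cintb_abel.
  - exact: Lf.1.
  - move=> x; rewrite normcM [X in X * _]normc_sqrt csq_real sqrtr_sqr ger0_norm//.
    by rewrite ler_wpM2l// FTs_bounded.
have csq_abel n (x : R) : csq (abel n.+1%:R^-1 x)%:C <= 1.
  have /andP[a0 a1] := abel01 n x.
  by rewrite csq_real exprn_ile1.
have Lu n : inL2 mu (u n).
  rewrite /u; under eq_fun do rewrite mulrC.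
  by apply: inL2Mu => // x; exact: csq_abel.
have uf : n2 mu (fun x => u n x - f x) @[n --> \oo] --> 0.
  apply: (@n2_dct _ _ _ _ (fun n x => u n x - f x) (fun x => csq (f x))).
  - by move=> n; apply: cmfB; [exact: (Lu n).1|exact: Lf.1].
  - exact: inL2_csq.
  - move=> n x; have /andP[a0 a1] := abel01 n x.
    rewrite -[X in _ - X]mul1r -mulrBl csqM -rmorphB csq_real ler_piMl ?csq_ge0//.
    by rewrite -sqrrN opprB exprn_ile1 ?subr_ge0// lerBlDr lerDl.
  - move=> x; under eq_fun do rewrite -[X in _ - X]mul1r -mulrBl csqM -rmorphB csq_real.
    rewrite -(mul0r (csq (f x))); apply: cvgM; last exact: cvg_cst.
    rewrite -(mul0r 0); apply: cvgM; rewrite -(subrr 1);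
      by apply: cvgB; [exact: abel_cvg1|exact: cvg_cst].
(* The multiplication formula moves the transform from [u n] to the conjugate of [g], where it
   produces the conjugate of [f] up to the factor [c0]. *)
have ipE n : ip mu (fourier_L1 (u n)) g = (\int[mu]_x (abel n.+1%:R^-1 x * csq (f x)))%:C.
  transitivity (c0%:C * cint mu (fun x => (g x)^* * FTs (-1) (u n) x)).
    rewrite -cintZ; last first.
      apply: (@cintb_boundedM _ _ _ (2 * \int[mu]_x normc (u n x))).
      - exact: cintbJ.
      - exact: cmf_FTs.
      - exact: FTs_bounded.
    by apply: eq_cint => x; rewrite fourier_L1E -mulrA [FTs _ _ _ * _]mulrC.
  rewrite (multiplication_formula (-1) (cintbJ ig) (iu n)).
  have EJ x : FTs (-1) (fun y => (g y)^*) x = (FTs 1 g x)^* by rewrite FTsJ.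
  rewrite -cint_real -cintZ; last first.
    apply: (@cintb_boundedM _ _ _ (2 * \int[mu]_x normc (g x)^*)) => //.
    - by apply: cmf_FTs; exact: cintbJ.
    - exact: FTs_bounded (cintbJ ig).
  apply: eq_cint => x; rewrite EJ; set z := (FTs 1 g x)^*; rewrite rmorphM /= -csqE {2}/f conjcM -/z.
  by rewrite conjc_real /u; ring.
exists f; apply/fourierP; split => //; exists u; split => //.
have LF n := (fourier_L1_plancherel (iu n) (Lu n)).1.
have cabel : \int[mu]_x (abel n.+1%:R^-1 x * csq (f x)) @[n --> \oo] --> n2 mu g.
  have := abel_integral_cvg Lf.1; rewrite sq2E// n2f => /fine_cvgP[_].
  exact.
apply: (@squeeze_cvgr _ _ _ _ (fun=> 0) (fun n =>
  2 * n2 mu g - 2 * \int[mu]_x (abel n.+1%:R^-1 x * csq (f x)))).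
- apply: nearW => n; rewrite n2_ge0/= (n2B (LF n) Lg) ipE lerD2r.
  rewrite mulr_natl mulr2n lerD2r -n2f.
  rewrite (fourier_L1_plancherel (iu n) (Lu n)).2.
  apply: le_Rintegral => //; [exact: inL2_csq|exact: inL2_csq|].
  by move=> x _; rewrite csqM ler_piMl ?csq_ge0.
- exact: cvg_cst.
- rewrite -(subrr (2 * n2 mu g)); apply: cvgB; first exact: cvg_cst.
  by apply: cvgM => //; exact: cvg_cst.
Qed.

End inversion.

Section bessel.
Context {d} {T : measurableType d} {R : realType}.
Variable mu : {measure set T -> \bar R}.
Variables (K : nat) (e : 'I_K -> T -> R[i]) (h : R).
Hypothesis Le : forall n, inL2 mu (e n).
Hypothesis ortho : forall n m, ip mu (e n) (e m) = if n == m then h%:C else 0.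

Lemma ip_orthogonal (b c : 'I_K -> R[i]) :
  ip mu (fun x => \sum_n b n * e n x) (fun x => \sum_n c n * e n x) =
  h%:C * \sum_n b n * (c n)^*.
Proof.
have Lc : inL2 mu (fun x => \sum_n c n * e n x).
  by apply: inL2_sum => n; exact: inL2Z.
rewrite ip_suml//; last by move=> n; exact: inL2Z.
rewrite mulr_sumr; apply: eq_bigr => n _.
rewrite ipZl// ip_sumr//; last by move=> m; exact: inL2Z.
rewrite (bigD1 n)//= big1 ?addr0; last first.
  by move=> m mn; rewrite ipZr// ortho eq_sym (negbTE mn) mulr0.
by rewrite ipZr// ortho eqxx; ring.
Qed.

Lemma n2_ip f : inL2 mu f -> (n2 mu f)%:C = ip mu f f.
Proof. by move=> Lf; rewrite /n2 -cint_real; apply: eq_cint => x; rewrite csqE. Qed.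

Lemma n2_orthogonal (b : 'I_K -> R[i]) :
  n2 mu (fun x => \sum_n b n * e n x) = h * \sum_n csq (b n).
Proof.
have Lb : inL2 mu (fun x => \sum_n b n * e n x).
  by apply: inL2_sum => n; exact: inL2Z.
apply: complexI; rewrite n2_ip// ip_orthogonal rmorphM rmorph_sum /=.
by congr (_ * _); apply: eq_bigr => n _; rewrite csqE.
Qed.

Lemma bessel f : 0 < h -> inL2 mu f -> \sum_n csq (ip mu f (e n)) <= h * n2 mu f.
Proof.
move=> h0 Lf; pose b n := (h^-1)%:C * ip mu f (e n).
pose t x := \sum_n b n * e n x.
have Lt : inL2 mu t by apply: inL2_sum => n; exact: inL2Z.
have := n2_ge0 mu (fun x => f x - t x); rewrite n2B// n2_orthogonal.
set S := \sum_n csq (ip mu f (e n)).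
have -> : \sum_n csq (b n) = h ^- 2 * S.
  by rewrite mulr_sumr; apply: eq_bigr => n _; rewrite csqM csq_real exprVn.
have -> : ip mu f t = (h^-1 * S)%:C.
  rewrite /t ip_sumr//; last by move=> n; exact: inL2Z.
  rewrite rmorphM rmorph_sum /= mulr_sumr; apply: eq_bigr => n _.
  rewrite ipZr// /b conjcM conjc_real -csqE.
  by ring.
rewrite /= (_ : h * (h ^- 2 * S) = h^-1 * S); last by field; rewrite gt_eqF.
move=> H; rewrite -ler_pdivrMl//; lra.
Qed.

End bessel.

(** * Parseval on a period *)

Section tile.
Context {R : realType}.
Notation mu := (@lebesgue_measure R).
Notation RR := (measurableTypeR R).

Lemma expi2pi_nat (n : nat) : expi (n%:R * (2 * pi)) = 1 :> R[i].
Proof.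
elim: n => [|n ih]; first by rewrite mul0r expi0.
rewrite -addn1 natrD mulrDl expiD ih mul1r mul1r.
have -> : 2 * pi = pi *+ 2 :> R by rewrite mulr_natl.
by rewrite /expi cos2pi sin2pi.
Qed.

Lemma expi2pi_int (n : int) : expi (n%:~R * (2 * pi)) = 1 :> R[i].
Proof.
case: n => n; first exact: expi2pi_nat.
rewrite NegzE mulrNz mulNr -expiJ expi2pi_nat.
by apply: complex_eqP; rewrite /= ?oppr0.
Qed.

(** Half-open, so that the translates by multiples of [h] partition the line. *)
Definition tile (h x : R) : R := \1_(`[0, h[%classic) x.

Lemma tileE h x : tile h x = (0 <= x < h)%R%:R.
Proof. by rewrite /tile indicE mem_setE in_itv. Qed.

Lemma tile_ge0 h x : 0 <= tile h x.
Proof. by rewrite tileE. Qed.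

Lemma tile_le1 h x : tile h x <= 1.
Proof. by rewrite tileE; case: (_ && _). Qed.

Lemma tile_idem h x : tile h x * tile h x = tile h x.
Proof. by rewrite tileE; case: (_ && _); rewrite ?mulr1 ?mulr0. Qed.

Lemma measurable_tile h : measurable_fun [set: RR] (tile h).
Proof. exact: measurable_indic. Qed.

Lemma integrable_tile h : mu.-integrable setT (EFin \o tile h).
Proof. exact: integrable_indic_itv. Qed.

Lemma Rintegral_tileM h (f : RR -> R) :
  \int[mu]_x (tile h x * f x) = \int[mu]_(x in `[0, h[) f x.
Proof.
rewrite [RHS]Rintegral_mkcond; apply: eq_Rintegral => x _.
by rewrite patchE /tile indicE; case: (_ \in _); rewrite ?mul1r ?mul0r.
Qed.

Lemma Rintegral_tile h : 0 <= h -> \int[mu]_x tile h x = h.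
Proof.
move=> h0; under eq_Rintegral do rewrite -[tile h _]mulr1.
rewrite Rintegral_tileM Rintegral_cst// mul1r /= lebesgue_measure_itv /=.
case: ifPn; first by rewrite oppr0 adde0.
by rewrite lte_fin -leNgt => h1; apply/eqP; rewrite eq_le h0 h1.
Qed.

Lemma Rintegral_tile_FTC h (f F : R -> R) : 0 < h -> continuous f ->
  (forall x : R, is_derive x 1 F (f x)) ->
  \int[mu]_x (tile h x * f x) = F h - F 0.
Proof.
move=> h0 cf dF.
have cF : continuous F.
  by move=> x; have [dFx _] := dF x; apply: differentiable_continuous; exact/derivable1_diffP.
rewrite Rintegral_tileM /Rintegral integral_itv_bndo_bndc; last first.
  by apply/measurable_EFinP; apply: measurable_funTS; exact: continuous_measurable_fun.
rewrite (@continuous_FTC2 _ f F)//.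
- exact: continuous_subspaceT.
- split.
  + by move=> x _; have [] := dF x.
  + by apply: cvg_at_right_filter; exact: cF.
  + by apply: cvg_at_left_filter; exact: cF.
- by move=> x _; rewrite derive1E; have := dF x => ?; rewrite derive_val.
Qed.

Lemma cint_tile_expi h c : 0 < h -> c != 0 -> expi (c * h) = 1 ->
  cint mu (fun x : RR => (tile h x)%:C * expi (c * x)) = 0.
Proof.
move=> h0 c0 [ch1 sh1].
have dsin (x : R) : is_derive x 1 (c^-1 \*: (sin \o ( *%R c))) (cos (c * x)).
  have h1 : is_derive x 1 (sin \o ( *%R c)) (cos (c * x) * c).
    by apply: is_derive1_comp; exact: is_derive_scale.
  have h2 := @is_deriveZ R R R (sin \o ( *%R c)) c^-1 x 1 _ h1.
  by apply: (is_derive_eq h2); rewrite /GRing.scale /= mulrC mulfK.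
have dcos (x : R) : is_derive x 1 ((- c^-1) \*: (cos \o ( *%R c))) (sin (c * x)).
  have h1 : is_derive x 1 (cos \o ( *%R c)) (- sin (c * x) * c).
    by apply: is_derive1_comp; exact: is_derive_scale.
  have h2 := @is_deriveZ R R R (cos \o ( *%R c)) (- c^-1) x 1 _ h1.
  by apply: (is_derive_eq h2); rewrite /GRing.scale /= mulNr mulNr mulrN opprK mulrC mulfK.
have ccos : continuous (fun x : R => cos (c * x)).
  move=> x; apply: continuous_comp; last exact: continuous_cos.
  exact: mulrl_continuous.
have csin : continuous (fun x : R => sin (c * x)).
  move=> x; apply: continuous_comp; last exact: continuous_sin.
  exact: mulrl_continuous.
apply: complex_eqP.
  rewrite Re_cint; under eq_Rintegral do rewrite cReMr.
  rewrite (Rintegral_tile_FTC h0 ccos dsin) /= /GRing.scale /= mulr0 sin0 sh1.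
  by rewrite mulr0 subrr.
transitivity (\int[mu]_x complex.Im ((tile h x)%:C * expi (c * x))); first by [].
under eq_Rintegral do rewrite cImMr.
rewrite (Rintegral_tile_FTC h0 csin dcos) /= /GRing.scale /= mulr0 cos0 ch1.
by rewrite subrr.
Qed.

Lemma tile_sum (a e : R) (K : nat) (x : R) : 0 < e ->
  \sum_(n < K) tile e (x - (a + n%:R * e)) = (a <= x < a + K%:R * e)%R%:R.
Proof.
move=> e0; elim: K => [|K ih].
  by rewrite big_ord0 mul0r addr0; case: leP => // ax; rewrite ltNge ax.
rewrite big_ord_recr /= ih tileE subr_ge0 ltrBlDr.
have Ke : 0 <= K%:R * e by rewrite mulr_ge0// ltW.
have -> : a + K.+1%:R * e = e + (a + K%:R * e) by rewrite -addn1 natrD; ring.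
have [x1|x1] := ltP x (a + K%:R * e).
  rewrite andbT /= addr0; case: (leP a x) => //= _.
  by rewrite (lt_le_trans x1)// lerDr ltW.
by rewrite andbF add0r andTb (le_trans _ x1) ?lerDl.
Qed.

Lemma Rintegral_sum (K : nat) (F : 'I_K -> RR -> R) :
  (forall n, mu.-integrable setT (EFin \o F n)) ->
  mu.-integrable setT (EFin \o (fun x => \sum_n F n x)) /\
  \int[mu]_x (\sum_n F n x) = \sum_n \int[mu]_x F n x.
Proof.
move=> iF; have ic n := cintb_real (iF n).
have E : (fun x => (\sum_n F n x)%:C) = fun x => \sum_n (F n x)%:C.
  by apply/funext => x; rewrite rmorph_sum.
split.
  rewrite (_ : (fun x => _) = fun x => complex.Re (\sum_n (F n x)%:C)).
    exact: (cintb_sum (index_enum _) ic).1.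
  by apply/funext => x; rewrite cRe_sum.
apply: complexI; rewrite -cint_real E cint_sum// rmorph_sum.
by apply: eq_bigr => n _; rewrite cint_real.
Qed.

Lemma expi_tile_orthogonal h t0 s (n m : int) : 0 < h -> 0 < t0 -> h * t0 = 2 * pi ->
  ip mu (fun x => (tile h x)%:C * expi ((n%:~R * t0 + s) * x))
        (fun x => (tile h x)%:C * expi ((m%:~R * t0 + s) * x)) = if n == m then h%:C else 0.
Proof.
move=> h0 t00 ht.
transitivity (cint mu (fun x : RR => (tile h x)%:C * expi (((n - m)%:~R * t0) * x))).
  apply: eq_cint => x; rewrite conjcM expiJ conjc_real.
  rewrite mulrACA -rmorphM /= tile_idem -expiD; congr (_ * expi _).
  by rewrite intrB; ring.
case: eqVneq => [->|nm].
  rewrite -[in RHS](Rintegral_tile (ltW h0)) -cint_real; apply: eq_cint => x.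
  by rewrite subrr !mul0r expi0 mulr1.
apply: cint_tile_expi => //.
  by rewrite mulf_neq0 ?(gt_eqF t00)// intr_eq0 subr_eq0.
by rewrite -mulrA [t0 * h]mulrC ht expi2pi_int.
Qed.

Lemma inL2_tile_expi h c : inL2 mu (fun x : RR => (tile h x)%:C * expi (c * x)).
Proof.
apply: (@inL2_dom _ _ _ _ _ (fun x : RR => tile h x)).
- apply: cmfM; first by apply: cmf_real; exact: measurable_tile.
  by apply: cmf_expi; exact: mulrl_measurable.
- exact: integrable_tile.
- by move=> x; rewrite csqMexpi csq_real expr2 tile_idem.
Qed.

End tile.

Section parseval.
Context {R : realType}.
Notation mu := (@lebesgue_measure R).
Notation RR := (measurableTypeR R).
Variables (h t0 : R).
Hypotheses (h0 : 0 < h) (t00 : 0 < t0) (ht : h * t0 = 2 * pi).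

Lemma cintb_tiled (F : RR -> R[i]) : inL2 mu F -> (forall x, F x = (tile h x)%:C * F x) ->
  cintb mu F.
Proof.
move=> LF FE; apply: (@cintb_dom _ _ _ _ _ (fun x : RR => tile h x + csq (F x))).
- exact: LF.1.
- by apply: intRD => //; [exact: integrable_tile|exact: inL2_csq].
- move=> x; rewrite FE (le_trans (normc_le_csq _ _))// csq_real expr2 tile_idem -FE.
  by rewrite lerD2l.
Qed.

(** The frequencies are [n t0 + s] with [-N <= n < N]: as [s] runs over [0, t0[ they sweep [-N t0, N
    t0[ exactly once. *)
Definition psum (F : RR -> R[i]) (N : nat) (s : R) : R :=
  \sum_(n < 2 * N) csq (FTs (-1) F ((n%:Z - N%:Z)%:~R * t0 + s)).

Lemma psum_bessel F N s : inL2 mu F -> (forall x, F x = (tile h x)%:C * F x) ->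
  psum F N s <= h * n2 mu F.
Proof.
move=> LF FE.
pose e (n : 'I_(2 * N)) (x : RR) := (tile h x)%:C * expi (((n%:Z - N%:Z)%:~R * t0 + s) * x).
have := @bessel _ _ _ mu _ e h _ _ _ h0 LF; rewrite /psum.
under eq_bigr => n _.
  rewrite (_ : ip mu F (e n) = FTs (-1) F ((n%:Z - N%:Z)%:~R * t0 + s)); last first.
    apply: eq_cint => x; rewrite /e conjcM expiJ conjc_real.
    by rewrite mulrCA mulrA -FE mulN1r.
  over.
apply.
- by move=> n; exact: inL2_tile_expi.
- move=> n m; rewrite expi_tile_orthogonal//.
  by rewrite (inj_eq (addIr _)) eqz_nat.
Qed.

Lemma FTs_shift F x s : cintb mu F ->
  FTs (-1) F (x + s) = FTs (-1) F x + FTs (-1) (fun y => F y * (expi (- (s * y)) - 1)) x.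
Proof.
move=> iF; rewrite /FTs -cintD.
- apply: eq_cint => y; rewrite -mulrDl; rewrite (_ : F y + _ = F y * expi (- (s * y))).
    by rewrite -mulrA -expiD; congr (_ * expi _); ring.
  by rewrite mulrBr mulr1 addrC subrK.
- exact: cintb_FTs.
- apply: cintb_FTs; under eq_fun do rewrite mulrBr mulr1.
  apply: cintbB => //; apply: cintbMu => //.
    apply: cmf_expi; apply: measurableT_comp => //; exact: mulrl_measurable.
  by move=> y; rewrite csq_expi.
Qed.

(** Shifting the frequencies by [s] multiplies [F] by e^(-i s y), which differs from 1 by at most
    |s| h on the tile. Bessel's inequality for the difference makes the estimate uniform in [N]. *)
Lemma psum_shift F N s eta : 0 < eta -> inL2 mu F -> (forall x, F x = (tile h x)%:C * F x) ->
  psum F N s <= (1 + eta) * psum F N 0 + (1 + eta^-1) * (h * ((s * h) ^+ 2 * n2 mu F)).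
Proof.
move=> eta0 LF FE; have iF := cintb_tiled LF FE.
pose G y := F y * (expi (- (s * y)) - 1).
have mG : cmR G.
  apply: cmfM; first exact: LF.1.
  apply: cmfB; last exact: cmf_cst.
  by apply: cmf_expi; apply: measurableT_comp => //; exact: mulrl_measurable.
have Gs y : csq (G y) <= (s * h) ^+ 2 * csq (F y).
  rewrite /G csqM mulrC.
  have [yh|yh] := boolP (0 <= y < h).
    rewrite ler_wpM2r ?csq_ge0// (le_trans (csq_expi1 _))// sqrrN !exprMn.
    rewrite ler_wpM2l ?sqr_ge0//; have /andP[y0 y1] := yh.
    by rewrite lerXn2r// ?nnegrE ltW.
  by rewrite FE tileE (negbTE yh) mul0r csq0 !mulr0.
have LG : inL2 mu G.
  by apply: (@inL2_dom _ _ _ _ _ (fun y => (s * h) ^+ 2 * csq (F y))) => //;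
    apply: intRZ => //; exact: inL2_csq.
have GE x : G x = (tile h x)%:C * G x by rewrite /G mulrA -FE.
have n2G : n2 mu G <= (s * h) ^+ 2 * n2 mu F.
  rewrite /n2 -RintegralZl//; last exact: inL2_csq.
  by apply: le_Rintegral => //; [exact: inL2_csq|apply: intRZ => //; exact: inL2_csq].
apply: (@le_trans _ _ ((1 + eta) * psum F N 0 + (1 + eta^-1) * psum G N 0)).
  rewrite /psum !mulr_sumr -big_split /=; apply: ler_sum => n _.
  by rewrite !addr0 FTs_shift//; exact: csqD_eta.
rewrite lerD2l ler_wpM2l//; first by rewrite addr_ge0// invr_ge0 ltW.
rewrite (le_trans (psum_bessel N 0 LG GE))//.
by rewrite ler_wpM2l// ltW.
Qed.

(** The [2 * N] translates of [0, t0[ tile the window, so the integral over the shift unfolds to one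
    over frequencies. *)
Lemma psum_integral F N : inL2 mu F -> (forall x, F x = (tile h x)%:C * F x) ->
  mu.-integrable setT (EFin \o (fun s => tile t0 s * psum F N s)) /\
  \int[mu]_s (tile t0 s * psum F N s) =
  \int[mu]_x (csq (FTs (-1) F x) * (- N%:R * t0 <= x < N%:R * t0)%R%:R).
Proof.
move=> LF FE; have iF := cintb_tiled LF FE.
have LFF : inL2 mu (FTs (-1) F).
  by split; [exact: cmf_FTs|rewrite FTs_plancherel// ltry].
pose a (n : nat) : R := (n%:Z - N%:Z)%:~R * t0.
pose g n (x : RR) := csq (FTs (-1) F x) * tile t0 (x - a n).
have ig n : mu.-integrable setT (EFin \o g n).
  apply: le_integrable (inL2_csq LFF) => //.
    apply/measurable_EFinP; apply: measurable_funM; first exact: measurable_csq LFF.1.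
    exact: (measurableT_comp (measurable_tile t0) (measurable_shiftR (- a n))).
  move=> x _; rewrite lee_fin ger0_norm ?mulr_ge0 ?csq_ge0 ?tile_ge0//.
  by rewrite ger0_norm ?csq_ge0// ler_piMr ?csq_ge0 ?tile_le1.
have igs (n : 'I_(2 * N)) := integrable_shift (a n) (ig n).
have E : (fun s => tile t0 s * psum F N s) = fun s => \sum_(n < 2 * N) g n (s + a n).
  apply/funext => s; rewrite /psum mulr_sumr; apply: eq_bigr => n _.
  by rewrite /g addrK mulrC addrC.
have [h1 h2] := Rintegral_sum igs.
split; first by rewrite E.
rewrite E h2; have [_ h3] := Rintegral_sum (fun n : 'I_(2 * N) => ig n).
transitivity (\sum_(n < 2 * N) \int[mu]_x g n x).
  by apply: eq_bigr => n _; rewrite (Rintegral_shift (a n) (ig n)).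
rewrite -h3; apply: eq_Rintegral => x _; rewrite -mulr_sumr; congr (_ * _).
rewrite (_ : N%:R * t0 = - N%:R * t0 + (2 * N)%:R * t0); last by rewrite natrM; ring.
rewrite -tile_sum//; apply: eq_bigr => n _; congr (tile t0 (x - _)).
by rewrite /a intrB; ring.
Qed.

Lemma psum_integral_cvg F : inL2 mu F -> (forall x, F x = (tile h x)%:C * F x) ->
  \int[mu]_s (tile t0 s * psum F N s) @[N --> \oo] --> 2 * pi * n2 mu F.
Proof.
move=> LF FE; have iF := cintb_tiled LF FE.
have LFF : inL2 mu (FTs (-1) F).
  by split; [exact: cmf_FTs|rewrite FTs_plancherel// ltry].
have n2FF : n2 mu (FTs (-1) F) = 2 * pi * n2 mu F.
  by apply: EFin_inj; rewrite -sq2E// FTs_plancherel.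
pose b (N : nat) (x : R) : bool := - N%:R * t0 <= x < N%:R * t0.
have mb N : measurable_fun [set: RR] (fun x => (b N x)%:R : R).
  rewrite (_ : (fun x => _) = \1_(`[- N%:R * t0, N%:R * t0[%classic)).
    exact: measurable_indic.
  by apply/funext => x; rewrite indicE mem_setE in_itv.
pose D N x := FTs (-1) F x * (~~ b N x)%:R%:C.
have D0 : n2 mu (D N) @[N --> \oo] --> 0.
  apply: (@n2_dct _ _ _ _ D (fun x => csq (FTs (-1) F x))).
  - move=> N; apply: cmfM; first exact: LFF.1.
    apply: cmf_real; rewrite (_ : (fun x => _) = fun x => 1 - (b N x)%:R).
      by apply: measurable_funB => //; exact: measurable_cst.
    by apply/funext => x; case: (b N x); rewrite ?subrr ?subr0.
  - exact: inL2_csq.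
  - move=> N x; rewrite /D csqM csq_real ler_piMr ?csq_ge0//.
    by case: (b N x); rewrite ?expr0n ?expr1n.
  - move=> x; apply: cvg_near_cst.
    exists (Num.trunc (`|x| / t0)).+1 => // N /= hN.
    have xN : `|x| < N%:R * t0.
      rewrite -ltr_pdivrMr// (lt_le_trans (truncnS_gt _))// ler_nat//.
    rewrite /D (_ : b N x) ?mulr0 ?csq0//.
    by move: xN; rewrite ltr_norml -mulNr => /andP[x1 x2]; rewrite /b ltW.
rewrite (_ : (fun N : nat => _) = fun N => 2 * pi * n2 mu F - n2 mu (D N)).
  by rewrite -[X in _ --> X]subr0; apply: cvgB => //; exact: cvg_cst.
apply/funext => N; have [_ ->] := psum_integral N LF FE.
rewrite -n2FF /n2 -RintegralB//.
- apply: eq_Rintegral => x _; rewrite /D csqM csq_real -/(b N x).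
  by case: (b N x); rewrite /= ?expr0n ?expr1n ?mulr0 ?mulr1 ?subrr ?subr0.
- exact: inL2_csq.
- apply: inL2_csq; apply: inL2Mu => //.
    apply: cmf_real; rewrite (_ : (fun x => _) = fun x => 1 - (b N x)%:R).
      by apply: measurable_funB => //; exact: measurable_cst.
    by apply/funext => x; case: (b N x); rewrite ?subrr ?subr0.
  by move=> x; rewrite csq_real; case: (b N x); rewrite ?expr0n ?expr1n.
Qed.

(* Averaging over the shift [s] in [0, t0[ turns the Bessel sums into the integral of |FT F|^2, which
   Plancherel evaluates as the average of the Bessel bounds. *)
Lemma psum_sup F e : inL2 mu F -> (forall x, F x = (tile h x)%:C * F x) -> 0 < e ->
  exists N, h * n2 mu F - e < psum F N 0.
Proof.
move=> LF FE e0; apply: contrapT => /forallNP H.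
set T := h * n2 mu F in H; set L := T - e in H.
have {}H N : psum F N 0 <= L by rewrite leNgt; apply/negP; exact: H.
have L0 : 0 <= L by rewrite (le_trans _ (H 0))// sumr_ge0// => n _; exact: csq_ge0.
have n20 := n2_ge0 mu F.
pose eta := e / (4 * (L + 1)).
have L1 : 0 < 4 * (L + 1) by rewrite mulr_gt0// ltr_wpDl.
have eta0 : 0 < eta by rewrite divr_gt0.
have etaL : eta * L <= e / 4.
  rewrite /eta -mulrA [_ * L]mulrC mulrA ler_pdivrMr//.
  by rewrite (_ : e / 4 * (4 * (L + 1)) = e * (L + 1)); [rewrite ler_wpM2l ?ltW// ltrDl|field].
pose C := (1 + eta^-1) * (h * (h ^+ 2 * n2 mu F)).
have C0 : 0 <= C.
  by rewrite !mulr_ge0// ?addr_ge0 ?invr_ge0 ?sqr_ge0// ltW.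
pose s0 := Num.min t0 (Num.min 1 (e / (4 * (C + 1)))).
have C1 : 0 < 4 * (C + 1) by rewrite mulr_gt0// ltr_wpDl.
have s00 : 0 < s0 by rewrite !lt_min t00 ltr01 divr_gt0.
have s0t : s0 <= t0 by rewrite ge_min lexx.
have Cs0 : C * s0 ^+ 2 <= e / 4.
  have s1 : s0 <= 1 by rewrite !ge_min lexx orbT.
  have : s0 <= e / (4 * (C + 1)) by rewrite !ge_min lexx !orbT.
  rewrite ler_pdivlMr// => hs.
  have : C * s0 ^+ 2 <= C * s0 by rewrite ler_wpM2l// expr2 ler_piMl// ltW.
  by move: hs; rewrite mulrCA; have := ltW s00; nra.
pose A := (1 + eta) * L + C * s0 ^+ 2.
(* For shifts below [s0] the sums stay under [A], by [psum_shift]; on the rest of the period only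
   the Bessel bound [T] is used. The choices of [eta] and [s0] give [A <= L + e / 2 < T], so the
   average falls short of the value [t0 * T] that Plancherel imposes. *)
have bound N : \int[mu]_s (tile t0 s * psum F N s) <= s0 * A + (t0 - s0) * T.
  have [ips _] := psum_integral N LF FE.
  have it0 := integrable_tile t0; have is0 := integrable_tile s0.
  have iA : mu.-integrable setT (EFin \o (fun s => A * tile s0 s + T * (tile t0 s - tile s0 s))).
    by apply: intRD => //; apply: intRZ => //; exact: intRB.
  have -> : s0 * A + (t0 - s0) * T =
      \int[mu]_s (A * tile s0 s + T * (tile t0 s - tile s0 s)).
    rewrite RintegralD//; [|exact: intRZ|by apply: intRZ => //; exact: intRB].
    rewrite !RintegralZl//; [|exact: intRB].
    by rewrite RintegralB// !Rintegral_tile// ?ltW//; ring.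
  apply: le_Rintegral => // s _.
  rewrite !tileE; have [s1|s1] := leP 0 s; last by rewrite /= !mul0r subrr !mulr0 addr0.
  have [s2|s2] := ltP s s0.
    rewrite /= (lt_le_trans s2 s0t) mul1r subrr mulr0 addr0 mulr1.
    rewrite (le_trans (psum_shift N s eta0 LF FE))// /A lerD//.
      by rewrite ler_wpM2l// addr_ge0// ltW.
    rewrite /C -mulrA ler_wpM2l ?addr_ge0 ?invr_ge0 ?(ltW eta0)//.
    rewrite (_ : h * ((s * h) ^+ 2 * _) = h * (h ^+ 2 * n2 mu F) * s ^+ 2); last by ring.
    rewrite ler_wpM2l//; first by rewrite !mulr_ge0 ?sqr_ge0// ltW.
    by rewrite lerXn2r ?nnegrE ?(ltW s00)// ltW.
  rewrite /= mulr0 add0r subr0.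
  case: ltP => _; last by rewrite mul0r mulr0.
  by rewrite mul1r mulr1; exact: psum_bessel.
have lim : 2 * pi * n2 mu F <= s0 * A + (t0 - s0) * T.
  have := psum_integral_cvg LF FE => cv.
  by rewrite -(cvg_lim _ cv)//; apply: limr_le; [apply: cvgP; exact: cv|exact: nearW].
have : s0 * T <= s0 * A.
  have tT : t0 * T = 2 * pi * n2 mu F by rewrite -ht /T; ring.
  by move: lim; rewrite -tT; lra.
rewrite ler_pM2l// /A => TA.
have : L = T - e by [].
by move: TA; rewrite mulrDl mul1r; lra.
Qed.

End parseval.

(** * Unordered sums over the integers *)

Section esum_int.
Context {R : realType}.

(** The windows [-N <= n < N] are cofinal among the finite sets of integers, so the unordered sum is
    the supremum of the window sums. *)
Lemma esum_int_sup (a : int -> R) (T : R) : (forall n, 0 <= a n) ->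
  (forall N : nat, \sum_(n < 2 * N) a (n%:Z - N%:Z) <= T) ->
  (forall e, 0 < e -> exists N : nat, T - e < \sum_(n < 2 * N) a (n%:Z - N%:Z)) ->
  \esum_(n in [set: int]) (a n)%:E = T%:E.
Proof.
move=> a0 aT Ta; pose I N := [set (n%:Z - N%:Z)%R | n in `I_(2 * N)].
have sumI N : \esum_(n in I N) (a n)%:E = (\sum_(n < 2 * N) a (n%:Z - N%:Z))%:E.
  rewrite esum_image; last by move=> x y _ _ /addIr [].
  rewrite esum_fset//; last by move=> i _; rewrite lee_fin.
  by rewrite -sumEFin (fsbig_ord _ _ (fun n : nat => (a (n%:Z - N%:Z))%:E)).
have le_esumS (X Y : set int) : X `<=` Y -> (\esum_(n in X) (a n)%:E <= \esum_(n in Y) (a n)%:E)%E.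
  move=> XY; rewrite (esum_mkcond X) (esum_mkcond Y); apply: le_esum => n _.
  case: ifPn => [/set_mem/XY Yn|_]; first by rewrite mem_set.
  by case: ifPn; rewrite lee_fin.
apply/eqP; rewrite eq_le; apply/andP; split.
  apply: ge_ereal_sup => _ [X [finX _]] <-.
  have [s sX] := (finite_seqP X).1 finX.
  pose N := (\sum_(x <- s) `|x|%N).+1.
  rewrite -esum_fset//; last by move=> i _; rewrite lee_fin.
  apply: (@le_trans _ _ (\esum_(n in I N) (a n)%:E)); last by rewrite sumI lee_fin.
  apply: le_esumS => x; rewrite sX /= => xs.
  have xN : (`|x| < N)%N by rewrite ltnS (big_rem x xs) leq_addr.
  by exists (absz (x + N%:Z)%R) => /=; lia.
apply/lee_subgt0Pr => e e0; have [N TN] := Ta e e0.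
rewrite -EFinB (@le_trans _ _ (\esum_(n in I N) (a n)%:E))//.
  by rewrite sumI lee_fin ltW.
exact: le_esumS.
Qed.

End esum_int.

Section parseval.
Context {R : realType}.
Notation mu := (@lebesgue_measure R).
Notation RR := (measurableTypeR R).
Variables (h t0 : R).
Hypotheses (h0 : 0 < h) (t00 : 0 < t0) (ht : h * t0 = 2 * pi).

Lemma parseval (F : RR -> R[i]) : inL2 mu F -> (forall x, F x = (tile h x)%:C * F x) ->
  \esum_(n in [set: int]) (csq (FTs (-1) F (n%:~R * t0)))%:E = (h * n2 mu F)%:E.
Proof.
move=> LF FE.
have E N : psum t0 F N 0 = \sum_(n < 2 * N) csq (FTs (-1) F ((n%:Z - N%:Z)%:~R * t0)).
  by apply: eq_bigr => n _; rewrite addr0.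
apply: esum_int_sup.
- by move=> n; exact: csq_ge0.
- by move=> N; rewrite -E; exact: psum_bessel.
- by move=> e e0; have [N hN] := psum_sup h0 t00 ht LF FE e0; exists N; rewrite -E.
Qed.

(* The transform of the [h]-periodization of [q], cut to the period [0, h[, interpolates that of [q]
   on the dual lattice. *)
Definition periodization (l : nat) (q : RR -> R[i]) (x : RR) : R[i] :=
  (tile h x)%:C * \sum_(k < 2 * l) q (x + (k%:R - l%:R) * h).

Lemma shiftE (l k : nat) : - (l%:R * h) + k%:R * h = (k%:R - l%:R) * h.
Proof. by ring. Qed.

(** The [2 * l] tiles fill [-l h, l h[, which contains the band, and are disjoint. *)
Lemma cover_tile (l : nat) omega x : omega < l%:R * h -> - omega <= x <= omega ->
  \sum_(k < 2 * l) tile h (x - (k%:R - l%:R) * h) = 1.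
Proof.
move=> oh /andP[x1 x2]; under eq_bigr do rewrite -shiftE.
rewrite tile_sum// natrM (_ : (_ <= _ < _) = true)//; lra.
Qed.

Lemma cintb_tile_shift (l : nat) q k : cintb mu q ->
  cintb mu (fun x : RR => (tile h (x - (k%:R - l%:R) * h))%:C * q x).
Proof.
move=> iq; under eq_fun do rewrite mulrC; apply: cintbMu => //.
  apply: cmf_real.
  exact: (measurableT_comp (measurable_tile h) (measurable_shiftR (- ((k%:R - l%:R) * h)))).
by move=> x; rewrite csq_real exprn_ile1 ?tile_ge0 ?tile_le1.
Qed.

Lemma cint_periodization (l : nat) omega (q : RR -> R[i]) : omega < l%:R * h -> cintb mu q ->
  (forall x, ~~ (- omega <= x <= omega) -> q x = 0) ->
  cint mu q = cint mu (periodization l q).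
Proof.
move=> oh iq q0.
transitivity (cint mu (fun x : RR => \sum_(k < 2 * l) (tile h (x - (k%:R - l%:R) * h))%:C * q x)).
  apply: eq_cint => x; rewrite -mulr_suml -rmorph_sum /=.
  have [x1|x1] := boolP (- omega <= x <= omega); last by rewrite q0 ?mulr0.
  by rewrite (cover_tile oh x1) mul1r.
rewrite cint_sum; last by move=> k; exact: cintb_tile_shift.
transitivity (\sum_(k < 2 * l) cint mu (fun x => (tile h x)%:C * q (x + (k%:R - l%:R) * h))).
  apply: eq_bigr => k _; have ik := cintb_tile_shift l k iq.
  by rewrite -(cint_shift ((k%:R - l%:R) * h) ik); apply: eq_cint => x; rewrite addrK.
rewrite -cint_sum.
  by apply: eq_cint => x; rewrite /periodization mulr_sumr.
move=> k; have := cintb_shift ((k%:R - l%:R) * h) (cintb_tile_shift l k iq).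
by congr (cintb _ _); apply/funext => x; rewrite addrK.
Qed.

Lemma Rintegral_periodization (l : nat) omega (q : RR -> R) : omega < l%:R * h ->
  mu.-integrable setT (EFin \o q) ->
  (forall x, ~~ (- omega <= x <= omega) -> q x = 0) ->
  \int[mu]_x q x = \int[mu]_x (tile h x * \sum_(k < 2 * l) q (x + (k%:R - l%:R) * h)).
Proof.
move=> oh iq q0; apply: complexI; rewrite -!cint_real (cint_periodization oh (cintb_real iq)).
  by apply: eq_cint => x; rewrite /periodization rmorphM rmorph_sum.
by move=> x /q0 ->.
Qed.

(** Translation becomes the phase e^(i n t0 x) on the transform side; it is [h]-periodic because
    [h * t0 = 2 * pi], and so factors out of the periodization. *)
Lemma ip_translate (l : nat) omega (f g phi p : RR -> R[i]) (n : int) : omega < l%:R * h ->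
  fourier f g -> fourier phi p -> (forall x, ~~ (- omega <= x <= omega) -> g x = 0) ->
  L2inner f (translate (n%:~R * t0) phi) =
  FTs (-1) (periodization l (fun x => g x * (p x)^*)) (n%:~R * t0).
Proof.
move=> oh fg phip g0; have [_ Lg] := fourier_inL2 fg; have [_ Lp] := fourier_inL2 phip.
transitivity (ip mu f (fun x : RR => phi (x + n%:~R * t0))); first by [].
rewrite (fourier_ip fg (fourier_shift (n%:~R * t0) phip)).
pose q (x : RR) := g x * (p x)^* * expi (- (n%:~R * t0 * x)).
have iq : cintb mu q.
  apply: cintbMu; first exact: cintb_ip.
    by apply: cmf_expi; apply: measurableT_comp => //; exact: mulrl_measurable.
  by move=> x; rewrite csq_expi.
transitivity (cint mu q).
  by apply: eq_cint => x; rewrite conjcM expiJ mulrA.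
rewrite (cint_periodization oh iq); last by move=> x /g0 gx; rewrite /q gx !mul0r.
apply: eq_cint => x; rewrite /periodization -mulrA; congr (_ * _).
rewrite mulr_suml; apply: eq_bigr => k _; rewrite /q; congr (_ * _).
have -> : - (n%:~R * t0 * (x + (k%:R - l%:R) * h)) =
    -1 * (n%:~R * t0 * x) + (n * (l%:Z - k%:Z))%:~R * (2 * pi).
  by rewrite -ht intrM intrB -!pmulrn; ring.
by rewrite expiD expi2pi_int mulr1.
Qed.

End parseval.

(** * Band-limited functions *)

Section bandlimited.
Context {R : realType}.
Notation mu := (@lebesgue_measure R).
Notation RR := (measurableTypeR R).
Variable omega : R.

(** Off the essential support each point has a neighborhood on which [g] vanishes a.e. Intervals
    with rational endpoints suffice, and there are countably many of them. *)
Lemma ess_supp_ae (g : R -> R[i]) : ess_supp g `<=` `[- omega, omega]%classic ->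
  {ae mu, forall x, ~~ (- omega <= x <= omega) -> g x = 0}.
Proof.
move=> sg.
pose good (a : rat * rat) := {ae mu, forall y, ratr a.1 < y < ratr a.2 -> g y = 0}.
have : {ae mu, forall x, forall n : nat,
    if (unpickle n : option (rat * rat)) is Some a
    then (`[< good a >] -> ratr a.1 < x < ratr a.2 -> g x = 0) else True}.
  apply: ae_foralln => n; case: unpickle => [a|]; last exact: aeW.
  have [ga|nga] := pselect (good a).
    by apply: ae_imp ga => x h _; exact: h.
  by apply: aeW => x /asboolP.
apply: ae_imp => x hx xo.
have nx : ~ ess_supp g x by move=> /sg; rewrite /= in_itv /= (negbTE xo).
have /existsNP[U /not_implyP[Ux /contrapT aU]] := nx.
have [e /= e0 eU] := Ux.
have [a1 /andP[a11 a12]] : exists q : rat, x - e < ratr q < x.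
  by have := @rat_in_itvoo R (x - e) x; rewrite ltrBlDr ltrDl => /(_ e0)[q]; rewrite in_itv; exists q.
have [a2 /andP[a21 a22]] : exists q : rat, x < ratr q < x + e.
  by have := @rat_in_itvoo R x (x + e); rewrite ltrDl => /(_ e0)[q]; rewrite in_itv; exists q.
have := hx (pickle (a1, a2)); rewrite pickleK; apply; last by rewrite a12 a21.
apply/asboolP; apply: ae_imp aU => y hy /= /andP[y1 y2]; apply: hy; apply: eU => /=.
by rewrite ltr_distl; apply/andP; split; lra.
Qed.

Lemma ess_supp_sub (g : R -> R[i]) : (forall x, ~~ (- omega <= x <= omega) -> g x = 0) ->
  ess_supp g `<=` `[- omega, omega]%classic.
Proof.
move=> g0 x sx; apply: contrapT => nx.
apply: (sx (~` `[- omega, omega]%classic)).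
  by apply: open_nbhs_nbhs; split => //; apply: closed_openC; exact: interval_closed.
by apply: aeW => y /= /negP; rewrite in_itv /=; exact: g0.
Qed.

(** A representative that vanishes everywhere outside the band, so that finite periodizations are
    exact at every point. *)
Definition cutoff (g : RR -> R[i]) (x : RR) : R[i] :=
  (\1_(`[- omega, omega]%classic) x)%:C * g x.

Lemma cutoff0 g x : ~~ (- omega <= x <= omega) -> cutoff g x = 0.
Proof.
by move=> xo; rewrite /cutoff indicE memNset ?mul0r//= in_itv /= => h; rewrite h in xo.
Qed.

Lemma cutoffE g x : - omega <= x <= omega -> cutoff g x = g x.
Proof. by move=> xo; rewrite /cutoff indicE mem_set ?mul1r//= in_itv. Qed.

Lemma bandlimited_cutoff f g : bandlimited omega f -> fourier f g ->
  fourier f (cutoff g) /\ {ae mu, forall x, g x = cutoff g x}.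
Proof.
move=> [_ [g' fg' /ess_supp_ae sg']] fg.
have gg' := fourier_unique fg fg'; have [_ Lg] := fourier_inL2 fg.
have E : {ae mu, forall x, g x = cutoff g x}.
  apply: ae_imp (ae_and gg' sg') => x [gx h].
  have [xo|xo] := boolP (- omega <= x <= omega); first by rewrite cutoffE.
  by rewrite cutoff0// gx h.
split => //; apply: fourier_ae fg _ E; apply: cmfM; last exact: Lg.1.
by apply: cmf_real; exact: measurable_indic.
Qed.

Lemma bandlimitedP f : bandlimited omega f <->
  exists2 g, fourier f g & forall x, ~~ (- omega <= x <= omega) -> g x = 0.
Proof.
split=> [bf|[g fg g0]].
  have [_ [g fg _]] := bf; exists (cutoff g); first exact: (bandlimited_cutoff bf fg).1.
  exact: cutoff0.
split; first by case: fg.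
by exists g => //; exact: ess_supp_sub.
Qed.

End bandlimited.

(** * Frame bounds on the fibers *)

Section ae_integral.
Context {d} {T : measurableType d} {R : realType}.
Variable mu : {measure set T -> \bar R}.

Lemma le_Rintegral_ae (f g : T -> R) :
  mu.-integrable setT (EFin \o f) -> mu.-integrable setT (EFin \o g) ->
  {ae mu, forall x, f x <= g x} -> \int[mu]_x f x <= \int[mu]_x g x.
Proof.
move=> if_ ig fg; rewrite -subr_ge0 -RintegralB//.
have igf := intRB measurableT ig if_.
have mgf : measurable_fun setT (fun x => g x - f x).
  by apply/measurable_EFinP; exact: measurable_int igf.
have -> : \int[mu]_x (g x - f x) = \int[mu]_x `|g x - f x|.
  rewrite /Rintegral; congr fine; apply: ae_eq_integral => //.
  - by apply/measurable_EFinP; exact: mgf.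
  - by apply/measurable_EFinP; apply: measurableT_comp => //; exact: mgf.
  - by apply: ae_imp fg => x fgx _; rewrite ger0_norm// subr_ge0.
by apply: Rintegral_ge0 => x _; exact: normr_ge0.
Qed.

(** Taking the square root of [u] reduces this to [n2_eq0]. *)
Lemma Rintegral_le0_ae (u : T -> R) : mu.-integrable setT (EFin \o u) ->
  (forall x, 0 <= u x) -> \int[mu]_x u x <= 0 -> {ae mu, forall x, u x = 0}.
Proof.
move=> iu u0 int0.
have Lu : inL2 mu (fun x => (Num.sqrt (u x))%:C).
  apply: (@inL2_dom _ _ _ _ _ u) => //.
    apply: cmf_real; apply: measurableT_comp.
      by apply: continuous_measurable_fun; exact: sqrt_continuous.
    by apply/measurable_EFinP; exact: measurable_int iu.
  by move=> x; rewrite csq_real sqr_sqrtr.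
apply: ae_imp (n2_eq0 Lu _) => [x [/eqP]|]; last first.
  rewrite /n2; under eq_Rintegral do rewrite csq_real sqr_sqrtr//.
  by apply/eqP; rewrite eq_le int0 Rintegral_ge0.
by rewrite sqrtr_eq0 => u1; apply/eqP; rewrite eq_le u1 u0.
Qed.

Lemma inL2_dom_ae f (g : T -> R) : cmf f -> mu.-integrable setT (EFin \o g) ->
  (forall x, 0 <= g x) -> {ae mu, forall x, csq (f x) <= g x} -> inL2 mu f.
Proof.
move=> mf ig g0 fg; split => //; have /integrableP[mg ig'] := ig.
apply: le_lt_trans ig'; apply: ae_ge0_le_integral => //.
- by move=> x _; rewrite lee_fin csq_ge0.
- exact: measurable_csqE.
- exact: measurableT_comp.
- by apply: ae_imp fg => x fgx _ /=; rewrite lee_fin ger0_norm.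
Qed.

End ae_integral.

Section fiber.
Context {R : realType}.
Notation mu := (@lebesgue_measure R).
Notation RR := (measurableTypeR R).
Variables (omega t0 h : R) (l N : nat) (phi p : 'I_N -> R -> R[i]).
Hypotheses (h0 : 0 < h) (t00 : 0 < t0) (ht : h * t0 = 2 * pi) (oh : omega < l%:R * h).
Hypothesis phip : forall j, fourier (phi j) (p j).
Hypothesis p0 : forall j x, ~~ (- omega <= x <= omega) -> p j x = 0.

Definition node (k : nat) (x : R) : R := x + (k%:R - l%:R) * h.

Definition fiber_sum (w : 'I_(2 * l) -> R[i]) (x : R) : R :=
  \sum_(j < N) csq (\sum_(k < 2 * l) w k * (p j (node k x))^*).

Definition admissible (w : 'I_(2 * l) -> R[i]) (x : R) : Prop :=
  forall k, w k != 0 -> - omega <= node k x <= omega.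

(** One null set serves all [w], because [fiberwise_frame] takes for [w] the values of a function at
    the nodes, which depend on [x]. *)
Definition fiberwise (A B : R) : Prop :=
  {ae mu, forall x, 0 <= x < h -> forall w, admissible w x ->
    A * (\sum_k csq (w k)) <= h * fiber_sum w x <= B * (\sum_k csq (w k))}.

Let Lp j : inL2 mu (p j). Proof. exact: (fourier_inL2 (phip j)).2. Qed.

Let per (g : RR -> R[i]) (j : 'I_N) := periodization h l (fun x => g x * (p j x)^*).

Lemma cintb_periodization q : cintb mu q -> cintb mu (periodization h l q).
Proof.
move=> iq; rewrite /periodization; under eq_fun do rewrite mulr_sumr.
apply: cintb_sum => k; have := cintb_shift ((k%:R - l%:R) * h) (cintb_tile_shift h l k iq).
by congr (cintb _ _); apply/funext => x; rewrite addrK.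
Qed.

Let per_cmf g j : inL2 mu g -> cmR (per g j).
Proof. by move=> Lg; apply: cintb_cmf; apply: cintb_periodization; exact: cintb_ip. Qed.

Let per_tile g j x : per g j x = (tile h x)%:C * per g j x.
Proof. by rewrite /per /periodization mulrA -rmorphM /= tile_idem. Qed.

Lemma csq_tile (x : R) z : csq ((tile h x)%:C * z) = tile h x * csq z.
Proof. by rewrite csqM csq_real expr2 tile_idem. Qed.

(** The last hypothesis is what Parseval asks for; as [g] and [p j] are merely L2, it is a genuine
    condition. It comes from the upper fiber bound in [fiberwise_frame] and from the cap [M] in the
    converse. *)
Lemma frame_sum f g : fourier f g -> (forall x, ~~ (- omega <= x <= omega) -> g x = 0) ->
  (forall j, inL2 mu (per g j)) ->
  (\sum_(j < N) \esum_(n in [set: int])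
     (normc (L2inner f (translate (n%:~R * t0) (phi j))) ^+ 2)%:E)%E =
  (\sum_(j < N) h * n2 mu (per g j))%:E.
Proof.
move=> fg g0 Lper; rewrite -sumEFin; apply: eq_bigr => j _.
rewrite -(parseval h0 t00 ht (Lper j) (per_tile g j)); apply: eq_esum => n _.
by rewrite normc_sq (ip_translate h0 ht n oh fg (phip j) g0).
Qed.

Definition energy (g : RR -> R[i]) (x : RR) : R := tile h x * \sum_(k < 2 * l) csq (g (node k x)).

Lemma energyE g : inL2 mu g -> (forall x, ~~ (- omega <= x <= omega) -> g x = 0) ->
  mu.-integrable setT (EFin \o energy g) /\ \int[mu]_x energy g x = n2 mu g.
Proof.
move=> Lg g0; have ig := inL2_csq Lg; split.
  have := (cintb_periodization (cintb_real ig)).1.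
  congr (integrable _ _ _); apply/funext => x /=; congr EFin.
  by rewrite /periodization cReMr cRe_sum.
by rewrite [RHS](Rintegral_periodization h0 oh ig)// => x /g0 ->; rewrite csq0.
Qed.

Let csq_per g j x : csq (per g j x) =
  tile h x * csq (\sum_(k < 2 * l) g (node k x) * (p j (node k x))^*).
Proof. by rewrite csq_tile. Qed.

Lemma fiberwise_frame A B : 0 < A -> A <= B -> fiberwise A B -> is_frame omega t0 phi.
Proof.
move=> A0 AB fib; exists A, B; split=> // f /bandlimitedP[g fg g0] S; rewrite {}/S.
have B0 : 0 < B := lt_le_trans A0 AB.
have [Lf Lg] := fourier_inL2 fg; have [ie Ie] := energyE Lg g0.
have key : {ae mu, forall x, A * energy g x <= h * \sum_(j < N) csq (per g j x) <= B * energy g x}.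
  apply: ae_imp fib => x hx; under eq_bigr do rewrite csq_per.
  rewrite -mulr_sumr /energy tileE.
  have [xh|_] := boolP (0 <= x < h); last by rewrite !mul0r !mulr0 lexx.
  rewrite !mul1r; apply: (hx xh (fun k => g (node k x))) => k.
  by apply: contraNT => /g0 ->.
have Lper j : inL2 mu (per g j).
  apply: (@inL2_dom_ae _ _ _ _ _ (fun x => B / h * energy g x)).
  - exact: per_cmf.
  - exact: intRZ.
  - move=> x; rewrite mulr_ge0 ?divr_ge0 ?(ltW B0) ?(ltW h0)// mulr_ge0 ?tile_ge0//.
    by apply: sumr_ge0 => k _; exact: csq_ge0.
  - apply: ae_imp key => x /andP[_]; rewrite mulrAC ler_pdivlMr// mulrC => le2.
    apply: le_trans le2; rewrite ler_pM2r// (bigD1 j)//= lerDl sumr_ge0// => i _.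
    exact: csq_ge0.
have [is_ Is] := Rintegral_sum (fun j => inL2_csq (Lper j)).
rewrite (frame_sum fg g0 Lper) L2norm_sqE (sq2E Lf) -!EFinM !lee_fin.
rewrite (fourier_isometry fg) -Ie -mulr_sumr -Is -!RintegralZl//.
split; apply: le_Rintegral_ae; do ?[exact: intRZ].
- by apply: ae_imp key => x /andP[].
- by apply: ae_imp key => x /andP[].
Qed.

(** * Frame inequalities tested on a prescribed fiber *)

Section converse.
Variables A B : R.
Hypothesis frameAB : forall f, bandlimited omega f ->
  let S := (\sum_(j < N) \esum_(n in [set: int])
              (normc (L2inner f (translate (n%:~R * t0) (phi j))) ^+ 2)%:E)%E in
  (A%:E * L2norm_sq f <= S)%E /\ (S <= B%:E * L2norm_sq f)%E.

Variables (w : 'I_(2 * l) -> R[i]) (E : set RR) (M : R).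
Hypotheses (mE : measurable E) (Eh : forall x, E x -> 0 <= x < h).
Hypothesis Ew : forall x, E x -> admissible w x.
Hypothesis EM : forall x, E x -> fiber_sum w x <= M.

(** The fiber of [g] is [w] over the points of [E] and 0 over the rest of the tile: since [E] lies
    in one tile, its translates by distinct multiples of [h] are disjoint. *)
Let g (y : RR) : R[i] := \sum_(k < 2 * l) w k * (\1_E (y - (k%:R - l%:R) * h))%:C.

Let gnode (k : 'I_(2 * l)) (x : R) : 0 <= x < h -> g (node k x) = w k * (\1_E x)%:C.
Proof.
move=> /andP[x0 xh]; rewrite /g (bigD1 k)//= /node addrK big1 ?addr0// => i ik.
rewrite indicE memNset ?mulr0// => /Eh.
rewrite (_ : x + _ - _ = x + (k%:R - i%:R) * h); last by ring.
have [ki|ki|ki] := ltngtP k i; last by rewrite (ord_inj ki) eqxx in ik.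
  have : k%:R + 1 <= i%:R :> R by rewrite natr1 ler_nat.
  by move=> hk /andP[+ _]; apply/negP; rewrite -ltNge; nra.
have : i%:R + 1 <= k%:R :> R by rewrite natr1 ler_nat.
by move=> hk /andP[_]; apply/negP; rewrite -leNgt; nra.
Qed.

Let g0 y : ~~ (- omega <= y <= omega) -> g y = 0.
Proof.
move=> yo; apply: big1 => k _; have [->|wk] := eqVneq (w k) 0; first by rewrite mul0r.
rewrite indicE memNset ?mulr0// => /Ew/(_ k wk).
by rewrite /node subrK; exact/negP.
Qed.

Let iE : mu.-integrable setT (EFin \o (\1_E : RR -> R)).
Proof.
apply: le_integrable (integrable_tile h) => //.
  by apply/measurable_EFinP; exact: measurable_indic.
move=> x _; rewrite lee_fin !ger0_norm ?tile_ge0// tileE indicE.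
by have [xE|_] := boolP (x \in E); [rewrite Eh//; exact: set_mem|].
Qed.

Let cg : cintb mu g.
Proof.
apply: cintb_sum => k; apply: cintbZ.
by apply: (@cintb_shift _ (- ((k%:R - l%:R) * h)) (fun x => (\1_E x)%:C)); exact: cintb_real.
Qed.

Let Lg : inL2 mu g.
Proof.
apply: inL2_sum => k; apply: inL2Z.
apply: (@inL2_shift _ (- ((k%:R - l%:R) * h)) (fun x => (\1_E x)%:C)).
apply: (@inL2_dom _ _ _ _ _ (\1_E : RR -> R)) => //.
  by apply: cmf_real; exact: measurable_indic.
by move=> x; rewrite csq_real indicE; case: (_ \in _); rewrite ?expr0n ?expr1n.
Qed.

Let csq_perE j x : csq (per g j x) =
  \1_E x * csq (\sum_(k < 2 * l) w k * (p j (node k x))^*).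
Proof.
rewrite csq_per tileE; have [xh|xh] := boolP (0 <= x < h); last first.
  by rewrite indicE memNset ?mul0r// => /Eh; exact/negP.
under eq_bigr do rewrite gnode// mulrAC mulrC.
rewrite -mulr_sumr csqM csq_real mul1r indicE.
by case: (_ \in _); rewrite ?expr0n ?expr1n.
Qed.

Let energyg x : energy g x = \1_E x * \sum_k csq (w k).
Proof.
rewrite /energy tileE; have [xh|xh] := boolP (0 <= x < h); last first.
  by rewrite indicE memNset ?mul0r// => /Eh; exact/negP.
rewrite mul1r mulr_sumr; apply: eq_bigr => k _; rewrite gnode// csqM csq_real mulrC indicE.
by case: (_ \in _); rewrite ?expr0n ?expr1n.
Qed.

Let Lper j : inL2 mu (per g j).
Proof.
apply: (@inL2_dom _ _ _ _ _ (fun x => M * (\1_E : RR -> R) x)).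
- exact: per_cmf.
- exact: intRZ.
- move=> x; rewrite csq_perE mulrC indicE.
  have [/set_mem xE|_] := boolP (x \in E); last by rewrite !mulr0.
  rewrite !mulr1 (le_trans _ (EM xE))// /fiber_sum (bigD1 j)//= lerDl sumr_ge0// => i _.
  exact: csq_ge0.
Qed.

Lemma frame_test :
  mu.-integrable setT (EFin \o (fun x : RR => \1_E x * (h * fiber_sum w x))) /\
  A * (\sum_k csq (w k)) * \int[mu]_x \1_E x <= \int[mu]_x (\1_E x * (h * fiber_sum w x))
    <= B * (\sum_k csq (w k)) * \int[mu]_x \1_E x.
Proof.
have [f fg] := fourier_surj cg Lg.
have bf : bandlimited omega f by apply/bandlimitedP; exists g.
have [Lf _] := fourier_inL2 fg.
have := frameAB bf; cbv zeta.
rewrite (frame_sum fg g0 Lper) L2norm_sqE (sq2E Lf).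
rewrite -!EFinM !lee_fin (fourier_isometry fg) -(energyE Lg g0).2.
under eq_Rintegral do rewrite energyg mulrC.
rewrite RintegralZl// -mulr_sumr.
have [is_ Is] := Rintegral_sum (fun j => inL2_csq (Lper j)).
have E1 x : h * (\sum_(j < N) csq (per g j x)) = \1_E x * (h * fiber_sum w x).
  by under eq_bigr do rewrite csq_perE; rewrite -mulr_sumr mulrCA.
have -> : h * (\sum_(j < N) n2 mu (per g j)) = \int[mu]_x (\1_E x * (h * fiber_sum w x)).
  by rewrite -Is -RintegralZl//; apply: eq_Rintegral => x _; exact: E1.
rewrite !mulrA => -[i1 i2]; split; last by rewrite i1.
by have := intRZ measurableT h is_; congr (integrable _ _ _); apply/funext => x; rewrite /= E1.
Qed.

End converse.

End fiber.

(** * Approximation by rational complex numbers *)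

Section complex_cvg.
Context {R : realType}.

Definition ccvg (u : nat -> R[i]) (z : R[i]) : Prop :=
  (complex.Re (u n) @[n --> \oo] --> complex.Re z) /\
  (complex.Im (u n) @[n --> \oo] --> complex.Im z).

Lemma ccvg_sum I (s : seq I) (u : I -> nat -> R[i]) (z : I -> R[i]) :
  (forall i, ccvg (u i) (z i)) ->
  ccvg (fun n => \sum_(i <- s) u i n) (\sum_(i <- s) z i).
Proof.
move=> uz; split.
  rewrite cRe_sum; under eq_fun do rewrite cRe_sum.
  by apply: cvg_big => [|i _]; [exact: add_continuous|exact: (uz i).1].
rewrite cIm_sum; under eq_fun do rewrite cIm_sum.
by apply: cvg_big => [|i _]; [exact: add_continuous|exact: (uz i).2].
Qed.

Lemma ccvgMr u z c : ccvg u z -> ccvg (fun n => u n * c) (z * c).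
Proof.
move=> [ur ui]; split.
  rewrite cReM; under eq_fun do rewrite cReM.
  by apply: cvgB; apply: cvgM => //; exact: cvg_cst.
rewrite cImM; under eq_fun do rewrite cImM.
by apply: cvgD; apply: cvgM => //; exact: cvg_cst.
Qed.

Lemma ccvg_csq u z : ccvg u z -> csq (u n) @[n --> \oo] --> csq z.
Proof. by move=> [ur ui]; rewrite /csq !expr2; apply: cvgD; apply: cvgM. Qed.

(** Zero is approximated by zeros only, so rational approximations of a vector vanish wherever it
    does and inherit its admissibility. *)
Lemma rat_seq (r : R) : exists q : nat -> rat,
  (r = 0 -> forall n, q n = 0) /\ (ratr (q n) : R) @[n --> \oo] --> r.
Proof.
have [->|r0] := eqVneq r 0.
  exists (fun=> 0); split => //; under eq_fun do rewrite rmorph0; exact: cvg_cst.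
have : forall n : nat, exists q : rat, r < ratr q < r + n.+1%:R^-1.
  move=> n; have := @rat_in_itvoo R r (r + n.+1%:R^-1).
  by rewrite ltrDl invr_gt0 ltr0Sn => /(_ isT)[q]; rewrite in_itv; exists q.
move=> /choice[q hq]; exists q; split=> [/eqP|]; first by rewrite (negbTE r0).
apply: (@squeeze_cvgr _ _ _ _ (fun=> r) (fun n => r + n.+1%:R^-1)).
- by apply: nearW => n; have /andP[/ltW -> /ltW ->] := hq n.
- exact: cvg_cst.
- by rewrite -[X in _ --> X]addr0; apply: cvgD; [exact: cvg_cst|exact: cvg_harmonic].
Qed.

Lemma crat_seq (z : R[i]) : exists a : nat -> rat * rat,
  (z = 0 -> forall n, a n = (0, 0)) /\ ccvg (fun n => ratr (a n).1 +i* ratr (a n).2) z.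
Proof.
have [q1 [q10 q1r]] := rat_seq (complex.Re z); have [q2 [q20 q2r]] := rat_seq (complex.Im z).
exists (fun n => (q1 n, q2 n)); split=> // z0 n.
by rewrite q10 ?q20// z0.
Qed.

End complex_cvg.

(** * From the frame inequalities to almost every fiber *)

Section frame_fiberwise.
Context {R : realType}.
Notation mu := (@lebesgue_measure R).
Notation RR := (measurableTypeR R).
Variables (omega t0 h : R) (l N : nat) (phi p : 'I_N -> R -> R[i]).
Hypotheses (h0 : 0 < h) (t00 : 0 < t0) (ht : h * t0 = 2 * pi) (oh : omega < l%:R * h).
Hypothesis phip : forall j, fourier (phi j) (p j).

Notation fs := (fiber_sum h (l := l) p).
Notation adm := (admissible omega h (l := l)).

Lemma measurable_fiber_sum w : measurable_fun [set: RR] (fs w).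
Proof.
apply: measurable_sum => j; apply: measurable_csq; apply: cmf_sum => k.
apply: cmfM; first exact: cmf_cst.
by apply: cmfJ; apply: cmf_shift; exact: (fourier_inL2 (phip j)).2.1.
Qed.

Lemma measurable_admissible w : measurable ([set x | adm w x] : set RR).
Proof.
have -> : [set x | adm w x] = \bigcap_(k in [set: 'I_(2 * l)])
    (if w k == 0 then [set: RR] else (node h l k : RR -> RR) @^-1` `[- omega, omega]%classic).
  apply/seteqP; split=> x.
    move=> ax k _; case: ifPn => //= wk.
    by rewrite in_itv; exact: ax.
  move=> bx k wk; have := bx k I; rewrite (negbTE wk) /=.
  by rewrite in_itv.
apply: fin_bigcap_measurable => // k _; case: ifPn => // _.
by rewrite -[_ @^-1` _]setTI; exact: (measurable_shiftR ((k%:R - l%:R) * h)).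
Qed.

Lemma measurable_lt_fun (f g : RR -> R) : measurable_fun setT f -> measurable_fun setT g ->
  measurable [set x | f x < g x].
Proof.
move=> mf mg; rewrite (_ : [set x | _] = setT `&` (fun x => f x < g x) @^-1` [set true]).
  exact: measurable_fun_ltr.
by rewrite setTI.
Qed.

Lemma measurable_le_fun (f g : RR -> R) : measurable_fun setT f -> measurable_fun setT g ->
  measurable [set x | f x <= g x].
Proof.
move=> mf mg; rewrite (_ : [set x | _] = setT `&` (fun x => f x <= g x) @^-1` [set true]).
  exact: measurable_fun_ler.
by rewrite setTI.
Qed.

Variables A B : R.
Hypothesis frameAB : forall f, bandlimited omega f ->
  let S := (\sum_(j < N) \esum_(n in [set: int])
              (normc (L2inner f (translate (n%:~R * t0) (phi j))) ^+ 2)%:E)%E in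
  (A%:E * L2norm_sq f <= S)%E /\ (S <= B%:E * L2norm_sq f)%E.

(** The cap [M] keeps the test functions within reach of [frame_test]. At a given point the fiber
    sum is finite, so every admissible point of the period is in [D w M] for some integer [M]. *)
Let D w M := [set x : RR | [/\ 0 <= x < h, adm w x & fs w x <= M]].

Let mD w M : measurable (D w M).
Proof.
have -> : D w M = `[0, h[%classic `&` [set x | adm w x] `&` [set x | fs w x <= M].
  by apply/seteqP; split=> x /=; rewrite in_itv /= => -[]; [|case].
apply: measurableI; first apply: measurableI => //; first exact: measurable_admissible.
by apply: measurable_le_fun; [exact: measurable_fiber_sum|exact: measurable_cst].
Qed.

(** A function positive on [E] and zero elsewhere whose integral is at most 0 forces [E] to be null.
    The sign [s] is -1 for the lower frame bound and 1 for the upper one. *)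
Let frame_test_null w M (s c : R) (E : set RR) : E `<=` D w M -> measurable E ->
  (forall x, E x -> 0 < s * (h * fs w x - c * \sum_k csq (w k))) ->
  (mu.-integrable setT (EFin \o (fun x : RR => \1_E x * (h * fs w x))) ->
   s * \int[mu]_x (\1_E x * (h * fs w x)) <= s * (c * (\sum_k csq (w k)) * \int[mu]_x \1_E x)) ->
  {ae mu, forall x, ~ E x}.
Proof.
move=> ED mE Es Eint; set S := \sum_k csq (w k) in Es Eint.
have Eh x : E x -> 0 <= x < h by move=> /ED[].
have [i1 _] := frame_test h0 t00 ht oh phip frameAB mE Eh
  (fun x Ex => let: And3 _ a _ := ED x Ex in a) (fun x Ex => let: And3 _ _ a := ED x Ex in a).
have iE : mu.-integrable setT (EFin \o (\1_E : RR -> R)).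
  apply: le_integrable (integrable_tile h) => //.
    by apply/measurable_EFinP; exact: measurable_indic.
  move=> x _; rewrite lee_fin !ger0_norm ?tile_ge0// tileE indicE.
  by have [xE|_] := boolP (x \in E); [rewrite Eh//; exact: set_mem|].
have iu : mu.-integrable setT (EFin \o (fun x : RR => s * (\1_E x * (h * fs w x) - c * S * \1_E x))).
  by apply: intRZ => //; apply: intRB => //; exact: intRZ.
have uE x : s * (\1_E x * (h * fs w x) - c * S * \1_E x) =
    \1_E x * (s * (h * fs w x - c * S)) by ring.
apply: ae_imp (Rintegral_le0_ae iu _ _).
- move=> x /eqP; rewrite uE => /[swap] Ex; rewrite indicE mem_set// mul1r gt_eqF//.
  exact: Es.
- move=> x; rewrite uE indicE; have [/set_mem Ex|] := boolP (x \in E); last by rewrite mul0r.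
  by rewrite mul1r ltW// Es.
- rewrite RintegralZl//; last by apply: intRB => //; exact: intRZ.
  by rewrite RintegralB//; [rewrite RintegralZl// mulrBr subr_le0 Eint|exact: intRZ].
Qed.

Let fiber_bound_ae w (M : nat) : {ae mu, forall x, D w M%:R x ->
  A * (\sum_k csq (w k)) <= h * fs w x <= B * (\sum_k csq (w k))}.
Proof.
have mfs := measurable_fiber_sum w; set S := \sum_k csq (w k).
have test E (ED : E `<=` D w M%:R) (mE : measurable E) :
    A * S * \int[mu]_x \1_E x <= \int[mu]_x (\1_E x * (h * fs w x))
    <= B * S * \int[mu]_x \1_E x.
  have Eh x : E x -> 0 <= x < h by move=> /ED[].
  exact: (frame_test h0 t00 ht oh phip frameAB mE Eh
    (fun x Ex => let: And3 _ a _ := ED x Ex in a) (fun x Ex => let: And3 _ _ a := ED x Ex in a)).2.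
pose EA := D w M%:R `&` [set x | h * fs w x < A * S].
pose EB := D w M%:R `&` [set x | B * S < h * fs w x].
have mhfs : measurable_fun [set: RR] (fun x : RR => h * fs w x) by exact: measurable_funM.
have mEA : measurable EA by apply: measurableI => //; exact: measurable_lt_fun.
have mEB : measurable EB by apply: measurableI => //; exact: measurable_lt_fun.
have EAD : EA `<=` D w M%:R by move=> x [].
have EBD : EB `<=` D w M%:R by move=> x [].
have nA : {ae mu, forall x, ~ EA x}.
  apply: (frame_test_null (s := -1) (c := A) EAD mEA).
    by move=> x [_ /=]; rewrite -/S => ?; lra.
  by move=> _; rewrite -/S !mulN1r lerN2; have /andP[] := test EA EAD mEA.
have nB : {ae mu, forall x, ~ EB x}.
  apply: (frame_test_null (s := 1) (c := B) EBD mEB).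
    by move=> x [_ /=]; rewrite -/S => ?; lra.
  by move=> _; rewrite -/S !mul1r; have /andP[] := test EB EBD mEB.
apply: ae_imp (ae_and nA nB) => x [hA hB] Dx.
by rewrite !leNgt; apply/andP; split; apply/negP => lt; [apply: hA|apply: hB].
Qed.

(** A null set can be discarded for each of countably many vectors: those with rational coordinates,
    combined with all integer caps. At a fixed [x] both sides are continuous in [w], and the bounds
    extend to every admissible vector. *)
Lemma frame_fiberwise_bounds : fiberwise omega h l p A B.
Proof.
pose cw (a : {ffun 'I_(2 * l) -> rat * rat}) k : R[i] := ratr (a k).1 +i* ratr (a k).2.
have key : {ae mu, forall x, forall n M : nat,
    if (unpickle n : option {ffun 'I_(2 * l) -> rat * rat}) is Some a
    then D (cw a) M%:R x -> A * (\sum_k csq (cw a k)) <= h * fs (cw a) x <= B * (\sum_k csq (cw a k))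
    else True}.
  apply: ae_foralln => n; apply: ae_foralln => M.
  case: unpickle => [a|]; last exact: aeW.
  exact: fiber_bound_ae.
apply: ae_imp key => x hx xh w aw.
have hrat a : adm (cw a) x ->
    A * (\sum_k csq (cw a k)) <= h * fs (cw a) x <= B * (\sum_k csq (cw a k)).
  move=> ax; have := hx (pickle a) (Num.trunc (fs (cw a) x)).+1; rewrite pickleK; apply.
  by split => //; rewrite ltW// truncnS_gt.
have /choice[q hq] := fun k => crat_seq (w k).
pose a n : {ffun 'I_(2 * l) -> rat * rat} := [ffun k => q k n].
have adma n : adm (cw (a n)) x.
  move=> k; rewrite /cw /a ffunE => ck; apply: aw; apply: contraNneq ck => wk.
  by rewrite (hq k).1// !rmorph0.
have cvw k : ccvg (fun n => cw (a n) k) (w k).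
  have := (hq k).2; congr ccvg; apply/funext => n.
  by rewrite /cw /a ffunE.
have cvS : \sum_k csq (cw (a n) k) @[n --> \oo] --> \sum_k csq (w k).
  by apply: cvg_big => [|k _]; [exact: add_continuous|exact: ccvg_csq].
have cvF : fs (cw (a n)) x @[n --> \oo] --> fs w x.
  apply: cvg_big => [|j _]; first exact: add_continuous.
  by apply: ccvg_csq; apply: ccvg_sum => k; exact: ccvgMr.
have cvM (c : R) (u : nat -> R) v : u n @[n --> \oo] --> v -> c * u n @[n --> \oo] --> c * v.
  by move=> uv; apply: cvgM => //; exact: cvg_cst.
apply/andP; split; rewrite -subr_ge0.
  have cv : h * fs (cw (a n)) x - A * \sum_k csq (cw (a n) k) @[n --> \oo] -->
      h * fs w x - A * \sum_k csq (w k) by apply: cvgB; exact: cvM.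
  rewrite -(cvg_lim _ cv)//; apply: limr_ge; first by apply: cvgP; exact: cv.
  by apply: nearW => n; rewrite subr_ge0; have /andP[] := hrat _ (adma n).
have cv : B * (\sum_k csq (cw (a n) k)) - h * fs (cw (a n)) x @[n --> \oo] -->
    B * (\sum_k csq (w k)) - h * fs w x by apply: cvgB; exact: cvM.
rewrite -(cvg_lim _ cv)//; apply: limr_ge; first by apply: cvgP; exact: cv.
by apply: nearW => n; rewrite subr_ge0; have /andP[] := hrat _ (adma n).
Qed.

End frame_fiberwise.

(** * Matrices bounded below *)

Section determinant_bounds.
Context {R : realType}.
Local Notation C := (R[i]).

Lemma det_bound n (M : 'M[C]_n) c : 0 <= c -> (forall i j, normc (M i j) <= c) ->
  normc (\det M) <= n`!%:R * c ^+ n.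
Proof.
move=> c0 Mc; have E (z : C) : `|z| = (normc z)%:C by [].
rewrite -lecR -E /determinant (le_trans (ler_norm_sum _ _ _))//.
apply: (@le_trans _ _ (\sum_(s : 'S_n) (c ^+ n)%:C)).
  apply: ler_sum => s _; rewrite normrM normr_sign mul1r normr_prod.
  have -> : (c ^+ n)%:C = \prod_(i < n) c%:C by rewrite prodr_const card_ord rmorphXn.
  by apply: ler_prod => i _; rewrite normr_ge0 /= E lecR.
rewrite sumr_const (_ : #|_| = n`!); last by rewrite -card_Sn; exact: eq_card.
by rewrite rmorphM /= rmorph_nat mulr_natl.
Qed.

Lemma csq_det_bound n (M : 'M[C]_n) a : 0 <= a -> (forall i j, csq (M i j) <= a) ->
  csq (\det M) <= (n`!%:R * Num.sqrt a ^+ n) ^+ 2.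
Proof.
move=> a0 Ma; rewrite -normc_sq lerXn2r ?nnegrE ?normc_ge0 ?mulr_ge0 ?exprn_ge0 ?sqrtr_ge0//.
by apply: det_bound => [|i j]; [exact: sqrtr_ge0|rewrite normc_sqrt ler_wsqrtr].
Qed.

Lemma csq_dot n (x y : 'I_n -> C) a : (forall i, csq (y i) <= a) ->
  csq (\sum_i x i * y i) <= n%:R * a * \sum_i csq (x i).
Proof.
move=> ya; rewrite (le_trans (csq_sum_le _))// -mulrA ler_wpM2l// mulr_sumr.
by apply: ler_sum => i _; rewrite csqM mulrC ler_wpM2r ?csq_ge0.
Qed.

Definition rowdot n m (w : 'I_n -> C) (M : 'M[C]_(n, m)) (j : 'I_m) : C := \sum_i w i * M i j.

(** Cramer's rule: [\det M] times [w] is the row [w M] times the adjugate, whose entries are bounded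
    in terms of [a]. The constant is independent of [M], hence uniform over the fibers. *)
Lemma det_rowdot_lower n (a eta : R) : 0 <= a -> 0 < eta -> exists2 K, 0 < K &
  forall M : 'M[C]_n, (forall i j, csq (M i j) <= a) -> eta <= csq (\det M) ->
  forall w, \sum_i csq (w i) <= K * \sum_j csq (rowdot w M j).
Proof.
move=> a0 eta0; pose b : R := (n.-1`!%:R * Num.sqrt a ^+ n.-1) ^+ 2.
have b0 : 0 <= b by exact: sqr_ge0.
(* Adding 1 keeps the constant positive even if the main term vanishes. *)
exists (n%:R * (n%:R * b) / eta + 1); first by rewrite ltr_wpDl// divr_ge0 ?(ltW eta0)// !mulr_ge0.
move=> M Ma Meta w; have adj i j : csq ((\adj M) i j) <= b.
  rewrite mxE /cofactor csqM (_ : csq _ = 1) ?mul1r; last first.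
    by rewrite -signr_odd; case: odd; rewrite ?csqN (csq_real 1) expr1n.
  by apply: csq_det_bound => // k l; rewrite !mxE.
have wdet i : w i * \det M = \sum_j rowdot w M j * (\adj M) j i.
  transitivity (((\row_k w k) *m M *m \adj M) 0 i).
    by rewrite -mulmxA mul_mx_adj mul_mx_scalar !mxE mulrC.
  rewrite mxE; apply: eq_bigr => j _; rewrite mxE; congr (_ * _).
  by apply: eq_bigr => k _; rewrite mxE.
set S := \sum_j csq (rowdot w M j); have S0 : 0 <= S by apply: sumr_ge0 => j _; exact: csq_ge0.
have wi i : csq (w i) <= n%:R * b / eta * S.
  rewrite mulrAC ler_pdivlMr// (le_trans (ler_wpM2l (csq_ge0 _) Meta))// -csqM wdet.
  by apply: csq_dot => j; exact: adj.
apply: (@le_trans _ _ (\sum_(i < n) (n%:R * b / eta * S))); first by apply: ler_sum.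
rewrite sumr_const card_ord -[_ *+ n]mulr_natl.
rewrite (_ : n%:R * _ = n%:R * (n%:R * b) / eta * S); last by rewrite !mulrA.
by rewrite ler_wpM2r// lerDl.
Qed.

(** A row of [invmx M] is sent by [M] to a unit vector, so the hypothesis bounds its squared norm by
    [A^-1]. The determinant of the inverse is then bounded above, and that of [M] below. *)
Lemma det_ge_rowdot n (A : R) : 0 < A -> exists2 eta, 0 < eta &
  forall M : 'M[C]_n, (forall w, A * \sum_i csq (w i) <= \sum_j csq (rowdot w M j)) ->
  eta <= normc (\det M).
Proof.
move=> A0; pose b : R := n`!%:R * Num.sqrt A^-1 ^+ n.
have b0 : 0 < b by rewrite mulr_gt0 ?ltr0n ?fact_gt0// exprn_gt0// sqrtr_gt0 invr_gt0.
exists b^-1; first by rewrite invr_gt0.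
move=> M HM; have uM : M \in unitmx.
  rewrite unitmxE unitfE; apply/negP => /eqP/eqP/det0P[v v0 vM].
  have := HM (fun i => v 0 i); rewrite [leRHS]big1; last first.
    move=> j _; rewrite (_ : rowdot _ _ _ = (v *m M) 0 j); last by rewrite mxE.
    by rewrite vM mxE csq0.
  apply/negP; rewrite -ltNge mulr_gt0// lt_neqAle sumr_ge0 ?andbT; last by move=> i _; exact: csq_ge0.
  apply: contra v0; rewrite eq_sym psumr_eq0; last by move=> i _; exact: csq_ge0.
  move=> /allP v0; apply/eqP/rowP => i; rewrite mxE.
  by apply: csq_eq0; apply/eqP; apply: v0; rewrite mem_index_enum.
have inv i j : csq (invmx M i j) <= A^-1.
  have := HM (fun k => invmx M i k); rewrite (bigD1 j)//= mulrDr.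
  have -> : \sum_k csq (rowdot (fun l => invmx M i l) M k) = 1.
    rewrite (bigD1 i)//= big1 => [|k ki].
      rewrite (_ : rowdot _ _ _ = (invmx M *m M) i i); last by rewrite mxE.
      by rewrite mulVmx// mxE eqxx csq_real expr1n addr0.
    rewrite (_ : rowdot _ _ _ = (invmx M *m M) i k); last by rewrite mxE.
    by rewrite mulVmx// mxE eq_sym (negbTE ki) csq0.
  rewrite -[A^-1]mul1r ler_pdivlMr// mulrC; apply: le_trans; rewrite lerDl mulr_ge0 ?(ltW A0)//.
  by apply: sumr_ge0 => k _; exact: csq_ge0.
have Vb : normc (\det (invmx M)) <= b.
  by apply: det_bound => [|i j]; [exact: sqrtr_ge0|rewrite normc_sqrt ler_wsqrtr].
have dd : normc (\det M) * normc (\det (invmx M)) = 1.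
  by rewrite -normcM -det_mulmx mulmxV// det1 normc_sqrt csq_real expr1n sqrtr1.
rewrite -[leLHS]mul1r ler_pdivrMr// -dd ler_wpM2l//; exact: normc_ge0.
Qed.

End determinant_bounds.

(** * Minors of a fixed order *)

Section minors.
Context {R : realType}.
Local Notation C := (R[i]).

Definition increasing m n (s : {ffun 'I_n -> 'I_m}) : bool :=
  [forall a : 'I_n, forall b : 'I_n, (a < b)%N ==> (s a < s b)%N].

Lemma increasing_inj m n (s : {ffun 'I_n -> 'I_m}) : increasing s -> injective s.
Proof.
move=> /forallP inc a b ab; apply: ord_inj; have [lt|lt|//] := ltngtP a b.
  by have := forallP (inc a) b; rewrite lt ab ltnn.
by have := forallP (inc b) a; rewrite lt ab ltnn.
Qed.

Lemma increasing_lift m (j : 'I_m.+1) : increasing [ffun a : 'I_m => lift j a].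
Proof.
apply/forallP => a; apply/forallP => b; apply/implyP => ab.
by rewrite !ffunE /= ltnNge leq_bump2 -ltnNge.
Qed.

Lemma minors_sq_ge p q n (M : 'M[C]_(p, q)) (r : {ffun 'I_n -> 'I_p}) (s : {ffun 'I_n -> 'I_q}) :
  increasing r -> increasing s -> csq (\det (mxsub r s M)) <= minors_sq n M.
Proof.
move=> ir is_; rewrite /minors_sq (bigD1 r)//= (bigD1 s)//= normc_sq -addrA lerDl addr_ge0//.
  by apply: sumr_ge0 => i _; rewrite normc_sq csq_ge0.
by apply: sumr_ge0 => i _; apply: sumr_ge0 => k _; rewrite normc_sq csq_ge0.
Qed.

(** Pigeonhole: the number of minors depends on the dimensions only, so one of them takes a fixed
    share of the sum. [K] overcounts them by admitting all selections, increasing or not. *)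
Lemma minors_sq_exists p q n (sigma : R) : 0 < sigma -> exists2 eta, 0 < eta &
  forall M : 'M[C]_(p, q), sigma <= minors_sq n M ->
  exists (r : {ffun 'I_n -> 'I_p}) (s : {ffun 'I_n -> 'I_q}),
    [/\ increasing r, increasing s & eta <= csq (\det (mxsub r s M))].
Proof.
move=> sigma0; pose K : R := (#|{ffun 'I_n -> 'I_p}| * #|{ffun 'I_n -> 'I_q}|)%:R.
have K0 : 0 <= K by [].
have eta0 : 0 < sigma / (K + 1) by rewrite divr_gt0// ltr_wpDl.
exists (sigma / (K + 1)) => // M Ms; apply: contrapT => none.
move: Ms; apply/negP; rewrite -ltNge.
apply: (@le_lt_trans _ _ (K * (sigma / (K + 1)))); last first.
  by rewrite mulrA ltr_pdivrMr ?ltr_wpDl// mulrC ltr_pM2l// ltrDl.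
rewrite /minors_sq big_mkcond.
apply: (@le_trans _ _ (\sum_(r : {ffun 'I_n -> 'I_p}) \sum_(s : {ffun 'I_n -> 'I_q}) (sigma / (K + 1)))).
  apply: ler_sum => r _; case: ifPn => ir; last by apply: sumr_ge0 => s _; exact: ltW.
  rewrite big_mkcond; apply: ler_sum => s _; case: ifPn => is_; last exact: ltW.
  rewrite normc_sq leNgt; apply/negP => /ltW lt; apply: none.
  by exists r, s; split.
by rewrite !sumr_const -mulrnA -mulr_natl mulnC.
Qed.

End minors.

(** * Injections that miss exactly one index *)

Section skip.
Variables (n m : nat) (kappa : 'I_n -> 'I_m) (k0 : 'I_m).
Hypotheses (mn : m = n.+1) (kappa_inj : injective kappa) (kappa0 : forall r, kappa r != k0).

Lemma image_skip : [set kappa r | r in [set: 'I_n]]%SET = [set~ k0]%SET.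
Proof.
apply/eqP; rewrite eqEcard; apply/andP; split.
  by apply/fintype.subsetP => _ /imsetP[x _ ->]; rewrite !inE.
by rewrite card_imset// cardsT card_ord cardsC1 card_ord mn.
Qed.

Lemma sum_skip (V : zmodType) (F : 'I_m -> V) : F k0 = 0 -> \sum_k F k = \sum_r F (kappa r).
Proof.
move=> F0; rewrite (bigD1 k0)//= F0 add0r.
rewrite (eq_bigl (fun k => k \in [set~ k0]%SET)); last by move=> k; rewrite !inE.
rewrite -image_skip big_imset/=; last by move=> x y _ _ /kappa_inj.
by apply: eq_bigl => r; rewrite inE.
Qed.

Lemma extend_skip (V : zmodType) (v : 'I_n -> V) :
  exists2 w : 'I_m -> V, w k0 = 0 & forall r, w (kappa r) = v r.
Proof.
exists (fun k => if [pick r | kappa r == k] is Some r then v r else 0).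
  by case: pickP => // r /eqP kr; move: (kappa0 r); rewrite kr eqxx.
by move=> r; case: pickP => [r' /eqP/kappa_inj ->//|/(_ r)]; rewrite eqxx.
Qed.

End skip.

(** * Lower bounds and minors for all rows but the last *)

Section degenerate.
Context {R : realType}.
Local Notation C := (R[i]).
Variable m : nat.
Implicit Types (M : 'M[C]_m.+1) (w : 'I_m.+1 -> C).

(** A minor that is not zero avoids the zero row, so it selects exactly the other [m] rows. Its
    square submatrix is bounded below by [det_rowdot_lower], and the column left out can only add to
    the sum. *)
Lemma minors_rowdot_lower (a sigma : R) : 0 <= a -> 0 < sigma -> exists2 K, 0 < K &
  forall M, (forall i j, csq (M i j) <= a) -> (forall j, M ord_max j = 0) ->
  sigma <= minors_sq m M -> forall w, w ord_max = 0 ->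
  \sum_i csq (w i) <= K * \sum_j csq (rowdot w M j).
Proof.
move=> a0 sigma0; have [eta eta0 Heta] := @minors_sq_exists R m.+1 m.+1 m _ sigma0.
have [K K0 HK] := det_rowdot_lower m a0 eta0.
exists K => // M Ma M0 /Heta[r [s [ir is_ detrs]]] w w0.
have rmax a' : r a' != ord_max.
  apply/eqP => ra; move: detrs; apply/negP; rewrite -ltNge.
  rewrite (_ : \det _ = 0) ?csq0// (expand_det_row _ a') big1// => j _.
  by rewrite mxE ra M0 mul0r.
have injr := increasing_inj ir; have injs := increasing_inj is_.
have sum_r := sum_skip (erefl _) injr rmax.
rewrite (sum_r _ (fun i => csq (w i))) ?w0 ?csq0//.
have := HK (mxsub r s M) _ detrs (fun x => w (r x)) => /(_ (fun i j => _)).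
move=> H; apply: le_trans (H _) _; first by move=> i j; rewrite mxE.
rewrite ler_pM2l//.
rewrite (eq_bigr (fun j => csq (rowdot w M (s j)))) => [|j _]; last first.
  rewrite /rowdot (sum_r _ (fun i => w i * M i (s j))) ?w0 ?mul0r//.
  by congr csq; apply: eq_bigr => x _; rewrite mxE.
have -> : \sum_i csq (rowdot w M (s i)) =
    \sum_(j in [set s x | x in [set: 'I_m]]%SET) csq (rowdot w M j).
  rewrite big_imset/=; last by move=> x y _ _ /injs.
  by apply: eq_bigl => x; rewrite inE.
rewrite [leRHS](bigID (fun j => j \in [set s x | x in [set: 'I_m]]%SET)) /= lerDl.
by apply: sumr_ge0 => j _; exact: csq_ge0.
Qed.

(* Completing the rows by a unit vector orthogonal to them keeps the lower bound; the determinant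
   of the completed matrix expands along the new row into minors of order [m]. *)
Lemma minors_sq_ge_rowdot (A : R) : 0 < A -> exists2 sigma, 0 < sigma &
  forall M, (forall w, w ord_max = 0 -> A * \sum_i csq (w i) <= \sum_j csq (rowdot w M j)) ->
  sigma <= minors_sq m M.
Proof.
move=> A0; have A1 : 0 < Num.min A 1 by rewrite lt_min A0 ltr01.
have [eta eta0 Heta] := @det_ge_rowdot R m.+1 _ A1.
(* One factor [m.+1] is lost to [csq_sum_le], the other to the number of cofactors in the
   expansion. *)
exists (eta ^+ 2 / (m.+1%:R * m.+1%:R)) => [|M HM].
  by rewrite divr_gt0 ?exprn_gt0// mulr_gt0.
pose M0 := \matrix_(i, j) if i == ord_max then 0 else M i j.
have /eqP/det0P[u u0 uM] : \det M0^T = 0.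
  rewrite det_tr (expand_det_row _ ord_max) big1// => j _.
  by rewrite mxE eqxx mul0r.
pose s := \sum_j csq (u 0 j).
have s0 : 0 < s.
  rewrite lt_neqAle sumr_ge0 ?andbT => [|j _]; last exact: csq_ge0.
  apply: contra u0; rewrite eq_sym psumr_eq0 => [|j _]; last exact: csq_ge0.
  move=> /allP su; apply/eqP/rowP => j; rewrite mxE; apply: csq_eq0.
  by apply/eqP; apply: su; rewrite mem_index_enum.
pose v j := ((Num.sqrt s)^-1)%:C * u 0 j.
have v1 : \sum_j csq (v j) = 1.
  under eq_bigr do rewrite csqM csq_real exprVn sqr_sqrtr ?(ltW s0)//.
  by rewrite -mulr_sumr mulVf// gt_eqF.
have Mv i : i != ord_max -> \sum_j M i j * v j = 0.
  move=> im; under eq_bigr do rewrite mulrCA.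
  rewrite -mulr_sumr (_ : \sum_j _ = (u *m M0^T) 0 i); first by rewrite uM mxE mulr0.
  by rewrite mxE; apply: eq_bigr => j _; rewrite !mxE (negbTE im) mulrC.
(* The vector [v] is annihilated by the rows without conjugation, so its conjugate is the one
   orthogonal to them in the Hermitian sense. *)
pose M1 : 'M[C]_m.+1 := \matrix_(i, j) if i == ord_max then (v j)^* else M i j.
have lower w : Num.min A 1 * \sum_i csq (w i) <= \sum_j csq (rowdot w M1 j).
  pose w' i := if i == ord_max then 0 else w i.
  have row j : rowdot w M1 j = rowdot w' M j + w ord_max * (v j)^*.
    rewrite /rowdot (bigD1 ord_max)//= mxE eqxx addrC; congr (_ + _).
    rewrite [RHS](bigD1 ord_max)//= /w' eqxx mul0r add0r; apply: eq_bigr => i im.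
    by rewrite mxE (negbTE im).
  have orth : \sum_j rowdot w' M j * v j = 0.
    rewrite /rowdot; under eq_bigr do rewrite mulr_suml.
    rewrite exchange_big big1// => i _; under eq_bigr do rewrite -mulrA.
    rewrite -mulr_sumr /w'; case: eqVneq => [_|im]; first by rewrite mul0r.
    by rewrite Mv ?mulr0.
  have -> : \sum_j csq (rowdot w M1 j) = \sum_j csq (rowdot w' M j) + csq (w ord_max).
    apply: complexI; rewrite rmorphD !rmorph_sum /=.
    pose T j := rowdot w' M j * v j.
    transitivity (\sum_j ((csq (rowdot w' M j))%:C + (w ord_max)^* * T j +
        (w ord_max * (T j)^* + (csq (w ord_max))%:C * (csq (v j))%:C))).
      apply: eq_bigr => j _; rewrite row -!csqE /T.
      move: (v j) (rowdot w' M j) (w ord_max) => z1 z2 z3; rewrite conjcD !conjcM.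
      by rewrite conjc_conjc; ring.
    rewrite !big_split /= -!mulr_sumr orth mulr0 addr0; congr (_ + _).
    have -> : \sum_j (csq (v j))%:C = 1 :> C by rewrite -rmorph_sum /= v1.
    rewrite mulr1.
    have -> : \sum_j (T j)^* = 0 by rewrite -conjc_sum orth conjc0.
    by rewrite mulr0 add0r.
  have w'0 : w' ord_max = 0 by rewrite /w' eqxx.
  have := HM w' w'0; rewrite (bigD1 ord_max)//= w'0 csq0 add0r => H.
  rewrite (bigD1 ord_max)//= mulrDr addrC lerD//.
    apply: le_trans H.
    rewrite (eq_bigr (fun i => csq (w' i))) => [|i im]; last by rewrite /w' (negbTE im).
    rewrite ler_wpM2r ?ge_min ?lexx//.
    by apply: sumr_ge0 => i _; exact: csq_ge0.
  by rewrite ler_piMl ?csq_ge0// ge_min lexx orbT.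
have := Heta _ lower; rewrite (expand_det_row _ ord_max) => Hdet.
rewrite ler_pdivrMr ?mulr_gt0//.
have cof j : csq (cofactor M1 ord_max j) <= minors_sq m M.
  rewrite /cofactor csqM (_ : csq _ = 1) ?mul1r; last first.
    by rewrite -signr_odd; case: odd; rewrite ?csqN -?(rmorph1 (real_complex R)) csq_real expr1n.
  apply: le_trans (minors_sq_ge M (increasing_lift ord_max) (increasing_lift j)).
  rewrite (_ : row' _ _ = mxsub [ffun a => lift ord_max a] [ffun a => lift j a] M)//.
  by apply/matrixP => a b; rewrite !mxE !ffunE eq_sym (negbTE (neq_lift _ _)).
have v1j j : csq (v j) <= 1.
  by rewrite -v1 (bigD1 j)//= lerDl sumr_ge0// => i _; exact: csq_ge0.
apply: (@le_trans _ _ (csq (\sum_j M1 ord_max j * cofactor M1 ord_max j))).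
  by rewrite -normc_sq lerXn2r ?nnegrE ?(ltW eta0) ?normc_ge0.
rewrite (le_trans (csq_sum_le _))// mulrCA ler_wpM2l//.
apply: (@le_trans _ _ (\sum_(j < m.+1) minors_sq m M)); last first.
  by rewrite sumr_const card_ord mulr_natr.
apply: ler_sum => j _; rewrite csqM mxE eqxx csqJ.
by rewrite (le_trans _ (cof j))// ler_piMl ?csq_ge0.
Qed.

End degenerate.

(** * Fibers and the pre-Gramian *)

Lemma Kminus_le_Kplus (R : realType) (omega h l : R) : 2 * omega <= (2 * l - 1) * h ->
  omega - (l - 1) * h <= - omega + l * h.
Proof. by lra. Qed.

Lemma Kmid_node_in (R : realType) (omega h l x r : R) : (l - 1) * h < omega ->
  0 < x < h -> 0 <= r * h -> (r + 3) * h <= 2 * l * h ->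
  - omega <= x + (r + 1 - l) * h <= omega.
Proof. by move=> ? /andP[? ?] ? ?; apply/andP; split; lra. Qed.

Lemma band_lt (R : realType) (omega h l : R) : 0 < h -> 2 * omega <= (2 * l - 1) * h ->
  omega < l * h.
Proof. by lra. Qed.

Section gramian.
Context {R : realType}.
Notation mu := (@lebesgue_measure R).
Notation RR := (measurableTypeR R).
Variables (omega t0 h : R) (l : nat) (phihat p : 'I_(2 * l - 1) -> R -> R[i]).
Hypotheses (hE : h = 2 * pi / t0) (l2 : (2 <= l)%N).
Hypotheses (omega0 : 0 < omega) (h0 : 0 < h).
Hypotheses (h_ge : 2 * omega <= (2 * l%:R - 1) * h) (h_lt : (l%:R - 1) * h < omega).
Hypothesis p0 : forall j x, ~~ (- omega <= x <= omega) -> p j x = 0.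
Hypothesis phihat_p : forall j, {ae mu, forall x, phihat j x = p j x}.

Notation fs := (fiber_sum h (l := l) p).
Notation adm := (admissible omega h (l := l)).
Notation J := (preGramian omega t0 phihat).
Notation node := (node h l).
Notation n := (2 * l - 1)%N.

Lemma index_lt (b : bool) (r : 'I_n) : ((if b then r : nat else r.+1) < 2 * l)%N.
Proof. by have := ltn_ord r; case: b; lia. Qed.

(* Row [r] of the pre-Gramian at [x] samples at the node of index [index (x \in K_+) r]; the single
   node it skips lies outside the band. *)
Definition index b r : 'I_(2 * l) := Ordinal (index_lt b r).

Lemma skipped_lt (b : bool) : ((if b then n else 0) < 2 * l)%N.
Proof. by case: b; lia. Qed.

(** Node [k] stands for [j = k - l]. The rows start at [j = -(l - 1)] off K_+, missing [k = 0], and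
    end at [j = l - 2] on K_+, missing [k = 2l - 1]. *)
Definition skipped b : 'I_(2 * l) := Ordinal (skipped_lt b).

Lemma index_inj b : injective (index b).
Proof. by move=> r s /(congr1 val) /= H; apply: val_inj; case: b H => //= -[]. Qed.

Lemma index_skipped b r : index b r != skipped b.
Proof.
apply/eqP => /(congr1 val) /=; have := ltn_ord r; case: b => //=.
by move=> H E; move: H; rewrite E ltnn.
Qed.

Lemma dimE : (2 * l)%N = n.+1. Proof. lia. Qed.

Lemma last_lt : (n.-1 < n)%N. Proof. lia. Qed.

Definition last_row : 'I_n := Ordinal last_lt.

Lemma preGramianE x r i : J x r i =
  (Num.sqrt h)%:C * phihat i (node (index (x \in Kplus omega h l) r) x).
Proof.
rewrite /preGramian mxE -hE; congr (_ * phihat i (x + _ * h)).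
by case: ifPn => _ /=; rewrite ?opprB ?rmorphB /= ?rmorphD /= -!pmulrn// -natr1; ring.
Qed.

Definition generic (x : R) : Prop :=
  [/\ 0 < x < h, x != omega - (l%:R - 1) * h, x != - omega + l%:R * h &
      forall k j, phihat j (node k x) = p j (node k x)].

Lemma ae_neq (a : R) : {ae mu, forall x, x != a}.
Proof.
exists [set a]; split => //; first exact: lebesgue_measure_set1.
by move=> x /= /negP; rewrite negbK => /eqP.
Qed.

Lemma ae_ord N (P : 'I_N -> R -> Prop) : (forall i, {ae mu, forall x, P i x}) ->
  {ae mu, forall x, forall i, P i x}.
Proof.
move=> aP; have : {ae mu, forall x, forall k : nat, if insub k is Some i then P i x else True}.
  by apply: ae_foralln => k; case: insub => [i|]; [exact: aP|exact: aeW].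
by apply: ae_imp => x h' i; have := h' i; rewrite valK.
Qed.

Lemma ae_generic : {ae mu, forall x, 0 <= x < h -> generic x}.
Proof.
have good : {ae mu, forall x, forall k : nat, forall j, phihat j (node k x) = p j (node k x)}.
  apply: ae_foralln => k; apply: ae_ord => j.
  exact: (ae_shift ((k%:R - l%:R) * h) (phihat_p j)).
have := ae_and (ae_neq 0) (ae_and (ae_neq (omega - (l%:R - 1) * h))
  (ae_and (ae_neq (- omega + l%:R * h)) good)).
apply: ae_imp => x [x0 [x1 [x2 x3]]] /andP[x4 x5]; split => //.
by rewrite x5 lt_neqAle eq_sym x0 x4.
Qed.

Lemma in_Kminus x : (x \in Kminus omega h l) = (0 < x < omega - (l%:R - 1) * h).
Proof. by rewrite in_itv. Qed.
Lemma in_Kmid x : (x \in Kmid omega h l) = (omega - (l%:R - 1) * h < x < - omega + l%:R * h).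
Proof. by rewrite in_itv. Qed.
Lemma in_Kplus x : (x \in Kplus omega h l) = (- omega + l%:R * h < x < h).
Proof. by rewrite in_itv. Qed.

Lemma generic_cases x : generic x ->
  [\/ x \in Kminus omega h l, x \in Kmid omega h l | x \in Kplus omega h l].
Proof.
case=> /andP[x0 xh] x1 x2 _; rewrite in_Kminus in_Kmid in_Kplus x0 xh andbT /=.
have [lt1|gt1|e] := ltgtP x (omega - (l%:R - 1) * h); last by rewrite e eqxx in x1.
  by constructor 1.
have [lt2|gt2|e] := ltgtP x (- omega + l%:R * h); last by rewrite e eqxx in x2.
  by constructor 2.
by constructor 3.
Qed.

Lemma Kplus_disjoint x : x \in Kminus omega h l \/ x \in Kmid omega h l ->
  (x \in Kplus omega h l) = false.
Proof.
rewrite in_Kminus in_Kmid in_Kplus => -[] /andP[a1 a2]; apply/negP => /andP[b1 b2].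
  by have := lt_trans b1 (lt_le_trans a2 (Kminus_le_Kplus h_ge)); rewrite ltxx.
by move: b1; apply/negP; rewrite -leNgt ltW.
Qed.

Lemma skipped_out x : generic x ->
  ~~ (- omega <= node (skipped (x \in Kplus omega h l)) x <= omega).
Proof.
move=> gx; have [xh _ _ _] := gx; apply/negP => /andP[b1 b2].
case: (generic_cases gx) => xK.
- move: b1 b2; rewrite (Kplus_disjoint (or_introl xK)) /node /= => b1 b2.
  move: xK; rewrite in_Kminus => /andP[_ x1].
  by have := Kminus_le_Kplus h_ge; lra.
- move: b1 b2; rewrite (Kplus_disjoint (or_intror xK)) /node /= => b1 b2.
  by move: xK; rewrite in_Kmid => /andP[]; lra.
- move: b1 b2; rewrite xK /node /= natrB; last by lia.
  rewrite natrM => b1 b2.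
  move: xK; rewrite in_Kplus => /andP[x1 _].
  by have := Kminus_le_Kplus h_ge; lra.
Qed.

Lemma index_in x r : generic x -> (x \in Kmid omega h l -> r != last_row) ->
  - omega <= node (index (x \in Kplus omega h l) r) x <= omega.
Proof.
move=> gx xr; have [/andP[x0 xh] _ _ _] := gx.
have rn : (r%:R + 2 <= 2 * l%:R :> R).
  by rewrite -natrM -natrD ler_nat; have := ltn_ord r; lia.
have r0 : 0 <= r%:R * h by rewrite mulr_ge0// ltW.
have rnh : (r%:R + 2) * h <= 2 * l%:R * h by rewrite ler_pM2r.
case: (generic_cases gx) => xK.
- rewrite (Kplus_disjoint (or_introl xK)) /node /= -natr1.
  by move: xK; rewrite in_Kminus => /andP[_ x1]; apply/andP; split; lra.
- rewrite (Kplus_disjoint (or_intror xK)) /node /= -natr1.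
  have {}rn : (r%:R + 3 <= 2 * l%:R :> R).
    rewrite -natrM -natrD ler_nat; have := ltn_ord r; have := xr xK.
    by rewrite -val_eqE /=; lia.
  have rnh3 : (r%:R + 3) * h <= 2 * l%:R * h by rewrite ler_pM2r.
  by apply: Kmid_node_in; rewrite ?x0.
- rewrite xK /node /=.
  by move: xK; rewrite in_Kplus => /andP[x1 _]; apply/andP; split; lra.
Qed.

Lemma last_row_out x : generic x -> x \in Kmid omega h l ->
  ~~ (- omega <= node (index (x \in Kplus omega h l) last_row) x <= omega).
Proof.
move=> gx xK; rewrite (Kplus_disjoint (or_intror xK)); apply/negP => /andP[_].
rewrite /node /= (_ : n.-1.+1 = n) ?prednK ?natrB ?natrM; [|lia|lia|lia].
by move: xK; rewrite in_Kmid => /andP[x1 _]; lra.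
Qed.

Lemma last_row0 x : generic x -> x \in Kmid omega h l -> forall i, J x last_row i = 0.
Proof.
move=> gx xK i; rewrite preGramianE; case: (gx) => _ _ _ ->.
by rewrite p0 ?mulr0//; exact: last_row_out.
Qed.

(* [v] ranges over the coefficient vectors supported by the rows whose node lies in the band. *)
Definition supported x (v : 'I_n -> R[i]) : Prop := x \in Kmid omega h l -> v last_row = 0.

(** The fiber sum pairs [w] with the conjugates of the transforms, the pre-Gramian contains the
    transforms themselves; conjugating inside the modulus moves the bar to [w]. *)
Lemma fiber_sumE x (w : 'I_(2 * l) -> R[i]) : generic x ->
  h * fs w x = \sum_i csq (rowdot (fun r => (w (index (x \in Kplus omega h l) r))^*) (J x) i).
Proof.
move=> gx; set b := _ \in _; rewrite mulr_sumr; apply: eq_bigr => i _.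
rewrite (sum_skip dimE (@index_inj b) (@index_skipped b)); last first.
  by rewrite p0 ?skipped_out// conjc0 mulr0.
rewrite -[csq (rowdot _ _ _)]csqJ.
have -> : rowdot (fun r => (w (index b r))^*) (J x) i =
    (Num.sqrt h)%:C * \sum_r (w (index b r))^* * p i (node (index b r) x).
  rewrite mulr_sumr; apply: eq_bigr => r _; rewrite preGramianE -/b.
  by case: (gx) => _ _ _ ->; rewrite mulrCA.
rewrite csqJ csqM csq_real sqr_sqrtr ?ltW//; congr (_ * _).
rewrite -csqJ; congr csq; rewrite conjc_sum; apply: eq_bigr => r _.
by rewrite conjcM conjc_conjc.
Qed.

Lemma sum_index b (w : 'I_(2 * l) -> R[i]) : w (skipped b) = 0 ->
  \sum_k csq (w k) = \sum_r csq ((w (index b r))^*).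
Proof.
move=> w0; rewrite (sum_skip dimE (@index_inj b) (@index_skipped b)); last by rewrite w0 csq0.
by apply: eq_bigr => r _; rewrite csqJ.
Qed.

(** An admissible vector vanishes at the skipped node and, over K, at the node of the last row; so
    admissible vectors are exactly the extensions by zero of conjugates of supported ones. *)
Lemma fiber_iff x A B : generic x ->
  (forall w, adm w x -> A * (\sum_k csq (w k)) <= h * fs w x <= B * (\sum_k csq (w k))) <->
  (forall v, supported x v ->
     A * (\sum_r csq (v r)) <= \sum_i csq (rowdot v (J x) i) <= B * (\sum_r csq (v r))).
Proof.
move=> gx; set b := x \in Kplus omega h l; split=> H.
  move=> v sv; have [w w0 wv] := extend_skip (@index_inj b) (@index_skipped b) (fun r => (v r)^*).
  have ev : (fun r => (w (index b r))^*) = v by apply/funext => r; rewrite wv conjc_conjc.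
  have aw : adm w x.
    move=> k wk.
    have : k \in [set index b r | r in [set: 'I_n]]%SET.
      rewrite (image_skip dimE (@index_inj b) (@index_skipped b)) !inE.
      by apply: contraNneq wk => ->; rewrite w0.
    move=> /imsetP[r _ kr]; rewrite kr; apply: index_in => // xK.
    apply: contraNneq wk => rl; rewrite kr wv rl sv//.
    by rewrite conjc0.
  have := H w aw; rewrite (fiber_sumE w gx) (sum_index w0) -/b ev.
  by under eq_bigr do rewrite wv conjc_conjc.
move=> w aw; have w0 : w (skipped b) = 0.
  by apply: contrapT => /eqP/aw; exact/negP/skipped_out.
rewrite (fiber_sumE w gx) (sum_index w0) -/b; apply: H => xK.
rewrite (_ : w _ = 0); first exact: conjc0.
by apply: contrapT => /eqP/aw; exact/negP/last_row_out.
Qed.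

Lemma omega_lt : omega < l%:R * h.
Proof. exact: band_lt h0 h_ge. Qed.

Lemma ae_node (P : R -> Prop) : {ae mu, forall x, P x} ->
  {ae mu, forall x, forall k : nat, P (node k x)}.
Proof. by move=> aP; apply: ae_foralln => k; exact: (ae_shift ((k%:R - l%:R) * h) aP). Qed.

(** The translated tiles cover the band, and finitely many null sets are discarded, one for each
    translate. *)
Lemma ae_unfold (P : R -> Prop) :
  {ae mu, forall x, 0 <= x < h -> forall k : 'I_(2 * l), P (node k x)} ->
  {ae mu, forall y, - omega <= y <= omega -> P y}.
Proof.
move=> aP.
have : {ae mu, forall y, forall k : 'I_(2 * l), 0 <= y - (k%:R - l%:R) * h < h -> P y}.
  apply: ae_ord => k; apply: ae_imp (ae_shift (- ((k%:R - l%:R) * h)) aP) => y H yk.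
  by have := H yk k; rewrite /node subrK.
apply: ae_imp => y H yo; have := cover_tile h0 omega_lt yo.
apply: contraPP => nP; rewrite big1; first by move/esym/eqP; rewrite oner_eq0.
move=> k _; rewrite tileE; case: (boolP (_ <= _ < _)) => // yk.
by case: nP; exact: H yk.
Qed.

Lemma full_supported x v : x \in Kminus omega h l \/ x \in Kplus omega h l -> supported x v.
Proof.
move=> xK xM; exfalso; case: xK => xK; last first.
  by move: xK; rewrite (Kplus_disjoint (or_intror xM)).
move: xK xM; rewrite in_Kminus in_Kmid => /andP[_ x1] /andP[x2 _].
by move: (lt_trans x1 x2); rewrite ltxx.
Qed.

Lemma Kminus_Kplus_in x : x \in Kminus omega h l \/ x \in Kplus omega h l -> 0 <= x < h.
Proof.
have lh : - omega + l%:R * h < h by move: h_lt; rewrite mulrBl mul1r; lra.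
rewrite in_Kminus in_Kplus => -[] /andP[x1 x2].
  by rewrite (ltW x1) (lt_le_trans x2)// (le_trans (Kminus_le_Kplus h_ge))// ltW.
rewrite x2 andbT (le_trans _ (ltW x1))// (le_trans _ (Kminus_le_Kplus h_ge))//.
by rewrite subr_ge0 ltW.
Qed.

Lemma Kmid_in x : x \in Kmid omega h l -> 0 <= x < h.
Proof.
rewrite in_Kmid => /andP[x1 x2]; have lh : - omega + l%:R * h < h.
  by move: h_lt; rewrite mulrBl mul1r; lra.
by rewrite (lt_trans x2)// andbT (le_trans _ (ltW x1))// subr_ge0 ltW.
Qed.

Notation fiberwise := (fiberwise omega h l p).

Lemma fiberwise_generic A B : fiberwise A B -> {ae mu, forall x, 0 <= x < h -> generic x /\
  forall v, supported x v ->
    A * (\sum_r csq (v r)) <= \sum_i csq (rowdot v (J x) i) <= B * (\sum_r csq (v r))}.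
Proof.
move=> fib; apply: ae_imp (ae_and fib ae_generic) => x [H G] xh.
by split; [exact: G|apply/(fiber_iff _ _ (G xh)); exact: H].
Qed.

Lemma fiberwise_cond1 A B : fiberwise A B ->
  {ae mu, forall y, y \in `]- omega, omega[ ->
    A / h <= \sum_j csq (phihat j y) <= B / h}.
Proof.
move=> fib; have : {ae mu, forall x, 0 <= x < h -> forall k : 'I_(2 * l),
    - omega <= node k x <= omega -> A / h <= \sum_j csq (p j (node k x)) <= B / h}.
  apply: ae_imp fib => x H xh k xk.
  (* On a unit vector the fiber sum reduces to the sum of squares in condition (1) at a single node;
     the factor [h] accounts for the bounds [A / h] and [B / h]. *)
  pose w (i : 'I_(2 * l)) : R[i] := (i == k)%:R.
  have aw : adm w x.
    by move=> i; rewrite /w; have [->|] := eqVneq i k; rewrite ?eqxx.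
  have := H xh w aw; rewrite (bigD1 k)//= big1 => [|i /negbTE ik]; last by rewrite /w ik csq0.
  rewrite /w eqxx addr0 (_ : csq 1 = 1) ?mulr1; last by rewrite (csq_real 1) expr1n.
  have -> : fs w x = \sum_j csq (p j (node k x)).
    apply: eq_bigr => j _; rewrite (bigD1 k)//= big1 => [|i /negbTE ik]; last by rewrite /w ik mul0r.
    by rewrite /w eqxx mul1r addr0 csqJ.
  by rewrite ler_pdivrMr// ler_pdivlMr// mulrC.
move=> /(@ae_unfold (fun y => - omega <= y <= omega ->
    A / h <= \sum_j csq (p j y) <= B / h)) H.
apply: ae_imp (ae_and H (ae_ord phihat_p)) => y [Hy E]; rewrite in_itv /= => /andP[y1 y2].
under eq_bigr do rewrite E; have yo : - omega <= y <= omega by rewrite !ltW.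
exact: (Hy yo yo).
Qed.

Lemma fiberwise_cond3 A B : 0 < A -> fiberwise A B -> exists2 eta, 0 < eta &
  {ae mu, forall x, x \in Kminus omega h l \/ x \in Kplus omega h l -> eta <= normc (\det (J x))}.
Proof.
move=> A0 /fiberwise_generic fib; have [eta eta0 H] := @det_ge_rowdot R n _ A0.
exists eta => //; apply: ae_imp fib => x Hx xK; apply: H => v.
by have [_ /(_ v (@full_supported x v xK))/andP[]] := Hx (Kminus_Kplus_in xK).
Qed.

(** The dimension [2 * l - 1] is not syntactically a successor, so the general statement is
    transported along [e], which turns [last_row] into [ord_max]. *)
Lemma minors_sq_ge_rowdot_last k (e : n = k.+1) (A : R) : 0 < A -> exists2 sigma, 0 < sigma &
  forall M : 'M[R[i]]_n, (forall w, w last_row = 0 ->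
    A * \sum_i csq (w i) <= \sum_j csq (rowdot w M j)) -> sigma <= minors_sq k M.
Proof.
move=> A0; have : (last_row : nat) = k by rewrite /= e.
move: last_row; rewrite e => i0 ik.
have -> : i0 = ord_max by apply: val_inj.
exact: minors_sq_ge_rowdot.
Qed.

Lemma minors_rowdot_lower_last k (e : n = k.+1) (a sigma : R) : 0 <= a -> 0 < sigma ->
  exists2 K, 0 < K & forall M : 'M[R[i]]_n, (forall i j, csq (M i j) <= a) ->
    (forall j, M last_row j = 0) -> sigma <= minors_sq k M -> forall w, w last_row = 0 ->
    \sum_i csq (w i) <= K * \sum_j csq (rowdot w M j).
Proof.
move=> a0 s0; have : (last_row : nat) = k by rewrite /= e.
move: last_row; rewrite e => i0 ik.
have -> : i0 = ord_max by apply: val_inj.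
exact: minors_rowdot_lower.
Qed.

Lemma minor_dimE : n = (2 * l - 2).+1. Proof. lia. Qed.

Lemma fiberwise_cond2 A B : 0 < A -> fiberwise A B -> exists2 sigma, 0 < sigma &
  {ae mu, forall x, x \in Kmid omega h l -> sigma <= minors_sq (2 * l - 2) (J x)}.
Proof.
move=> A0 /fiberwise_generic fib; have [sigma s0 H] := minors_sq_ge_rowdot_last minor_dimE A0.
exists sigma => //; apply: ae_imp fib => x Hx xK; apply: H => v v0.
by have [_ /(_ v (fun=> v0))/andP[]] := Hx (Kmid_in xK).
Qed.

Section conditions.
Variable gamma : R.
Hypothesis gamma0 : 0 < gamma.
Hypothesis cond1 : {ae mu, forall y, y \in `]- omega, omega[ -> \sum_j csq (phihat j y) <= gamma}.

Lemma ae_preGramian_le : {ae mu, forall x, 0 <= x < h ->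
  generic x /\ forall r i, csq (J x r i) <= h * gamma}.
Proof.
have : {ae mu, forall y, forall i, csq (phihat i y) <= gamma}.
  apply: ae_imp (ae_and cond1 (ae_and (ae_ord phihat_p) (ae_and (ae_neq omega) (ae_neq (- omega))))).
  move=> y [H [E [y1 y2]]] i.
  have [yo|yo] := boolP (- omega <= y <= omega); last by rewrite E p0// csq0 ltW.
  apply: le_trans (H _); last first.
    by rewrite in_itv /= !lt_neqAle y1 eq_sym y2.
  rewrite (bigD1 i)//= lerDl; apply: sumr_ge0 => j _; exact: csq_ge0.
move=> /ae_node H; apply: ae_imp (ae_and H ae_generic) => x [Hx G] xh.
split; first exact: G.
move=> r i; rewrite preGramianE csqM csq_real sqr_sqrtr ?(ltW h0)// ler_pM2l//; exact: Hx.
Qed.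

Lemma rowdot_upper (M : 'M[R[i]]_n) v a : (forall r i, csq (M r i) <= a) ->
  \sum_i csq (rowdot v M i) <= n%:R * (n%:R * a) * \sum_r csq (v r).
Proof.
move=> Ma; apply: (@le_trans _ _ (\sum_(i < n) n%:R * a * \sum_r csq (v r))).
  by apply: ler_sum => i _; exact: csq_dot.
by rewrite sumr_const card_ord -[_ *+ n]mulr_natl mulrA.
Qed.

Lemma conditions_fiberwise sigma eta : 0 < sigma -> 0 < eta ->
  {ae mu, forall x, x \in Kmid omega h l -> sigma <= minors_sq (2 * l - 2) (J x)} ->
  {ae mu, forall x, x \in Kminus omega h l \/ x \in Kplus omega h l -> eta <= normc (\det (J x))} ->
  exists A B, [/\ 0 < A, A <= B & fiberwise A B].
Proof.
move=> s0 eta0 cond2 cond3.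
have a0 : 0 <= h * gamma by rewrite mulr_ge0// ltW.
have [K1 K10 H1] := @det_rowdot_lower R n _ _ a0 (exprn_gt0 2 eta0).
have [K2 K20 H2] := minors_rowdot_lower_last minor_dimE a0 s0.
(* [K1] serves K_- and K_+, [K2] serves K; the maximum with [A] secures [A <= B]. *)
pose A := Num.min K1^-1 K2^-1; pose B := Num.max A (n%:R * (n%:R * (h * gamma))).
have A0 : 0 < A by rewrite lt_min !invr_gt0 K10.
exists A, B; split => //; first by rewrite le_max lexx.
apply: ae_imp (ae_and ae_preGramian_le (ae_and cond2 cond3)) => x [G [C2 C3]] xh.
have [gx Ja] := G xh; apply/(fiber_iff _ _ gx) => v sv.
have S0 : 0 <= \sum_r csq (v r) by apply: sumr_ge0 => r _; exact: csq_ge0.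
apply/andP; split; last first.
  by rewrite (le_trans (rowdot_upper v Ja))// ler_wpM2r// le_max lexx orbT.
have full : x \in Kminus omega h l \/ x \in Kplus omega h l ->
    A * \sum_r csq (v r) <= \sum_i csq (rowdot v (J x) i).
  move=> xK; have dJ : eta ^+ 2 <= csq (\det (J x)).
    by rewrite -normc_sq lerXn2r ?nnegrE ?normc_ge0 ?(ltW eta0)//; exact: C3.
  apply: (@le_trans _ _ (K1^-1 * \sum_r csq (v r))).
    by rewrite ler_wpM2r// ge_min lexx.
  by rewrite ler_pdivrMl//; exact: H1.
case: (generic_cases gx) => xK; [exact: full (or_introl xK)| |exact: full (or_intror xK)].
apply: (@le_trans _ _ (K2^-1 * \sum_r csq (v r))).
  by rewrite ler_wpM2r// ge_min lexx orbT.
rewrite ler_pdivrMl//; apply: H2 => //; [exact: last_row0|exact: C2|exact: sv].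
Qed.

(** The pre-Gramian is transposed here: synthesis combines its columns, the generators, while the
    frame bounds concern its rows. With K empty every generic point lies in K_- or K_+, where the
    determinant is bounded below. *)
Lemma det_columns_lower eta : 0 < eta -> Kmid omega h l =i pred0 ->
  {ae mu, forall x, x \in Kminus omega h l \/ x \in Kplus omega h l -> eta <= normc (\det (J x))} ->
  exists2 K, 0 < K & {ae mu, forall x, 0 <= x < h -> forall d : 'I_n -> R[i],
    \sum_i csq (d i) <= K * \sum_(k < 2 * l) csq (\sum_i p i (node k x) * d i)}.
Proof.
move=> eta0 K_empty cond3; have a0 : 0 <= h * gamma by rewrite mulr_ge0// ltW.
have [K K0 HK] := @det_rowdot_lower R n _ _ a0 (exprn_gt0 2 eta0).
exists (K * h); first by rewrite mulr_gt0.
apply: ae_imp (ae_and ae_preGramian_le cond3) => x [G C3] xh d.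
have [gx Ja] := G xh; set b := x \in Kplus omega h l.
have xK : x \in Kminus omega h l \/ x \in Kplus omega h l.
  by case: (generic_cases gx) => xK; [left| |right] => //; rewrite K_empty in xK.
have dJ : eta ^+ 2 <= csq (\det (J x)^T).
  by rewrite det_tr -normc_sq lerXn2r ?nnegrE ?normc_ge0 ?(ltW eta0)//; exact: C3.
apply: le_trans (HK (J x)^T _ dJ d) _; first by move=> i j; rewrite mxE.
rewrite -mulrA ler_pM2l// mulr_sumr.
rewrite (sum_skip dimE (@index_inj b) (@index_skipped b)); last first.
  rewrite big1 ?csq0 ?mulr0// => i _.
  by rewrite p0 ?mul0r//; exact: skipped_out.
apply: ler_sum => r _; rewrite [rowdot _ _ _](_ : _ =
    (Num.sqrt h)%:C * \sum_i p i (node (index b r) x) * d i); last first.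
  rewrite mulr_sumr; apply: eq_bigr => i _; rewrite mxE preGramianE -/b.
  by case: (gx) => _ _ _ ->; rewrite mulrC mulrA.
by rewrite csqM csq_real sqr_sqrtr// ltW.
Qed.

End conditions.

End gramian.

(** * The synthesis operator *)

Section synthesis.
Context {R : realType}.
Notation mu := (@lebesgue_measure R).
Notation RR := (measurableTypeR R).
Variables (omega t0 h : R) (l N : nat) (phi p : 'I_N -> R -> R[i]).
Hypotheses (h0 : 0 < h) (t00 : 0 < t0) (ht : h * t0 = 2 * pi) (oh : omega < l%:R * h).
Hypothesis phip : forall j, fourier (phi j) (p j).
Hypothesis p0 : forall j x, ~~ (- omega <= x <= omega) -> p j x = 0.
Variable K : R.
Hypothesis K0 : 0 < K.
Hypothesis columns : {ae mu, forall x, 0 <= x < h -> forall d : 'I_N -> R[i],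
  \sum_i csq (d i) <= K * \sum_(k < 2 * l) csq (\sum_i p i (node h l k x) * d i)}.

Definition trig_sum (d : int -> 'I_N -> R[i]) (k : nat) (j : 'I_N) (x : R) : R[i] :=
  \sum_(m < (2 * k).+1) d (m%:Z - k%:Z) j * expi ((m%:Z - k%:Z)%:~R * t0 * x).

Lemma trig_sum_node d k j i x : trig_sum d k j (node h l i x) = trig_sum d k j x.
Proof.
apply: eq_bigr => m _; congr (_ * _); rewrite /node.
have -> : (m%:Z - k%:Z)%:~R * t0 * (x + (i%:R - l%:R) * h) =
    (m%:Z - k%:Z)%:~R * t0 * x + ((m%:Z - k%:Z) * (i%:Z - l%:Z))%:~R * (2 * pi).
  by rewrite -ht intrM [(i%:Z - l%:Z)%:~R]intrB -!pmulrn; ring.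
by rewrite expiD expi2pi_int mulr1.
Qed.

Lemma fourier_synthesis d k :
  fourier (synthesis_partial t0 phi d k) (fun x => \sum_j p j x * trig_sum d k j x).
Proof.
have := fourier_sum (index_enum _) (fun j : 'I_N => fourier_sum (index_enum _)
  (fun m : 'I_(2 * k).+1 => fourierZ (d (m%:Z - k%:Z) j)
    (fourier_shift ((m%:Z - k%:Z)%:~R * t0) (phip j)))).
congr fourier; apply/funext => x; apply: eq_bigr => j _.
by rewrite mulr_sumr; apply: eq_bigr => m _; rewrite mulrCA.
Qed.

(** The trigonometric sums are [h]-periodic, so along each fiber they are a constant vector to which
    [columns] applies. Over the tile the exponentials are orthogonal with squared norm [h], which
    recovers the coefficients. *)
Lemma synthesis_lower d k n j : (absz n <= k)%N ->
  h * csq (d n j) <= K * n2 mu (synthesis_partial t0 phi d k).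
Proof.
move=> nk; have fS := fourier_synthesis d k; have [_ Lg] := fourier_inL2 fS.
rewrite (fourier_isometry fS); set g := (fun x => _) in Lg *.
have g0 x : ~~ (- omega <= x <= omega) -> g x = 0.
  by move=> xo; apply: big1 => i _; rewrite p0// mul0r.
have [ie Ie] := energyE h0 oh Lg g0.
pose e (m : 'I_(2 * k).+1) (x : RR) := (tile h x)%:C * expi (((m%:Z - k%:Z)%:~R * t0 + 0) * x).
have Le m : inL2 mu (e m) by exact: inL2_tile_expi.
have oe m m' : ip mu (e m) (e m') = if m == m' then h%:C else 0.
  by rewrite expi_tile_orthogonal// (inj_eq (addIr _)) eqz_nat.
pose b i (m : 'I_(2 * k).+1) := d (m%:Z - k%:Z) i.
pose T i (x : RR) := \sum_m b i m * e m x.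
have LT i : inL2 mu (T i) by apply: inL2_sum => m; exact: inL2Z.
have TE i x : T i x = (tile h x)%:C * trig_sum d k i x.
  by rewrite mulr_sumr; apply: eq_bigr => m _; rewrite /e addr0 mulrCA.
have [iT IT] := Rintegral_sum (fun i => inL2_csq (LT i)).
apply: (@le_trans _ _ (\sum_i n2 mu (T i))).
  rewrite (bigD1 j)//= (n2_orthogonal Le oe) -[leLHS]addr0 lerD//; last first.
    by apply: sumr_ge0 => i _; exact: n2_ge0.
  rewrite ler_pM2l//.
  have nk' : (absz (n + k%:Z)%R < (2 * k).+1)%N by lia.
  rewrite (bigD1 (Ordinal nk'))//= /b /= (_ : (absz _)%:Z - k%:Z = n); last by lia.
  by rewrite lerDl; apply: sumr_ge0 => i _; exact: csq_ge0.
rewrite -IT -Ie -RintegralZl//; apply: le_Rintegral_ae => //; first exact: intRZ.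
apply: ae_imp columns => x Hx; rewrite /energy.
under eq_bigr do rewrite TE csq_tile; rewrite -mulr_sumr tileE.
have [xh|_] := boolP (0 <= x < h); last by rewrite !mul0r mulr0.
rewrite !mul1r; have := Hx xh (fun i => trig_sum d k i x).
congr (_ <= K * _); apply: eq_bigr => i _; congr csq.
by apply: eq_bigr => i' _; rewrite trig_sum_node.
Qed.

(** The partial sums of [c - c'] tend to 0 in L2, and by [synthesis_lower] they dominate each
    coefficient once its index is in the window. *)
Lemma synthesis_injective c c' f : synthesis omega t0 phi c f -> synthesis omega t0 phi c' f ->
  forall n j, c n j = c' n j.
Proof.
have LS d k : inL2 mu (synthesis_partial t0 phi d k) by exact: (fourier_inL2 (fourier_synthesis d k)).1.
move=> [bf cf] [_ cf'] n j; have Lf : inL2 mu f by rewrite -L2E; case: bf.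
have {}cf := (L2cvgE (LS c) Lf).1 cf; have {}cf' := (L2cvgE (LS c') Lf).1 cf'.
pose d n j := c n j - c' n j.
apply/eqP; rewrite -subr_eq0; apply/eqP; apply: csq_eq0; apply/eqP.
rewrite eq_le csq_ge0 andbT -(ler_pM2l h0) mulr0 -/(d n j).
pose u k := K * (2 * n2 mu (fun x => synthesis_partial t0 phi c k x - f x) +
  2 * n2 mu (fun x => synthesis_partial t0 phi c' k x - f x)).
have cu : u k @[k --> \oo] --> (0 : R).
  have -> : 0 = K * (2 * 0 + 2 * 0) by rewrite !mulr0 addr0 mulr0.
  apply: cvgM; first exact: cvg_cst.
  by apply: cvgD; apply: cvgM => //; exact: cvg_cst.
rewrite -(cvg_lim _ cu)//; apply: limr_ge; first by apply: cvgP; exact: cu.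
exists (absz n) => // k /= nk; apply: le_trans (synthesis_lower d j nk) _.
rewrite /u ler_pM2l//.
have Lc := inL2B (LS c k) Lf; have Lc' := inL2B (LS c' k) Lf.
have := n2_le2 Lc (inL2N Lc'); rewrite n2N; apply: le_trans.
rewrite le_eqVlt; apply/orP; left; apply/eqP; congr n2; apply/funext => x.
transitivity (synthesis_partial t0 phi c k x - synthesis_partial t0 phi c' k x); last by ring.
rewrite /synthesis_partial -sumrB; apply: eq_bigr => i _.
by rewrite -sumrB; apply: eq_bigr => m _; rewrite mulrBl.
Qed.

End synthesis.

Unset Implicit Arguments.

Theorem theorem3p7 (R : realType) (omega t0 : R) (l : nat)
    (phi phihat : 'I_(2 * l - 1) -> R -> R[i]) :
  let h := 2 * pi / t0 in
  let mu := @lebesgue_measure R in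
  let J := preGramian omega t0 phihat in
  let cond1 (delta gamma : R) :=
    {ae mu, forall xi, xi \in `]- omega, omega[ ->
      delta <= \sum_(j < 2 * l - 1) normc (phihat j xi) ^+ 2 <= gamma} in
  let cond2 (sigma : R) :=
    {ae mu, forall x, x \in Kmid omega h l ->
      sigma <= minors_sq (2 * l - 2) (J x)} in
  let cond3 (eta : R) :=
    {ae mu, forall x, x \in Kminus omega h l \/ x \in Kplus omega h l ->
      eta <= normc (\det (J x))} in
  0 < omega -> 0 < t0 -> (2 <= l)%N ->
  omega / (l%:R - 2^-1) <= h < omega / (l%:R - 1) ->
  (forall j, bandlimited omega (phi j)) ->
  (forall j, fourier (phi j) (phihat j)) ->
  (is_frame omega t0 phi <->
    exists delta gamma sigma eta : R,
      [/\ 0 < delta, 0 < gamma, 0 < sigma & 0 < eta] /\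
      [/\ cond1 delta gamma, cond2 sigma & cond3 eta]) /\
  (h = omega / (l%:R - 2^-1) ->
    (is_riesz_basis omega t0 phi <->
      exists delta gamma eta : R,
        [/\ 0 < delta, 0 < gamma & 0 < eta] /\
        cond1 delta gamma /\ cond3 eta)).
Proof.
move=> h mu J cond1 cond2 cond3 omega0 t00 l2 /andP[h_le h_lt'] bphi fphi.
have hE : h = 2 * pi / t0 by [].
have h0 : 0 < h by rewrite divr_gt0// mulr_gt0// pi_gt0.
have ht : h * t0 = 2 * pi by rewrite hE divfK// gt_eqF.
clearbody h.
have l2R : 2 <= l%:R :> R by rewrite ler_nat.
have h_ge : 2 * omega <= (2 * l%:R - 1) * h.
  move: h_le; rewrite ler_pdivrMr; last by lra.
  by move: l2R => _ ?; lra.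
have h_lt : (l%:R - 1) * h < omega.
  by move: h_lt'; rewrite ltr_pdivlMr 1?mulrC//; lra.
(* The given transforms are arbitrary representatives; [p] vanishes everywhere outside the band and
   agrees with them almost everywhere. *)
pose p j := cutoff omega (phihat j).
have p0 j x : ~~ (- omega <= x <= omega) -> p j x = 0 by exact: cutoff0.
have fp j : fourier (phi j) (p j) := (bandlimited_cutoff (bphi j) (fphi j)).1.
have phihat_p j : {ae mu, forall x, phihat j x = p j x} := (bandlimited_cutoff (bphi j) (fphi j)).2.
have oh := band_lt h0 h_ge.
have normc_csq y : \sum_(j < 2 * l - 1) normc (phihat j y) ^+ 2 = \sum_j csq (phihat j y).
  by apply: eq_bigr => j _; rewrite normc_sq.
have frame_of delta gamma sigma eta : 0 < gamma -> 0 < sigma -> 0 < eta ->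
    cond1 delta gamma -> cond2 sigma -> cond3 eta -> is_frame omega t0 phi.
  move=> gamma0 sigma0 eta0 c1 c2 c3.
  have c1' : {ae mu, forall y, y \in `]- omega, omega[ -> \sum_j csq (phihat j y) <= gamma}.
    by apply: ae_imp c1 => y Hy yo; have /andP[_] := Hy yo; rewrite normc_csq.
  have [A [B [A0 AB fib]]] :=
    conditions_fiberwise hE l2 omega0 h0 h_ge h_lt p0 phihat_p gamma0 c1' sigma0 eta0 c2 c3.
  exact: (@fiberwise_frame R omega t0 h l _ phi p h0 t00 ht oh fp A B A0 AB fib).
have conds_of : is_frame omega t0 phi -> exists delta gamma sigma eta : R,
      [/\ 0 < delta, 0 < gamma, 0 < sigma & 0 < eta] /\
      [/\ cond1 delta gamma, cond2 sigma & cond3 eta].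
  move=> [A [B [A0 AB frameAB]]].
  have fib := frame_fiberwise_bounds h0 t00 ht oh fp frameAB.
  have c1 := fiberwise_cond1 h0 h_ge phihat_p fib.
  have [sigma sigma0 c2] := fiberwise_cond2 hE l2 omega0 h0 h_ge h_lt p0 phihat_p A0 fib.
  have [eta eta0 c3] := fiberwise_cond3 hE l2 omega0 h0 h_ge h_lt p0 phihat_p A0 fib.
  exists (A / h), (B / h), sigma, eta; split; first by split; rewrite ?divr_gt0// (lt_le_trans A0).
  split => //; apply: ae_imp c1 => y Hy yo; rewrite normc_csq; exact: Hy.
split.
  split; first exact: conds_of.
  move=> [delta [gamma [sigma [eta [[d0 g0 s0 e0] [c1 c2 c3]]]]]].
  exact: frame_of g0 s0 e0 c1 c2 c3.
move=> h_eq; have K_empty : Kmid omega h l =i pred0.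
  move=> x; rewrite in_Kmid inE; apply/negP => /andP[x1 x2].
  have : omega = h * (l%:R - 2^-1) by rewrite h_eq divfK// gt_eqF//; lra.
  by move=> oE; lra.
split=> [[/conds_of[delta [gamma [sigma [eta [[d0 g0 s0 e0] [c1 c2 c3]]]]]] _]|].
  by exists delta, gamma, eta.
move=> [delta [gamma [eta [[d0 g0 e0] [c1 c3]]]]].
(* Condition (2) is vacuous on the empty interval, so any positive constant, here 1, can be used. *)
have c2 : cond2 1 by apply: aeW => x; rewrite K_empty.
split; first exact: frame_of g0 ltr01 e0 c1 c2 c3.
move=> c c' _ _ f.
have c1' : {ae mu, forall y, y \in `]- omega, omega[ -> \sum_j csq (phihat j y) <= gamma}.
  by apply: ae_imp c1 => y Hy yo; have /andP[_] := Hy yo; rewrite normc_csq.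
have [K K0 col] := det_columns_lower hE l2 omega0 h0 h_ge h_lt p0 phihat_p g0 c1' e0 K_empty c3.
exact: (synthesis_injective h0 t00 ht oh fp p0 K0 col).
Qed.
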